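(* Let $N\ge 2$ and let $$g(x)=\frac{|x|^\alpha}{\alpha}-\frac{|x|^\beta}{\beta},\qquad x\in\mathbb{R}^N,$$ with $\alpha>\beta\ge 2$, $\alpha\ge 4$ and $(\alpha,\beta)\ne(4,2)$. Then there exists $\overline m>0$ such that for every $0<m<\overline m$, every minimizer of $$\min\Bigl\{\mathcal{E}(h) : h\in L^1(\mathbb{R}^N),\ 0\le h\le 1,\ \|h\|_1=m\Bigr\}$$ is (up to Lebesgue-null sets) the characteristic function of some set $E_m$, which is then a minimizer of $\min\{\mathcal{E}(E): E\subseteq\mathbb{R}^N,\ |E|=m\}$. Moreover, for $m$ small, $E_m$ consists of $N+1$ convex components, each of which is contained in a small neighborhood of a vertex of $\Delta_N$; that is, for every $\varepsilon>0$ there is $m_\varepsilon\in(0,\overline m]$ such that for every $0<m<m_\varepsilon$ and every such $E_m$, up to a rigid motion and up to Lebesgue-null sets, $E_m=\bigcup_{i=1}^{N+1}E_m^i$ with the $E_m^i$ pairwise disjoint, convex, non-empty, and $E_m^i\subseteq B_\varepsilon(x_i)$ for every $i$, where $x_1,\dots,x_{N+1}$ are the points of $\Delta_N$.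
   Context: For a density $h\in L^1(\mathbb{R}^N;[0,1])$, $\mathcal{E}(h)=\int_{\mathbb{R}^N}\int_{\mathbb{R}^N} g(x-y)h(x)h(y)\,dx\,dy$; for a measurable set $E$ of finite volume, $\mathcal{E}(E)=\int_E\int_E g(x-y)\,dx\,dy$, i.e. the energy of its characteristic function. $|E|$ is Lebesgue measure. $\Delta_N=\{x_1,\dots,x_{N+1}\}\subset\mathbb{R}^N$ is the set of vertices of the standard regular $(N+1)$-gon (regular simplex) centered at the origin, with mutual distances $|x_i-x_j|=1$ for $i\ne j$. $B_\varepsilon(x)$ is the ball of radius $\varepsilon$ centered at $x$. *)

(* Defs.v *)
From HB Require Import structures.
From mathcomp Require Import all_boot all_order all_algebra.
From mathcomp Require Import all_classical all_reals all_analysis.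
From mathcomp Require Import ring.

Set Implicit Arguments.
Unset Strict Implicit.
Unset Printing Implicit Defensive.

Import Order.TTheory GRing.Theory Num.Theory.
Import numFieldNormedType.Exports.

Local Open Scope classical_set_scope.
Local Open Scope ring_scope.

(* MathComp-Analysis has no Lebesgue measure on R^n. As for its Lebesgue
   measure on R, the sigma-algebra taken on 'rV[R]_n is the Borel one, and the
   measure is not completed: every L^1 class has a Borel representative, and
   "up to null sets" is expressed with [negligible] and {ae _, _}, which do not
   need the sets involved to be Borel. *)
Definition measure_rV_display : measure_display.
Proof. exact: default_measure_display. Qed.

Section measurable_rV.
Context (R : realType) (n : nat).

Let coors (i : 'I_n) (x : 'rV[R]_n) : measurableTypeR R := x ord0 i.

Let rV_set0 : g_sigma_preimage coors set0.
Proof. exact: sigma_algebra0. Qed.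

Let rV_setC A : g_sigma_preimage coors A -> g_sigma_preimage coors (~` A).
Proof. exact: sigma_algebraC. Qed.

Let rV_bigcup (F : _^nat) : (forall i, g_sigma_preimage coors (F i)) ->
  g_sigma_preimage coors (\bigcup_i (F i)).
Proof. exact: sigma_algebra_bigcup. Qed.

HB.instance Definition _ := @isMeasurable.Build measure_rV_display
  'rV[R]_n (g_sigma_preimage coors) rV_set0 rV_setC rV_bigcup.

Lemma measurable_coord (i : 'I_n) :
  measurable_fun [set: 'rV[R]_n] (fun x => x ord0 i : measurableTypeR R).
Proof.
move=> _ Y mY; rewrite setTI; apply: sub_sigma_algebra => /=.
rewrite -bigcup_seq/=; exists i => /=; first by rewrite mem_index_enum.
by exists Y => //; rewrite setTI.
Qed.

Lemma measurable_rVP d (T : measurableType d) (f : T -> 'rV[R]_n) :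
  (forall i, measurable_fun setT (fun x => f x ord0 i : measurableTypeR R)) ->
  measurable_fun setT f.
Proof.
move=> mf.
have : g_sigma_preimage (fun i => (coors i) \o f) `<=` measurable.
  apply: smallest_sub; first exact: sigma_algebra_measurable.
  move=> A; rewrite -bigcup_seq => -[i _] [B mB <-]; exact: mf.
rewrite g_sigma_preimage_comp => prefS _ A mA; apply: prefS; exists A => //.
Qed.
End measurable_rV.

Section rV_cons.
Context (R : realType) (n : nat).

Definition rV_cons (p : measurableTypeR R * 'rV[R]_n) : 'rV[R]_n.+1 :=
  row_mx (p.1 : R)%:M p.2.

Lemma rV_cons0 p : rV_cons p ord0 ord0 = p.1.
Proof.
rewrite /rV_cons; have -> : ord0 = lshift n (ord0 : 'I_1) :> 'I_(1 + n).
  exact: val_inj.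
by rewrite (@row_mxEl _ 1 1 n) mxE eqxx mulr1n.
Qed.

Lemma rV_consS p (j : 'I_n) : rV_cons p ord0 (lift ord0 j) = p.2 ord0 j.
Proof.
rewrite /rV_cons; have -> : lift ord0 j = rshift 1 j :> 'I_(1 + n).
  exact: val_inj.
by rewrite (@row_mxEr _ 1 1 n).
Qed.

Lemma measurable_rV_cons : measurable_fun setT rV_cons.
Proof.
apply: measurable_rVP => i; case: (unliftP ord0 i) => [j|] ->.
  rewrite [X in measurable_fun _ X](_ : _ =
    (fun x : 'rV[R]_n => x ord0 j : measurableTypeR R) \o snd).
    apply: measurableT_comp; [exact: measurable_coord|exact: measurable_snd].
  by apply/funext => p /=; rewrite rV_consS.
rewrite [X in measurable_fun _ X](_ : _ = fst); first exact: measurable_fst.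
by apply/funext => p /=; rewrite rV_cons0.
Qed.

End rV_cons.

Section lebesgue_rV_succ.
Local Open Scope ereal_scope.
Context (R : realType) (n : nat).
Variable m : {sigma_finite_measure set 'rV[R]_n -> \bar R}.

Definition lebesgue_rV_succ : set 'rV[R]_n.+1 -> \bar R :=
  pushforward (@lebesgue_measure R \x m) (@rV_cons R n).

Let succ0 : lebesgue_rV_succ set0 = 0.
Proof. by rewrite /lebesgue_rV_succ /pushforward preimage_set0 measure0. Qed.

Let succ_ge0 A : 0 <= lebesgue_rV_succ A.
Proof. by rewrite /lebesgue_rV_succ /pushforward; exact: measure_ge0. Qed.

Let mpre A : measurable A -> measurable (@rV_cons R n @^-1` A).
Proof.
by move=> mA; rewrite -[X in measurable X]setTI; exact: measurable_rV_cons.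
Qed.

Let succ_sigma_additive : semi_sigma_additive lebesgue_rV_succ.
Proof.
move=> F mF tF mUF; rewrite /lebesgue_rV_succ /pushforward preimage_bigcup.
apply: measure_semi_sigma_additive => [k||].
- exact: mpre.
- apply/trivIsetP => /= i j _ _ ij; rewrite -preimage_setI.
  by move/trivIsetP : tF => /(_ _ _ _ _ ij) ->//; rewrite preimage_set0.
- by rewrite -preimage_bigcup; exact: mpre.
Qed.

HB.instance Definition _ := isMeasure.Build _ _ _
  lebesgue_rV_succ succ0 succ_ge0 succ_sigma_additive.

Let uncons (v : 'rV[R]_n.+1) : measurableTypeR R * 'rV[R]_n :=
  (v ord0 ord0, \row_(j < n) v ord0 (lift ord0 j)).

Let rV_consK : cancel (@rV_cons R n) uncons.
Proof.
case=> t v; rewrite /uncons rV_cons0; congr pair.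
by apply/rowP => j; rewrite mxE rV_consS.
Qed.

Let measurable_uncons : measurable_fun setT uncons.
Proof.
apply: measurable_fun_pair; first exact: measurable_coord.
apply: measurable_rVP => j.
rewrite [X in measurable_fun _ X](_ : _ = fun v : 'rV[R]_n.+1 =>
    v ord0 (lift ord0 j) : measurableTypeR R).
  exact: measurable_coord.
by apply/funext => v; rewrite mxE.
Qed.

Let succ_sigma_finite : sigma_finite setT lebesgue_rV_succ.
Proof.
have /sigma_finiteP[F [TF ndF Foo]] := @sigma_finiteT _ _ _ (@lebesgue_measure R).
have /sigma_finiteP[G [TG ndG Goo]] := sigma_finiteT m.
exists (fun k => uncons @^-1` (F k `*` G k)).
  rewrite -preimage_bigcup [X in _ @^-1` X](_ : _ = setT) ?preimage_setT//.
  rewrite -setXTT TF TG predeqE => -[x y]; split.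
    by move=> [k _ []/= ? ?]; split; exists k.
  move=> [/= [i _ Fix] [j _ Gjy]]; exists (maxn i j) => //; split.
  - by move: x Fix; exact/subsetPset/ndF/leq_maxl.
  - by move: y Gjy; exact/subsetPset/ndG/leq_maxr.
move=> k; have [mF Fk] := Foo k; have [mG Gk] := Goo k; split.
  rewrite -[X in measurable X]setTI; apply: measurable_uncons => //.
  exact: measurableX.
rewrite /lebesgue_rV_succ /pushforward -comp_preimage.
rewrite (_ : uncons \o _ = id); last by apply/funext => p; exact: rV_consK.
by rewrite preimage_id product_measure1E// lte_mul_pinfty// ge0_fin_numE.
Qed.

HB.instance Definition _ := Measure_isSigmaFinite.Build _ _ _
  lebesgue_rV_succ succ_sigma_finite.

End lebesgue_rV_succ.

(* Characterized by its values on boxes, see [lebesgue_rV_box]. *)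
Fixpoint lebesgue_rV (R : realType) (n : nat) :
    {sigma_finite_measure set 'rV[R]_n -> \bar R} :=
  match n with
  | 0 => \d_ (0 : 'rV[R]_0)
  | n'.+1 => lebesgue_rV_succ (lebesgue_rV R n')
  end.

Lemma lebesgue_rV_box (R : realType) (n : nat) (A : 'I_n -> set R) :
  (forall i, measurable (A i : set (measurableTypeR R))) ->
  lebesgue_rV R n [set v | forall i, A i (v ord0 i)] =
  (\prod_(i < n) lebesgue_measure (A i))%E.
Proof.
elim: n A => [A mA|n IHn A mA].
  by rewrite big_ord0 /= diracE mem_set//; case.
rewrite big_ord_recl -IHn//.
rewrite -(@product_measure1E _ _ _ _ _ _ (lebesgue_rV R n)) //.
- rewrite /= /lebesgue_rV_succ /pushforward; congr (product_measure1 _ _ _).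
  apply/seteqP; split => [[t v] /= tv|[t v] /= [At Av] i].
    split; first by have := tv ord0; rewrite rV_cons0.
    by move=> i; have := tv (lift ord0 i); rewrite rV_consS.
  by case: (unliftP ord0 i) => [j|] ->; rewrite (rV_consS, rV_cons0).
- rewrite [X in measurable X](_ : _ = \bigcap_(i in [set: 'I_n])
    (setT `&` (fun v : 'rV[R]_n => v ord0 i : measurableTypeR R) @^-1` A (lift ord0 i))).
    apply: fin_bigcap_measurable => // i _; exact: measurable_coord.
  by apply/seteqP; split => [v Av i _|v Av i]; [split=> //; exact: Av|have [] := Av i I].
Qed.

Section euclidean.
Context (R : realType) (N : nat).
Implicit Types x y : 'rV[R]_N.

(* the library norm `|x| on 'rV[R]_N is the sup norm *)
Definition enorm x : R := Num.sqrt (\sum_(i < N) x ord0 i ^+ 2).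

Definition eball x (r : R) : set 'rV[R]_N := [set y | enorm (y - x) < r].

(* Q need not have determinant 1. When a set is
   moved onto a union of pieces near the vertices of a regular simplex, nothing
   is lost by this: composing with the reflection that swaps
   two vertices and relabelling the sets makes the motion orientation
   preserving. *)
Definition rigid_motion (T : 'rV[R]_N -> 'rV[R]_N) : Prop :=
  exists (Q : 'M[R]_N) (v : 'rV[R]_N),
    Q *m Q^T = 1%:M /\ forall x, T x = x *m Q + v.

(* The vertices are determined up to a rigid motion fixing the origin, and up
   to relabelling; see [regular_simplex_exists]. *)
Definition regular_simplex (x : 'I_N.+1 -> 'rV[R]_N) : Prop :=
  \sum_i x i = 0 /\ forall i j, i != j -> enorm (x i - x j) = 1.

End euclidean.

Section energy.
Context (R : realType) (N : nat).
Local Notation mu := (lebesgue_rV R N).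
Implicit Types (g h : 'rV[R]_N -> R) (E : set 'rV[R]_N) (m : R).

Definition power_kernel (alpha beta : R) (x : 'rV[R]_N) : R :=
  enorm x `^ alpha / alpha - enorm x `^ beta / beta.

(* The library integral is the difference of the integrals of the positive and
   negative parts. For g = power_kernel alpha beta, which is bounded below, and
   h in L^1 with 0 <= h <= 1, the energy is well defined in ]-oo, +oo]. *)
Definition energy g h : \bar R :=
  (\int[mu]_x \int[mu]_y (g (x - y) * h x * h y)%:E)%E.

Definition set_energy g E : \bar R :=
  (\int[mu]_(x in E) \int[mu]_(y in E) (g (x - y))%:E)%E.

(* As h stands for an L^1 class, its bounds are required almost everywhere. *)
Definition density m h : Prop :=
  [/\ mu.-integrable setT (EFin \o h), {ae mu, forall x, 0 <= h x <= 1}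
    & 'N[mu]_1%E [EFin \o h]%E = m%:E].

Definition density_minimizer g m h : Prop :=
  density m h /\ forall k, density m k -> (energy g h <= energy g k)%E.

Definition set_minimizer g m E : Prop :=
  [/\ measurable E, mu E = m%:E
    & forall F, measurable F -> mu F = m%:E ->
      (set_energy g E <= set_energy g F)%E].

Definition ae_characteristic h E : Prop :=
  measurable E /\ {ae mu, forall x, h x = \1_E x}.

End energy.

Lemma regular_simplex_exists (R : realType) (N : nat) : (0 < N)%N ->
  exists x : 'I_N.+1 -> 'rV[R]_N, regular_simplex x.
Proof.
move=> N0; have Nn0 : N%:R != 0 :> R by rewrite pnatr_eq0 -lt0n.
pose r : R := (Num.sqrt 2)^-1; pose c : R := (Num.sqrt N.+1%:R - 1) / N%:R.
pose a : R := (c - 1) / N.+1%:R.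
have r2 : r ^+ 2 * 2 = 1 by rewrite /r exprVn sqr_sqrtr// mulVf.
have c2 : N%:R * c ^+ 2 + 2 * c = 1.
  have : Num.sqrt N.+1%:R ^+ 2 = N.+1%:R :> R by rewrite sqr_sqrtr.
  rewrite /c -natr1; set s := Num.sqrt _ => s2.
  have -> : N%:R * ((s - 1) / N%:R) ^+ 2 + 2 * ((s - 1) / N%:R) =
    (s ^+ 2 - 1) / N%:R by field.
  by rewrite s2 addrK divff.
clearbody r.
have ca : a + 1 + N%:R * a = c.
  have Sn0 : N%:R + 1 != 0 :> R by rewrite natr1 pnatr_eq0.
  by rewrite /a -natr1; field.
clearbody a c.
have sumeq (k : 'I_N) : \sum_(l < N) (l == k)%:R = 1 :> R.
  by rewrite (bigD1 k)//= eqxx big1 ?addr0// => l /negPf ->.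
pose v (k : 'I_N) : 'rV[R]_N := \row_l (r * ((l == k)%:R + a)).
pose w : 'rV[R]_N := \row_l (- r * (1 + N%:R * a)).
pose x (i : 'I_N.+1) := if unlift ord0 i is Some k then v k else w.
have x0 : x ord0 = w by rewrite /x unlift_none.
have xS k : x (lift ord0 k) = v k by rewrite /x liftK.
have enormN y : enorm (- y) = enorm y :> R.
  by rewrite /enorm; congr Num.sqrt; apply: eq_bigr => l _; rewrite mxE sqrrN.
have sqw (l k : 'I_N) : (r * ((l == k)%:R + a) - - r * (1 + N%:R * a)) ^+ 2 =
    r ^+ 2 * (1 + 2 * c) * (l == k)%:R + r ^+ 2 * c ^+ 2.
  by rewrite -{}ca; case: (l == k); rewrite /= ?mulr1n ?mulr0n; ring.
have sqv (l k j : 'I_N) : k != j ->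
    (r * ((l == k)%:R + a) - r * ((l == j)%:R + a)) ^+ 2 =
    r ^+ 2 * (l == k)%:R + r ^+ 2 * (l == j)%:R.
  move=> kj; have [->|lk] := eqVneq l k.
    by rewrite (negPf kj) /= ?mulr1n ?mulr0n; ring.
  by case: (l == j); rewrite /= ?mulr1n ?mulr0n; ring.
have vw k : enorm (v k - w) = 1.
  rewrite /enorm (_ : \sum_(l < N) _ = 1) ?sqrtr1//.
  under eq_bigr => l _.
    rewrite !mxE (_ : _ ^+ 2 = r ^+ 2 * (1 + 2 * c) * (l == k)%:R +
                              r ^+ 2 * c ^+ 2); last first.
      exact: sqw.
    over.
  rewrite big_split /= -mulr_sumr sumeq sumr_const card_ord -mulr_natl.
  transitivity (r ^+ 2 * (1 + (N%:R * c ^+ 2 + 2 * c))); first by ring.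
  by rewrite c2 -[1 + 1]/(2) r2.
have vv k j : k != j -> enorm (v k - v j) = 1.
  move=> kj; rewrite /enorm (_ : \sum_(l < N) _ = 1) ?sqrtr1//.
  under eq_bigr => l _.
    rewrite !mxE (_ : _ ^+ 2 = r ^+ 2 * (l == k)%:R + r ^+ 2 * (l == j)%:R);
      last first.
      exact: sqv.
    over.
  by rewrite big_split /= -!mulr_sumr !sumeq !mulr1 -[RHS]r2; ring.
exists x; split.
  rewrite big_ord_recl x0; under eq_bigr do rewrite xS.
  apply/rowP => l; rewrite !mxE summxE; under eq_bigr do rewrite mxE.
  rewrite -mulr_sumr big_split /= sumr_const card_ord -mulr_natl.
  under eq_bigr do rewrite eq_sym.
  by rewrite sumeq; ring.
move=> i j; case: (unliftP ord0 i) => [k|] ->; case: (unliftP ord0 j) => [l|] ->.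
- by rewrite !xS (inj_eq (@lift_inj _ ord0)) => /vv.
- by rewrite xS x0 vw.
- by rewrite xS x0 -enormN opprB vw.
- by rewrite eqxx.
Qed.

(* Main.v *)
Require Import Defs.
From mathcomp Require Import all_boot all_order all_algebra.
From mathcomp Require Import all_classical all_reals all_analysis.
From mathcomp Require Import measurable_realfun ring lra.

(** Let [gamma = 1/beta - 1/alpha] and let
    [f r = r^alpha/alpha - r^beta/beta + gamma] be the radial profile of the
    kernel, shifted so that its minimum, attained at [r = 1] only, is 0 (see
    [profile]).  On densities of mass [m] the shift adds the constant
    [gamma m^2] to the energy, which becomes the interaction energy of a
    nonnegative kernel worth [gamma] at distance 0 and 0 at distance 1.

    Concentration.  The profile satisfies [f r >= gamma (r^2 - 1)^2], with
    equality only at 0 and 1: in the variable [s = r^2] this is a comparison of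
    Bernoulli type between two powers ([powR_quartic_gap]).  The quartic kernel
    is a polynomial, its energy is a function of a few moments, and it is at
    least [m^2/(N+1)] ([quartic_energy_ge]).  Conversely [N+1] tiny cubes at the
    vertices of a regular simplex have interaction energy about
    [gamma m^2/(N+1)] when [m] is small.  For a minimizer the part of the energy
    that comes from [f r - gamma (r^2 - 1)^2] is therefore negligible: most
    pairs of points are at distance about 0 or about 1.  As [N+2] points cannot
    be almost at distance 1 from each other, the mass lies in at most [N+1]
    small clusters ([clusters_exist]); the self-interaction of the clusters
    forces their number to be [N+1] and their masses to be almost equal
    ([cluster_arithmetic]); and an almost regular simplex is close to a regular
    one up to a rigid motion ([almost_simplex_aligns]).

    Bathtub.  The first variation shows that a minimizer is 1 where its
    potential is below some level [lambda] and 0 where the potential is above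
    it ([minimizer_bathtub]).  The potential is about [gamma m/(N+1)] near the
    vertices and larger by a fixed proportion elsewhere, while a cube of fixed
    size near a vertex is enough room for the whole mass; hence the minimizer
    vanishes outside small balls around the vertices ([minimizers_localize]).

    Convexity.  On each of these balls the potential is strictly convex
    ([potential_strictly_convex]).  The cluster around another vertex, in the
    direction [e], contributes to the second difference along [v] about
    [2 kappa (v.e)^2], where [4 kappa = alpha - beta] is the second derivative
    of [f] at 1, and these terms add up to at least [kappa |v|^2] because the
    vertices of the simplex form a frame ([simplex_frame]).  The cluster around
    the vertex itself takes away at most [sigma |v|^2] with [sigma < kappa];
    here [(alpha, beta) <> (4, 2)] is used once more.  So the part of each ball
    where the potential is below [lambda] is convex, and the part where it
    equals [lambda] has no point strictly between two others: it meets every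
    line in at most two points and is null by Fubini's theorem.  The minimizer
    is therefore the characteristic function of [N+1] convex pieces. *)

Set Implicit Arguments.
Unset Strict Implicit.
Unset Printing Implicit Defensive.

Import Order.TTheory GRing.Theory Num.Theory.
Import numFieldNormedType.Exports.

Local Open Scope classical_set_scope.
Local Open Scope ring_scope.

(** * Bernoulli inequalities and a comparison of two powers *)

Section bernoulli.
Context (R : realType).
Implicit Types u t p s a b : R.

Lemma ln_lt_subr1 u : 0 < u -> u != 1 -> ln u < u - 1.
Proof.
move=> u0 u1; have lu0 : ln u != 0 by rewrite ln_eq0.
by have := expR_gt1Dx lu0; rewrite lnK ?posrE// ltrBrDl.
Qed.

Lemma ln_le_subr1 u : 0 < u -> ln u <= u - 1.
Proof.
move=> u0; have [->|u1] := eqVneq u 1; first by rewrite ln1 subrr.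
exact/ltW/ln_lt_subr1.
Qed.

(** With [A] the right-hand side, [ln y < y - 1] at [y = u / A] and [ln y <= y - 1]
    at [y = 1 / A]; the combination of these bounds with weights [t] and [1 - t]
    has right-hand side 0 and left-hand side [t ln u - ln A]. *)
Lemma powR_lt_tangent u t : 0 < u -> u != 1 -> 0 < t -> t < 1 ->
  u `^ t < 1 + t * (u - 1).
Proof.
move=> u0 u1 t0 t1; pose A := 1 + t * (u - 1).
have A0 : 0 < A by rewrite /A; nra.
have Ai0 : 0 < A^-1 by rewrite invr_gt0.
have uA1 : u / A != 1.
  apply/eqP => /(congr1 ( *%R^~ A)); rewrite mulfVK ?gt_eqF// mul1r => uA.
  have : (1 - t) * (u - 1) = 0 by move: uA; rewrite /A; lra.
  by move/eqP; rewrite mulf_eq0 !subr_eq0 (negPf u1) orbF gt_eqF.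
have h1 := ln_lt_subr1 (divr_gt0 u0 A0) uA1.
have h2 := ln_le_subr1 Ai0.
move: h1 h2; rewrite ln_div ?posrE// lnV ?posrE// => h1 h2.
have e1 : t * (u / A - 1) + (1 - t) * (A^-1 - 1) = 0.
  by have An0 := lt0r_neq0 A0; rewrite /A in An0 *; field.
have : t * ln u < ln A by nra.
by rewrite -ltr_expR lnK ?posrE// /powR gt_eqF.
Qed.

Lemma powR_le_tangent u t : 0 <= u -> 0 <= t -> t <= 1 ->
  u `^ t <= 1 + t * (u - 1).
Proof.
move=> u0 t0 t1.
have [->|tn0] := eqVneq t 0; first by rewrite powRr0 mul0r addr0.
have [->|tn1] := eqVneq t 1; first by rewrite powRr1// mul1r; lra.
have [->|un0] := eqVneq u 0; first by rewrite powR0//; nra.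
have [->|un1] := eqVneq u 1; first by rewrite powR1; lra.
by apply/ltW/powR_lt_tangent; rewrite // lt_neqAle ?tn1// eq_sym ?tn0 ?un0.
Qed.

(** The upper bound for the exponent [1 / p], at the point [u^p]. *)
Lemma powR_ge_tangent u p : 0 <= u -> 1 <= p -> 1 + p * (u - 1) <= u `^ p.
Proof.
move=> u0 p1; have p0 : 0 < p by lra.
have ip1 : p^-1 <= 1 by rewrite invf_le1.
have ip0 : 0 <= p^-1 by rewrite invr_ge0 ltW.
have := powR_le_tangent (powR_ge0 u p) ip0 ip1.
rewrite -powRrM divff ?gt_eqF// powRr1// => h.
have : p * (u - 1) <= p * (p^-1 * (u `^ p - 1)) by rewrite ler_pM2l//; lra.
by rewrite mulrA divff ?gt_eqF// mul1r; lra.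
Qed.

Lemma powR_gt_tangent u p : 0 < u -> u != 1 -> 1 < p ->
  1 + p * (u - 1) < u `^ p.
Proof.
move=> u0 u1 p1; have p0 : 0 < p by lra.
have ip1 : p^-1 < 1 by rewrite invf_lt1.
have ip0 : 0 < p^-1 by rewrite invr_gt0.
have up1 : u `^ p != 1 by rewrite powR_eq1 (negPf u1) gt_eqF//= ltNge ltW.
have := powR_lt_tangent (powR_gt0 p u0) up1 ip0 ip1.
rewrite -powRrM divff ?gt_eqF// powRr1 ?ltW// => h.
have : p * (u - 1) < p * (p^-1 * (u `^ p - 1)) by rewrite ltr_pM2l//; lra.
by rewrite mulrA divff ?gt_eqF// mul1r; lra.
Qed.

(** The claim is [N b / b < N a / a] for [N x = s^x + s^2 - 2 s].  The value of
    [N x / x] at [x = 2] is [k = s^2 - s], and Bernoulli's inequality puts [N x / x]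
    below [k] for [x <= 2] and above [k] for [x >= 2].  If both exponents exceed 2,
    [s^b] is bounded by interpolation between the exponents 2 and [a].  For
    [(a, b) = (2, 1)] both sides are equal. *)
Lemma powR_quartic_gap s a b : 0 < s -> s != 1 -> 1 <= b -> 2 <= a -> b < a ->
  (a, b) <> (2, 1) ->
  (b^-1 - a^-1) * (s ^+ 2 - 2 * s) < s `^ a / a - s `^ b / b.
Proof.
move=> s0 s1 b1 a2 ba abn.
have a0 : 0 < a by lra.
have b0 : 0 < b by lra.
have an0 := lt0r_neq0 a0; have bn0 := lt0r_neq0 b0.
pose N x := s `^ x + s ^+ 2 - 2 * s.
suff : N b / b < N a / a by rewrite /N; nra.
pose k := s ^+ 2 - s.
have NE x : 0 < x -> N x / x = k + s * (s `^ (x - 1) - (1 + (x - 1) * (s - 1))) / x.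
  move=> x0; have xn0 := lt0r_neq0 x0; rewrite /N /k -(mulr_powRB1 (ltW s0) x0).
  by field.
have Nage : k <= N a / a.
  rewrite NE// lerDl; apply: divr_ge0 (ltW a0).
  rewrite pmulr_rge0// subr_ge0.
  by apply: powR_ge_tangent; lra.
have Nagt : 2 < a -> k < N a / a.
  move=> a2'; rewrite NE// ltrDl; apply: divr_gt0 a0.
  rewrite pmulr_rgt0// subr_gt0.
  by apply: powR_gt_tangent; lra.
have [b2|b2] := leP b 2.
  have [a2'|a2'] := ltP 2 a.
    apply: le_lt_trans (Nagt a2'); rewrite NE// gerDl.
    rewrite pmulr_lle0 ?invr_gt0// pmulr_rle0// subr_le0.
    by apply: powR_le_tangent; lra.
  apply: lt_le_trans Nage; rewrite NE// gtrDl.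
  have ae : a = 2 by lra.
  have bn1 : b != 1 by apply/eqP => be; apply: abn; rewrite ae be.
  have b1' : 1 < b by rewrite lt_neqAle eq_sym bn1.
  rewrite pmulr_llt0 ?invr_gt0// pmulr_rlt0// subr_lt0.
  by apply: powR_lt_tangent; lra.
have a2' : 2 < a by lra.
pose t := (b - 2) / (a - 2).
have am2 : 0 < a - 2 by lra.
have t0 : 0 < t by rewrite divr_gt0//; lra.
have t1 : t < 1 by rewrite ltr_pdivrMr//; lra.
have bE : b = 2 + (a - 2) * t by rewrite /t; field; exact: lt0r_neq0.
have Nb : N b <= (1 - t) * (2 * k) + t * N a.
  have := powR_le_tangent (powR_ge0 s (a - 2)) (ltW t0) (ltW t1).
  rewrite -powRrM => h.
  have sb : s `^ b = s ^+ 2 * s `^ ((a - 2) * t).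
    by rewrite {1}bE powRD ?(gt_eqF s0) ?implybT// powR_mulrn ?ltW.
  have sa : s `^ a = s ^+ 2 * s `^ (a - 2).
    rewrite -(@powR_mulrn _ s 2) ?ltW// -powRD ?(gt_eqF s0) ?implybT//.
    by congr (_ `^ _); ring.
  have : s `^ b <= s ^+ 2 * (1 + t * (s `^ (a - 2) - 1)).
    by rewrite sb ler_pM2l// exprn_gt0.
  by rewrite /N sa /k; lra.
have kN := Nagt a2'.
have ak : a * k < N a by move: kN; rewrite ltr_pdivlMr// mulrC.
rewrite ltr_pdivrMr// mulrAC ltr_pdivlMr//.
apply: (@le_lt_trans _ _ (((1 - t) * (2 * k) + t * N a) * a)).
  by rewrite ler_pM2r.
rewrite [X in _ < _ * X]bE.
have : 0 < (1 - t) * (N a - a * k) by apply: mulr_gt0; lra.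
by nra.
Qed.

End bernoulli.

(** * The shifted radial profile of the kernel *)

Section profile.
Context (R : realType).
Variables alpha beta : R.
Hypotheses (ba : beta < alpha) (b2 : 2 <= beta) (a4 : 4 <= alpha).
Hypothesis abn : (alpha, beta) <> (4, 2).
Implicit Types r s : R.

(** The opposite of the minimum of [r^alpha / alpha - r^beta / beta]. *)
Definition wdepth : R := beta^-1 - alpha^-1.

Definition profile r : R := r `^ alpha / alpha - r `^ beta / beta + wdepth.

Let a0 : 0 < alpha. Proof. by move: a4; lra. Qed.
Let b0 : 0 < beta. Proof. by move: b2; lra. Qed.

Lemma wdepth_gt0 : 0 < wdepth.
Proof. by rewrite subr_gt0 ltf_pV2 ?posrE. Qed.

Lemma profile0 : profile 0 = wdepth.
Proof. by rewrite /profile !powR0 ?gt_eqF// !mul0r subrr add0r. Qed.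

Lemma profile1 : profile 1 = 0.
Proof. by rewrite /profile !powR1 /wdepth; ring. Qed.

Let powR_half r x : 0 <= r -> r `^ x = (r ^+ 2) `^ (x / 2).
Proof. by move=> r0; rewrite -powR_mulrn// -powRrM; congr (_ `^ _); field. Qed.

(** [powR_quartic_gap] at [s = r^2] with halved exponents: the bounds 4 and 2 on
    [alpha] and [beta] become the bounds 2 and 1 of that lemma. *)
Lemma profile_gt_quartic r : 0 < r -> r != 1 ->
  wdepth * (r ^+ 2 - 1) ^+ 2 < profile r.
Proof.
move=> r0 r1.
have s0 : 0 < r ^+ 2 by rewrite exprn_gt0.
have s1 : r ^+ 2 != 1.
  rewrite -[_ == _]subr_eq0 subr_sqr_1 mulf_eq0 subr_eq0 (negPf r1)/=.
  by rewrite gt_eqF//; lra.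
have ba2 : (alpha / 2, beta / 2) <> (2, 1) :> R * R.
  by case=> ha hb; apply: abn; congr pair; lra.
have b1' : 1 <= beta / 2 by move: b2; lra.
have a2' : 2 <= alpha / 2 by move: a4; lra.
have ba' : beta / 2 < alpha / 2 by move: ba; lra.
have := powR_quartic_gap s0 s1 b1' a2' ba' ba2.
rewrite -!powR_half ?ltW// /profile /wdepth.
have an0 := lt0r_neq0 a0; have bn0 := lt0r_neq0 b0.
rewrite !invf_div !(mulrA (_ `^ _)) => h.
have -> : r `^ alpha / alpha - r `^ beta / beta + (beta^-1 - alpha^-1) =
  2^-1 * (r `^ alpha * 2 / alpha - r `^ beta * 2 / beta) + (beta^-1 - alpha^-1).
  by field; rewrite an0 bn0.
have : 2^-1 * ((2 / beta - 2 / alpha) * ((r ^+ 2) ^+ 2 - 2 * r ^+ 2)) <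
  2^-1 * (r `^ alpha * 2 / alpha - r `^ beta * 2 / beta).
  by rewrite ltr_pM2l.
set X := 2^-1 * (_ - r `^ _ * _ / _).
have -> : 2^-1 * ((2 / beta - 2 / alpha) * ((r ^+ 2) ^+ 2 - 2 * r ^+ 2)) =
  (beta^-1 - alpha^-1) * (r ^+ 2 - 1) ^+ 2 - (beta^-1 - alpha^-1).
  by field; rewrite an0 bn0.
by lra.
Qed.

Lemma profile_ge_quartic r : 0 <= r -> wdepth * (r ^+ 2 - 1) ^+ 2 <= profile r.
Proof.
move=> r0; have [->|rn0] := eqVneq r 0.
  by rewrite profile0 expr0n/= sub0r sqrrN expr1n mulr1.
have [->|r1] := eqVneq r 1.
  by rewrite profile1 expr1n subrr expr0n/= mulr0.
by apply/ltW/profile_gt_quartic; rewrite // lt_neqAle eq_sym rn0.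
Qed.

Lemma profile_ge0 r : 0 <= r -> 0 <= profile r.
Proof.
move=> r0; apply: le_trans (profile_ge_quartic r0).
by rewrite mulr_ge0 ?sqr_ge0// ltW// wdepth_gt0.
Qed.

Let powR_dominates (x y K : R) : 0 < y -> y < x -> 0 < K ->
  exists2 L : R, 1 <= L & forall r, L <= r -> K * r `^ y + 1 <= r `^ x.
Proof.
move=> y0 yx K0; pose L := (K + 1) `^ (x - y)^-1.
have xy : 0 < x - y by lra.
have L1 : 1 <= L.
  rewrite /L -[leLHS](powRr0 (K + 1)); apply: ler_powR; first by lra.
  by rewrite invr_ge0 ltW.
exists L => // r Lr.
have r1 : 1 <= r by apply: le_trans Lr.
have KL : K + 1 <= r `^ (x - y).
  have -> : K + 1 = L `^ (x - y).
    by rewrite /L -powRrM mulVf ?gt_eqF// powRr1//; lra.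
  by apply: ge0_ler_powR; rewrite ?nnegrE; lra.
have ry : 1 <= r `^ y by rewrite -[leLHS](powRr0 r); apply: ler_powR; lra.
have -> : r `^ x = r `^ (x - y) * r `^ y.
  by rewrite -powRD; [congr (_ `^ _); ring | rewrite (@gt_eqF _ _ r) ?implybT//; lra].
by nra.
Qed.

(** The part of the kernel that the quartic kernel does not control: on
    [r >= 0] it vanishes at 0 and 1 only, so that little of it means that
    distances are close to 0 or 1. *)
Definition profile_gap r : R := profile r - wdepth * (r ^+ 2 - 1) ^+ 2.

(** If [alpha > 4] the leading term is [r^alpha / alpha].  If [alpha = 4] then
    [beta > 2], and the coefficient [1/4 - wdepth] of [r^4] is positive. *)
Let profile_gap_infty : exists2 L : R, 1 <= L &
  exists2 c : R, 0 < c & forall r, L <= r -> c <= profile_gap r.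
Proof.
have g0 := wdepth_gt0.
have an0 := lt0r_neq0 a0; have bn0 := lt0r_neq0 b0.
have expand r : profile_gap r = r `^ alpha / alpha - r `^ beta / beta
    - wdepth * r ^+ 4 + 2 * wdepth * r ^+ 2.
  by rewrite /profile_gap /profile; ring.
have [a4'|a4'] := ltP 4 alpha.
  pose M := Num.max beta 4.
  have M0 : 0 < M by rewrite lt_max b0.
  have Ma : M < alpha by rewrite /M gt_max ba.
  have K0 : 0 < alpha * (beta^-1 + wdepth).
    by rewrite mulr_gt0// addr_gt0// invr_gt0.
  have [L L1 HL] := powR_dominates M0 Ma K0.
  exists L => //; exists alpha^-1; first by rewrite invr_gt0.
  move=> r Lr; have r1 : 1 <= r by apply: le_trans Lr.
  have rb : r `^ beta <= r `^ M by apply: ler_powR; rewrite // /M le_max lexx.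
  have r4 : r ^+ 4 <= r `^ M.
    rewrite -powR_mulrn; last by lra.
    by apply: ler_powR; rewrite // /M le_max lexx orbT.
  have h : alpha^-1 * (alpha * (beta^-1 + wdepth) * r `^ M + 1) <= r `^ alpha / alpha.
    by rewrite mulrC ler_pM2r ?invr_gt0// HL.
  rewrite expand; move: h; rewrite mulrDr mulr1 !mulrA mulVf// mul1r => h.
  have ib0 : 0 < beta^-1 by rewrite invr_gt0.
  have : 0 <= 2 * wdepth * r ^+ 2 by rewrite mulr_ge0 ?sqr_ge0//; lra.
  have : r `^ beta / beta <= beta^-1 * r `^ M by rewrite mulrC ler_pM2l.
  have : wdepth * r ^+ 4 <= wdepth * r `^ M by rewrite ler_pM2l.
  by move: h; rewrite mulrDl; lra.
have ae : alpha = 4 by apply/eqP; rewrite eq_le a4' a4.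
have b2' : 2 < beta.
  by rewrite lt_neqAle b2 andbT; apply/eqP => be; apply: abn; rewrite ae -be.
pose c := 4^-1 - wdepth.
have c0 : 0 < c.
  have : beta^-1 < 2^-1 by rewrite ltf_pV2 ?posrE.
  by rewrite /c /wdepth ae; lra.
have K0 : 0 < (c * beta)^-1 by rewrite invr_gt0 mulr_gt0.
have [L L1 HL] := powR_dominates b0 ba K0.
exists L => //; exists c => // r Lr; rewrite expand ae.
have r0 : 0 <= r by apply: le_trans Lr; lra.
have -> : r `^ 4 = r ^+ 4 by rewrite -powR_mulrn.
have h : c * ((c * beta)^-1 * r `^ beta + 1) <= c * r ^+ 4.
  by rewrite ler_pM2l// -(powR_mulrn 4 r0) -[4%:R]ae HL.
have e : c * ((c * beta)^-1 * r `^ beta + 1) = r `^ beta / beta + c.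
  by have cn0 := lt0r_neq0 c0; field; rewrite bn0 cn0.
have : 0 <= 2 * wdepth * r ^+ 2 by rewrite mulr_ge0 ?sqr_ge0//; lra.
by move: h; rewrite e /c; lra.
Qed.

Let profile_derive r : 0 < r ->
  is_derive r 1 profile (r `^ (alpha - 1) - r `^ (beta - 1)).
Proof.
move=> r0; rewrite /profile.
have da := @is_derive1_powR R alpha r r0; have db := @is_derive1_powR R beta r r0.
apply: is_derive_eq.
rewrite -![_ *: _]/(_ * _) !mulr0 !add0r addr0.
by field; rewrite !gt_eqF.
Qed.

Let profile_continuous r : 0 < r -> {for r, continuous profile}.
Proof.
move=> r0; apply: differentiable_continuous; apply/derivable1_diffP.
exact: (@ex_derive _ _ _ _ _ _ _ (profile_derive r0)).
Qed.

Lemma profile_gap_ge0 r : 0 <= r -> 0 <= profile_gap r.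
Proof. by move=> r0; rewrite subr_ge0 profile_ge_quartic. Qed.

Let profile_gap_cont r : 0 < r -> {for r, continuous profile_gap}.
Proof.
move=> r0; rewrite /profile_gap.
apply: continuousB; first exact: profile_continuous.
apply: continuousM; first exact: cst_continuous.
have c1 : {for r, continuous (fun x : R => x ^+ 2 - 1)}.
  by apply: continuousB; [exact: exprn_continuous|exact: cst_continuous].
exact: (continuous_comp c1 (@exprn_continuous _ 2 _)).
Qed.

Let profile_gap_itv x y : 0 < x -> x <= y -> (y < 1 \/ 1 < x) ->
  exists2 c : R, 0 < c & forall r, x <= r <= y -> c <= profile_gap r.
Proof.
move=> x0 xy n1.
have cf : {within `[x, y], continuous profile_gap}.
  apply: continuous_in_subspaceT => z; rewrite inE/= in_itv/= => /andP[xz zy].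
  by apply: profile_gap_cont; lra.
have [c + Hc] := EVT_min xy cf.
rewrite in_itv/= => /andP[xc cy].
exists (profile_gap c) => [|r xr]; last by apply: Hc; rewrite in_itv.
rewrite subr_gt0 profile_gt_quartic//; first by lra.
by case: n1 => n1; [rewrite lt_eqF//|rewrite gt_eqF//]; lra.
Qed.

(** Compactness away from the zeros 0 and 1, and the behaviour at infinity. *)
Lemma profile_gap_bounded_below d : 0 < d -> exists2 c : R, 0 < c &
  forall r, d <= r -> d <= `|r - 1| -> c <= profile_gap r.
Proof.
move=> d0.
have [L L1 [c1 c10 H1]] := profile_gap_infty.
have [c2 c20 H2] : exists2 c : R, 0 < c &
    forall r, d <= r -> r <= 1 - d -> c <= profile_gap r.
  have [dd|dd] := leP d (1 - d).
    have [|c c0 H] := profile_gap_itv d0 dd; first by left; lra.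
    by exists c => // r dr r1; apply: H; rewrite dr.
  by exists 1 => // r dr r1; lra.
have [c3 c30 H3] : exists2 c : R, 0 < c &
    forall r, 1 + d <= r -> r <= L + d -> c <= profile_gap r.
  have d1 : 0 < 1 + d by lra.
  have d1L : 1 + d <= L + d by lra.
  have [|c c0 H] := profile_gap_itv d1 d1L; first by right; lra.
  by exists c => // r dr r1; apply: H; rewrite dr.
exists (Num.min c1 (Num.min c2 c3)); first by rewrite !lt_min c10 c20.
move=> r dr; rewrite ler_normr => /orP[h|h].
  have [Lr|rL] := leP L r; first by rewrite ge_min H1.
  by rewrite !ge_min H3 ?orbT//; lra.
by rewrite !ge_min H2 ?orbT//; lra.
Qed.

Lemma profile_near1 e : 0 < e -> exists2 d : R, 0 < d &
  forall r, 0 <= r -> `|r - 1| < d -> profile r <= e.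
Proof.
move=> e0; have := profile_continuous (@ltr01 R).
move/cvgrPdist_lt => /(_ e e0) [d /= d0 H]; exists d => // r r0 r1.
have := H r; rewrite /ball_/= distrC => /(_ r1).
rewrite profile1 sub0r normrN => /ltW; exact/le_trans/ler_norm.
Qed.

Lemma profile_near0 r : 0 <= r -> r <= 1 -> profile r <= wdepth + r.
Proof.
move=> r0 r1; rewrite /profile addrC lerD2l.
apply: (@le_trans _ _ (r `^ alpha / alpha)).
  by rewrite gerBl divr_ge0 ?powR_ge0// ltW.
apply: (@le_trans _ _ (r `^ alpha)).
  by rewrite ler_pdivrMr// ler_peMr ?powR_ge0//; move: a4; lra.
have [->|rn0] := eqVneq r 0; first by rewrite powR0 ?gt_eqF.
by apply: ge1r_powR; [rewrite lt_neqAle eq_sym rn0 r0| move: a4; lra].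
Qed.

Lemma profile_le_powR r : profile r <= r `^ alpha + wdepth.
Proof.
rewrite /profile lerD2r.
apply: (@le_trans _ _ (r `^ alpha / alpha)).
  by rewrite gerBl divr_ge0 ?powR_ge0// ltW.
by rewrite ler_pdivrMr// ler_peMr ?powR_ge0//; move: a4; lra.
Qed.

(** The kernel grows like a power, so a translation by 1 multiplies it by a
    bounded factor, up to a constant.  This carries a bound on an integral of the
    kernel from one base point to all nearby ones. *)
Lemma profile_doubling : exists2 A : R, 0 < A &
  forall r s, 0 <= r -> 0 <= s -> r <= s + 1 -> profile r <= A * (1 + profile s).
Proof.
have g0 := wdepth_gt0.
have K0 : 0 < 2 * alpha / beta by rewrite divr_gt0// mulr_gt0.
have [L L1 HL] := powR_dominates b0 ba K0.
have sL s : 0 <= s -> s `^ alpha <= 2 * alpha * profile s + L `^ alpha.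
  move=> s0; have p0 : 0 <= 2 * alpha * profile s.
    by rewrite mulr_ge0 ?profile_ge0// mulr_ge0// ltW.
  have [Ls|sL] := leP L s.
    have h := HL _ Ls; apply: (@le_trans _ _ (2 * alpha * profile s)); last first.
      by rewrite lerDl powR_ge0.
    rewrite /profile.
    have -> : 2 * alpha * (s `^ alpha / alpha - s `^ beta / beta + wdepth) =
      2 * s `^ alpha - 2 * alpha / beta * s `^ beta + 2 * alpha * wdepth.
      by field; rewrite !gt_eqF.
    have : 0 < 2 * alpha * wdepth by rewrite !mulr_gt0.
    by lra.
  apply: (@le_trans _ _ (L `^ alpha)); last by rewrite lerDr.
  by apply: ge0_ler_powR; rewrite ?nnegrE//; [exact: ltW|lra|exact: ltW].
pose T := 2 `^ alpha; pose B := L `^ alpha.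
have T0 : 0 < T by apply: powR_gt0.
have B0 : 0 <= B by apply: powR_ge0.
exists (T * (1 + B + 2 * alpha) + wdepth).
  by rewrite addr_gt0// mulr_gt0//; move: a4; lra.
move=> r s r0 s0 rs; have ps := profile_ge0 s0.
apply: (le_trans (profile_le_powR r)).
have rT : r `^ alpha <= T * (1 + s `^ alpha).
  pose u := Num.max s 1.
  have u0 : 0 <= u by rewrite le_max s0.
  have ru : r <= 2 * u.
    have : s <= u by rewrite le_max lexx.
    have : 1 <= u by rewrite le_max lexx orbT.
    by lra.
  apply: (@le_trans _ _ ((2 * u) `^ alpha)).
    by apply: ge0_ler_powR; rewrite ?nnegrE ?mulr_ge0// ltW.
  rewrite powRM// ler_pM2l// /u; have [s1|s1] := leP s 1.
    by rewrite powR1 lerDl powR_ge0.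
  by rewrite lerDr.
apply: (@le_trans _ _ (T * (1 + (2 * alpha * profile s + B)) + wdepth)).
  by rewrite lerD2r (le_trans rT)// ler_pM2l// lerD2l sL.
have : 0 <= wdepth * profile s by rewrite mulr_ge0// ltW.
have : 0 <= T * B * profile s by rewrite !mulr_ge0// ltW.
have : 0 <= T * alpha by rewrite !mulr_ge0// ltW.
have : 0 <= T * profile s by rewrite !mulr_ge0// ltW.
by nra.
Qed.

End profile.

(** * Convexity of the profile near distances 1 and 0 *)

Section convexity_from_derivatives.
Context (R : realType).
Implicit Types f : R -> R.

(** Monotonicity comes together with convexity because the function is going
    to be composed with the norm, and only a nondecreasing convex function remains
    convex. *)
Definition cvx_ndecr f (a b : R) : Prop :=
  (forall x y t, a <= x <= b -> a <= y <= b -> 0 <= t <= 1 ->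
     f (t * x + (1 - t) * y) <= t * f x + (1 - t) * f y) /\
  (forall x y, a <= x -> x <= y -> y <= b -> f x <= f y).

Let cvx_wlog f (a b : R) :
  (forall x y t, a <= x -> x < y -> y <= b -> 0 < t < 1 ->
     f (t * x + (1 - t) * y) <= t * f x + (1 - t) * f y) ->
  forall x y t, a <= x <= b -> a <= y <= b -> 0 <= t <= 1 ->
     f (t * x + (1 - t) * y) <= t * f x + (1 - t) * f y.
Proof.
move=> H x y t /andP[ax xb] /andP[ay yb] /andP[t0 t1].
have [->|tn0] := eqVneq t 0; first by rewrite !mul0r !add0r subr0 !mul1r.
have [->|tn1] := eqVneq t 1; first by rewrite subrr !mul0r !addr0 !mul1r.
have t0' : 0 < t by rewrite lt_neqAle eq_sym tn0.
have t1' : t < 1 by rewrite lt_neqAle tn1.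
have [xy|yx|->] := ltgtP x y.
- by apply: H; rewrite // t0' t1'.
- have := H y x (1 - t) ay yx xb.
  rewrite subr_gt0 t1' ltrBlDr ltrDl t0' => /(_ isT).
  by rewrite opprB addrCA subrr addr0 addrC [leRHS]addrC.
- by rewrite -!mulrDl addrCA subrr addr0 !mul1r.
Qed.

Lemma cvx_ndecr_derive f f1 f2 (a b : R) :
  (forall x, a < x < b -> is_derive x 1 f (f1 x)) ->
  (forall x, a < x < b -> is_derive x 1 f1 (f2 x)) ->
  (forall x, a < x < b -> 0 <= f1 x) -> (forall x, a < x < b -> 0 <= f2 x) ->
  {within `[a, b], continuous f} -> cvx_ndecr f a b.
Proof.
move=> d1 d2 p1 p2 cf.
have cW x y : a <= x -> y <= b -> {within `[x, y], continuous f}.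
  move=> ax yb; apply: continuous_subspaceW cf; apply: subset_itvScc => //;
  by rewrite bnd_simp.
have mvt x y : a <= x -> x < y -> y <= b ->
    exists2 c, x < c < y & f y - f x = f1 c * (y - x).
  move=> ax xy yb.
  have dz z : z \in `]x, y[ -> is_derive z 1 f (f1 z).
    by rewrite in_itv/= => /andP[xz zy]; apply: d1; lra.
  have [c] := MVT xy dz (cW _ _ ax yb).
  by rewrite in_itv/= => cxy E; exists c.
have mvt1 x y : a < x -> x < y -> y < b -> f1 x <= f1 y.
  move=> ax xy yb.
  have dz z : z \in `]x, y[ -> is_derive z 1 f1 (f2 z).
    by rewrite in_itv/= => /andP[xz zy]; apply: d2; lra.
  have cf1 : {within `[x, y], continuous f1}.
    apply: continuous_in_subspaceT => z; rewrite inE/= in_itv/= => /andP[xz zy].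
    apply: differentiable_continuous; apply/derivable1_diffP.
    by apply: (@ex_derive _ _ _ _ _ _ _ (d2 z _)); lra.
  have [c] := MVT xy dz cf1; rewrite in_itv/= => /andP[xc cy] E.
  by rewrite -subr_ge0 E mulr_ge0 ?p2//; lra.
split; last first.
  move=> x y ax; rewrite le_eqVlt => /predU1P[->//|xy] yb.
  have [c /andP[xc cy] E] := mvt _ _ ax xy yb.
  by rewrite -subr_ge0 E mulr_ge0 ?p1//; lra.
apply: cvx_wlog => x y t ax xy yb /andP[t0 t1].
set z := t * x + _; have xz : x < z by rewrite /z; nra.
have zy : z < y by rewrite /z; nra.
have [c /andP[xc cz] Ec] := mvt x z ax xz (le_trans (ltW zy) yb).
have [e /andP[ze ey] Ee] := mvt z y (le_trans ax (ltW xz)) zy yb.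
have ce : f1 c <= f1 e by apply: mvt1; lra.
have E1 : z - x = (1 - t) * (y - x) by rewrite /z; ring.
have E2 : y - z = t * (y - x) by rewrite /z; ring.
rewrite E1 in Ec; rewrite E2 in Ee.
have : 0 <= t * (1 - t) * (y - x) * (f1 e - f1 c).
  by rewrite !mulr_ge0//; lra.
have -> : t * (1 - t) * (y - x) * (f1 e - f1 c) =
   (1 - t) * (f y - f z) - t * (f z - f x) by rewrite Ec Ee; ring.
by lra.
Qed.

End convexity_from_derivatives.

Section profile_convexity.
Context (R : realType).
Variables alpha beta : R.
Hypotheses (ba : beta < alpha) (b2 : 2 <= beta) (a4 : 4 <= alpha).
Hypothesis abn : (alpha, beta) <> (4, 2).
Implicit Types r s : R.
Local Notation profile := (profile alpha beta).

Let a0 : 0 < alpha. Proof. by move: a4; lra. Qed.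
Let b0 : 0 < beta. Proof. by move: b2; lra. Qed.

(** A quarter of the second derivative of the profile at 1. *)
Definition curv1 : R := (alpha - beta) / 4.

Lemma curv1_gt0 : 0 < curv1.
Proof. by rewrite /curv1 divr_gt0// subr_gt0. Qed.

Let powRd r p : 0 < r ->
  is_derive r 1 (fun x => x `^ p) (p * r `^ (p - 1)).
Proof. by move=> r0; exact: is_derive1_powR. Qed.

Let shifted_derive (k s : R) r : 0 < r ->
  is_derive r 1 (fun x => profile x - k / 2 * (x ^+ 2 - 1) ^+ 2 + s * x ^+ 2)
    (r `^ (alpha - 1) - r `^ (beta - 1) - 2 * k * (r ^+ 3 - r) + 2 * s * r).
Proof.
move=> r0; rewrite /profile.
have da := powRd alpha r0; have db := powRd beta r0.
apply: is_derive_eq.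
rewrite -?[_ *: _]/(_ * _) /GRing.scale/=.
by field; rewrite !gt_eqF.
Qed.

Let shifted_derive2 (k s : R) r : 0 < r ->
  is_derive r 1
    (fun x => x `^ (alpha - 1) - x `^ (beta - 1) - 2 * k * (x ^+ 3 - x) + 2 * s * x)
    ((alpha - 1) * r `^ (alpha - 2) - (beta - 1) * r `^ (beta - 2)
      - 2 * k * (3 * r ^+ 2 - 1) + 2 * s).
Proof.
move=> r0.
have da := powRd (alpha - 1) r0; have db := powRd (beta - 1) r0.
apply: is_derive_eq.
rewrite -?[_ *: _]/(_ * _) /GRing.scale/=.
have -> : alpha - 1 - 1 = alpha - 2 by ring.
have -> : beta - 1 - 1 = beta - 2 by ring.
by ring.
Qed.

(** The profile decreases on the left of 1, so it is not convex when composed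
    with the norm.  Subtracting the multiple of [(r^2 - 1)^2] with the same second
    derivative at 1 leaves a function whose first two derivatives vanish at 1, and
    [s r^2] makes both of them positive around 1.  Second differences of the
    subtracted polynomial are explicit. *)
Lemma profile_cvx_near1 s : 0 < s -> exists2 d : R, 0 < d < 1 / 2 &
  cvx_ndecr (fun r => profile r - curv1 / 2 * (r ^+ 2 - 1) ^+ 2 + s * r ^+ 2)
    (1 - d) (1 + d).
Proof.
move=> s0.
pose h1 r := r `^ (alpha - 1) - r `^ (beta - 1) - 2 * curv1 * (r ^+ 3 - r) + 2 * s * r.
pose h2 r := (alpha - 1) * r `^ (alpha - 2) - (beta - 1) * r `^ (beta - 2)
      - 2 * curv1 * (3 * r ^+ 2 - 1) + 2 * s.
have h11 : h1 1 = 2 * s by rewrite /h1 !powR1; ring.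
have h21 : h2 1 = 2 * s by rewrite /h2 !powR1 /curv1; field.
have c1 : {for 1, continuous h1}.
  apply: differentiable_continuous; apply/derivable1_diffP.
  exact: (@ex_derive _ _ _ _ _ _ _ (shifted_derive2 curv1 s ltr01)).
have c2 : {for 1, continuous h2}.
  apply: differentiable_continuous; apply/derivable1_diffP.
  have da := powRd (alpha - 2) (@ltr01 R); have db := powRd (beta - 2) (@ltr01 R).
  exact: ex_derive.
have s20 : 0 < 2 * s by lra.
move/cvgrPdist_lt : c1 => /(_ _ s20) [d1 /= d10 H1].
move/cvgrPdist_lt : c2 => /(_ _ s20) [d2 /= d20 H2].
have q0 : (0 : R) < 1 / 4 by lra.
pose d := Num.min (1 / 4) (Num.min (d1 / 2) (d2 / 2)).
have d0 : 0 < d by rewrite !lt_min q0 !divr_gt0.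
have d4 : d <= 1 / 4 by rewrite ge_min lexx.
have dd1 : d <= d1 / 2 by rewrite !ge_min lexx orbT.
have dd2 : d <= d2 / 2 by rewrite !ge_min lexx !orbT.
exists d; first by rewrite d0/=; lra.
apply: (@cvx_ndecr_derive _ _ h1 h2).
- by move=> x /andP[x1 x2]; apply: shifted_derive; lra.
- by move=> x /andP[x1 x2]; apply: shifted_derive2; lra.
- move=> x /andP[x1 x2]; have := H1 x; rewrite /ball_/= h11.
  have xd : `|1 - x| < d1 by rewrite ltr_norml; apply/andP; split; lra.
  by move=> /(_ xd); rewrite ltr_norml => /andP[]; lra.
- move=> x /andP[x1 x2]; have := H2 x; rewrite /ball_/= h21.
  have xd : `|1 - x| < d2 by rewrite ltr_norml; apply/andP; split; lra.
  by move=> /(_ xd); rewrite ltr_norml => /andP[]; lra.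
- apply: continuous_in_subspaceT => z; rewrite inE/= in_itv/= => /andP[xz zy].
  apply: differentiable_continuous; apply/derivable1_diffP.
  have z0 : 0 < z by lra.
  exact: (@ex_derive _ _ _ _ _ _ _ (shifted_derive curv1 s z0)).
Qed.

(** The only obstacle is the concave term [- r^beta / beta].  For [beta > 2] its
    second derivative tends to 0 at 0, and any [s > 0] is enough.  For [beta = 2] it
    is -1, so [s = 1/2] is needed; it is below [(alpha - 2) / 4] because
    [alpha > 4]. *)
Lemma profile_cvx_near0 : exists2 s : R, 0 < s < curv1 &
  exists2 d : R, 0 < d & cvx_ndecr (fun r => profile r + s * r ^+ 2) 0 d.
Proof.
have [s [s0 sk] [d [d0 d1] Hd]] : exists2 s : R, 0 < s /\ s < curv1 &
  exists2 d : R, 0 < d /\ d <= 1 &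
    forall r, 0 < r -> r <= d -> (beta - 1) * r `^ (beta - 2) <= 2 * s.
  have [b2'|b2'] := leP beta 2.
    have be : beta = 2 by apply/eqP; rewrite eq_le b2 b2'.
    have a4' : 4 < alpha.
      by rewrite lt_neqAle a4 andbT; apply/eqP => ae; apply: abn; rewrite be -ae.
    exists (2^-1); first by split; rewrite /curv1 ?be; lra.
    by exists 1 => // r r0 r1; rewrite be subrr powRr0; lra.
  have k0 := curv1_gt0; have b1 : 0 < beta - 1 by lra.
  exists (curv1 / 2); first by split; lra.
  pose c := curv1 / (beta - 1); have c0 : 0 < c by rewrite divr_gt0.
  exists (Num.min 1 (c `^ (beta - 2)^-1)).
    by split; [rewrite lt_min ltr01 powR_gt0|rewrite ge_min lexx].
  move=> r r0; rewrite le_min => /andP[r1 rc].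
  have : r `^ (beta - 2) <= c.
    have -> : c = (c `^ (beta - 2)^-1) `^ (beta - 2).
      by rewrite -powRrM mulVf ?powRr1 ?(ltW c0)// gt_eqF//; lra.
    by apply: ge0_ler_powR; rewrite ?nnegrE ?powR_ge0// ?ltW//; lra.
  rewrite -(ler_pM2l b1) => /le_trans; apply.
  by rewrite /c mulrC divfK ?gt_eqF//; lra.
exists s; first by rewrite s0 sk.
exists d => //.
pose h1 r := r `^ (alpha - 1) - r `^ (beta - 1) - 2 * 0 * (r ^+ 3 - r) + 2 * s * r.
pose h2 r := (alpha - 1) * r `^ (alpha - 2) - (beta - 1) * r `^ (beta - 2)
      - 2 * 0 * (3 * r ^+ 2 - 1) + 2 * s.
have E : (fun r => profile r + s * r ^+ 2) =
  (fun r => profile r - 0 / 2 * (r ^+ 2 - 1) ^+ 2 + s * r ^+ 2).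
  by apply/funext => r; rewrite mul0r mul0r subr0.
rewrite E; apply: (@cvx_ndecr_derive _ _ h1 h2).
- by move=> x /andP[x1 x2]; apply: shifted_derive.
- by move=> x /andP[x1 x2]; apply: shifted_derive2.
- move=> x /andP[x1 x2]; have := Hd x x1 (ltW x2).
  have -> : h1 x = x `^ (alpha - 1) - x `^ (beta - 1) + 2 * s * x.
    by rewrite /h1; ring.
  have -> : x `^ (beta - 1) = x `^ (beta - 2) * x.
    rewrite -{3}(powRr1 (ltW x1)) -powRD ?(gt_eqF x1) ?implybT//.
    by congr (_ `^ _); ring.
  have := powR_ge0 x (alpha - 1); have := powR_ge0 x (beta - 2).
  set u := x `^ (beta - 2); set v := x `^ _ => u0 v0 h.
  have bu : 0 <= (beta - 2) * u by rewrite mulr_ge0//; move: b2; lra.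
  have : 0 <= (2 * s - u) * x by rewrite mulr_ge0 ?(ltW x1)//; lra.
  by lra.
- move=> x /andP[x1 x2]; have := Hd x x1 (ltW x2).
  have : 0 <= (alpha - 1) * x `^ (alpha - 2).
    by rewrite mulr_ge0 ?powR_ge0//; move: a4; lra.
  by rewrite /h2; lra.
- apply/(@derivable_oo_LRcontinuous_within R); split.
  + move=> x; rewrite in_itv/= => /andP[x1 x2].
    exact: (@ex_derive _ _ _ _ _ _ _ (shifted_derive 0 s x1)).
  + have c3 : profile r @[r --> 0^'+] --> profile 0.
      rewrite profile0//.
      have -> : wdepth alpha beta = 0 * alpha^-1 - 0 * beta^-1 + wdepth alpha beta.
        by ring.
      apply: (@cvgD _ _ _ _ _ (fun r => r `^ alpha / alpha - r `^ beta / beta)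
        (fun=> wdepth alpha beta)); last exact: cvg_cst.
      apply: (@cvgB _ _ _ _ _ (fun r => r `^ alpha / alpha)
        (fun r => r `^ beta / beta));
      (apply: cvgM; last exact: cvg_cst); exact: powR_cvg0.
    have c4 : s * r ^+ 2 @[r --> 0^'+] --> s * 0 ^+ 2.
      apply: cvgM; first exact: cvg_cst.
      by apply: cvg_at_right_filter; exact: exprn_continuous.
    rewrite -E (_ : profile 0 - _ + _ = profile 0 + s * 0 ^+ 2); first exact: cvgD.
    by ring.
  + apply: cvg_at_left_filter.
    have c : {for d, continuous
        (fun r => profile r - 0 / 2 * (r ^+ 2 - 1) ^+ 2 + s * r ^+ 2)}.
      apply: differentiable_continuous; apply/derivable1_diffP.
      exact: (@ex_derive _ _ _ _ _ _ _ (shifted_derive 0 s d0)).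
    exact: c.
Qed.

End profile_convexity.

(** * Euclidean geometry of the regular simplex *)

Section euclidean_geometry.
Context (R : realType) (N : nat).
Implicit Types (x y z u v w : 'rV[R]_N) (a r s t : R).

Definition dotv x y : R := \sum_(k < N) x ord0 k * y ord0 k.

Lemma dotvC x y : dotv x y = dotv y x.
Proof. by apply: eq_bigr => k _; rewrite mulrC. Qed.

Lemma dotvDl x y z : dotv (x + y) z = dotv x z + dotv y z.
Proof. by rewrite -big_split; apply: eq_bigr => k _; rewrite mxE mulrDl. Qed.

Lemma dotvZl a x y : dotv (a *: x) y = a * dotv x y.
Proof. by rewrite mulr_sumr; apply: eq_bigr => k _; rewrite mxE mulrA. Qed.

Lemma dotvNl x y : dotv (- x) y = - dotv x y.
Proof. by rewrite -scaleN1r dotvZl mulN1r. Qed.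

Lemma dotvDr x y z : dotv x (y + z) = dotv x y + dotv x z.
Proof. by rewrite dotvC dotvDl !(dotvC x). Qed.

Lemma dotvZr a x y : dotv x (a *: y) = a * dotv x y.
Proof. by rewrite dotvC dotvZl dotvC. Qed.

Lemma dotvNr x y : dotv x (- y) = - dotv x y.
Proof. by rewrite dotvC dotvNl dotvC. Qed.

Lemma dotv_sumr (I : finType) x (F : I -> 'rV[R]_N) :
  dotv x (\sum_i F i) = \sum_i dotv x (F i).
Proof.
rewrite /dotv exchange_big/=; apply: eq_bigr => k _.
by rewrite summxE mulr_sumr.
Qed.

Definition dotvE := (dotvDl, dotvDr, dotvZl, dotvZr, dotvNl, dotvNr).

Lemma dotv_mulmx x y : dotv x y = (x *m y^T) ord0 ord0.
Proof. by rewrite mxE; apply: eq_bigr => k _; rewrite mxE. Qed.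

Lemma dotv_ge0 x : 0 <= dotv x x.
Proof. by apply: sumr_ge0 => k _; rewrite -expr2 sqr_ge0. Qed.

Lemma dotv_eq0 x : dotv x x = 0 -> x = 0.
Proof.
move/eqP; rewrite psumr_eq0; last by move=> k _; rewrite -expr2 sqr_ge0.
move/allP => h; apply/rowP => k; rewrite mxE; apply/eqP.
by have := h k (mem_index_enum _); rewrite /= -expr2 sqrf_eq0.
Qed.

Lemma enorm_dotv x : enorm x = Num.sqrt (dotv x x).
Proof. by congr Num.sqrt; apply: eq_bigr => k _; rewrite expr2. Qed.

Lemma sqr_enorm x : enorm x ^+ 2 = dotv x x.
Proof. by rewrite enorm_dotv sqr_sqrtr// dotv_ge0. Qed.

Lemma enorm_ge0 x : 0 <= enorm x.
Proof. exact: sqrtr_ge0. Qed.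

Lemma enorm0 : enorm (0 : 'rV[R]_N) = 0.
Proof. by rewrite enorm_dotv -(scale0r 0) dotvZl mul0r sqrtr0. Qed.

Lemma enorm_eq0 x : enorm x = 0 -> x = 0.
Proof. by move=> h; apply: dotv_eq0; rewrite -sqr_enorm h expr0n. Qed.

Lemma enormN x : enorm (- x) = enorm x.
Proof. by rewrite !enorm_dotv !dotvE opprK. Qed.

Lemma enormB x y : enorm (x - y) = enorm (y - x).
Proof. by rewrite -enormN opprB. Qed.

Lemma enormZ a x : enorm (a *: x) = `|a| * enorm x.
Proof.
by rewrite !enorm_dotv dotvZl dotvZr mulrA -expr2 sqrtrM ?sqr_ge0// sqrtr_sqr.
Qed.

Lemma enorm_le x r : 0 <= r -> dotv x x <= r ^+ 2 -> enorm x <= r.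
Proof.
move=> r0 h; rewrite -(@ler_pXn2r _ 2)// ?nnegrE ?enorm_ge0//.
by rewrite sqr_enorm.
Qed.

Lemma dotv_le_enorm x y : dotv x y <= enorm x * enorm y.
Proof.
have [->|yn0] := eqVneq y 0.
  by rewrite enorm0 mulr0 -(scale0r 0) dotvZr mul0r.
have yy : 0 < dotv y y.
  rewrite lt_neqAle dotv_ge0 andbT eq_sym.
  by apply: contra_neq yn0; exact: dotv_eq0.
have h := dotv_ge0 (dotv y y *: x - dotv x y *: y).
have : dotv x y ^+ 2 <= dotv x x * dotv y y.
  move: h; rewrite !dotvE (dotvC y x) => h.
  have : 0 <= dotv y y * (dotv x x * dotv y y - dotv x y ^+ 2) by nra.
  by rewrite pmulr_rge0// subr_ge0.
rewrite -!sqr_enorm -exprMn => h2.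
apply: (le_trans (ler_norm _)).
by rewrite -(@ler_pXn2r _ 2)// ?nnegrE ?mulr_ge0 ?enorm_ge0// real_normK ?num_real.
Qed.

Lemma ler_norm_dotv x y : `|dotv x y| <= enorm x * enorm y.
Proof.
rewrite ler_norml dotv_le_enorm andbT lerNl -dotvNl -(enormN x).
exact: dotv_le_enorm.
Qed.

Lemma enormD x y : enorm (x + y) <= enorm x + enorm y.
Proof.
apply: enorm_le; first by rewrite addr_ge0 ?enorm_ge0.
rewrite sqrrD !sqr_enorm !dotvE (dotvC y x).
by have := dotv_le_enorm x y; lra.
Qed.

Lemma enorm_trans z x y : enorm (x - y) <= enorm (x - z) + enorm (z - y).
Proof. by rewrite -{1}(subrK z x) -addrA; exact: enormD. Qed.

Lemma enorm_dist z x y : `|enorm (x - y) - enorm (z - y)| <= enorm (x - z).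
Proof.
have h1 := enorm_trans z x y; have h2 := enorm_trans x z y.
by rewrite (enormB z x) in h2; rewrite ler_norml; apply/andP; split; lra.
Qed.

Lemma sqr_enormB x y :
  enorm (x - y) ^+ 2 = dotv x x - 2 * dotv x y + dotv y y.
Proof. by rewrite sqr_enorm !dotvE (dotvC y x); ring. Qed.

Lemma enorm_conv t x y : 0 <= t <= 1 ->
  enorm (t *: x + (1 - t) *: y) <= t * enorm x + (1 - t) * enorm y.
Proof.
move=> /andP[t0 t1]; apply: (le_trans (enormD _ _)).
by rewrite !enormZ !ger0_norm ?subr_ge0.
Qed.

Lemma sqr_enorm_conv t x y :
  enorm (t *: x + (1 - t) *: y) ^+ 2 =
  t * enorm x ^+ 2 + (1 - t) * enorm y ^+ 2 - t * (1 - t) * enorm (x - y) ^+ 2.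
Proof. by rewrite !sqr_enorm !dotvE (dotvC y x); ring. Qed.

Lemma coord_le_enorm x k : `|x ord0 k| <= enorm x.
Proof.
rewrite -(@ler_pXn2r _ 2)// ?nnegrE ?enorm_ge0// real_normK ?num_real//.
rewrite sqr_enorm /dotv (bigD1 k)//= -expr2 lerDl.
by apply: sumr_ge0 => i _; rewrite -expr2 sqr_ge0.
Qed.

Lemma enorm_le_coord x r : 0 <= r -> (forall k, `|x ord0 k| <= r) ->
  enorm x <= N%:R * r.
Proof.
move=> r0 h; apply: enorm_le; first by rewrite mulr_ge0.
apply: (@le_trans _ _ (N%:R * r ^+ 2)).
  have -> : N%:R * r ^+ 2 = \sum_(k < N) r ^+ 2.
    by rewrite sumr_const card_ord mulr_natl.
  apply: ler_sum => k _.
  by rewrite -expr2 -(real_normK (num_real (x ord0 k))) ler_pXn2r ?nnegrE.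
rewrite exprMn ler_wpM2r ?sqr_ge0// expr2 -natrM ler_nat.
by case: (N) => // n; rewrite leq_pmulr.
Qed.

End euclidean_geometry.

Section simplex.
Context (R : realType) (N : nat).
Implicit Types (z v : 'rV[R]_N).

Definition unit_simplex (x : 'I_N.+1 -> 'rV[R]_N) : Prop :=
  forall i j, i != j -> enorm (x i - x j) = 1.

Let c : R := (2 * N.+1%:R)^-1.
Let N1 : 0 < N.+1%:R :> R. Proof. by rewrite ltr0n. Qed.
Let sumc (a : R) : \sum_(i < N.+1) a = N.+1%:R * a.
Proof. by rewrite sumr_const card_ord mulr_natl. Qed.
Let cE : N.+1%:R * c = 1 / 2.
Proof. by rewrite /c; field; exact: lt0r_neq0. Qed.

Section centered.
Variable x : 'I_N.+1 -> 'rV[R]_N.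
Hypotheses (x0 : \sum_i x i = 0) (x1 : unit_simplex x).

Let sumdot v : \sum_i dotv v (x i) = 0.
Proof. by rewrite -dotv_sumr x0 -(scale0r 0) dotvZr mul0r. Qed.

Let d2 i j : enorm (x i - x j) ^+ 2 = 1 - (i == j)%:R.
Proof.
have [->|ij] := eqVneq i j; first by rewrite !subrr enorm0 expr0n.
by rewrite x1// expr1n subr0.
Qed.

Let sumd i (a b : R) : \sum_j (a - b * (i == j :> 'I_N.+1)%:R) = N.+1%:R * a - b.
Proof.
rewrite sumrB sumr_const card_ord mulr_natl; congr (_ - _).
rewrite -mulr_sumr (bigD1 i)//= eqxx big1 ?addr0 ?mulr1//.
by move=> j ij; rewrite eq_sym (negPf ij).
Qed.

Let gram_diag i : dotv (x i) (x i) = 1 / 2 - c.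
Proof.
pose A := \sum_j dotv (x j) (x j).
have row k : N.+1%:R * dotv (x k) (x k) + A = N%:R.
  have : \sum_j enorm (x k - x j) ^+ 2 = N%:R.
    under eq_bigr do rewrite d2 -[(_ == _)%:R]mul1r.
    by rewrite sumd mulr1 -natr1; ring.
  under eq_bigr do rewrite sqr_enormB.
  rewrite big_split/= sumrB sumr_const card_ord -mulr_sumr sumdot mulr0 subr0.
  by rewrite mulr_natl.
have AE : A = N%:R / 2.
  have : \sum_k (N.+1%:R * dotv (x k) (x k) + A) = N.+1%:R * N%:R.
    by under eq_bigr do rewrite row; rewrite sumr_const card_ord mulr_natl.
  rewrite big_split/= -mulr_sumr -/A sumr_const card_ord -[A *+ _]mulr_natl -mulrDr.
  by move/(mulfI (lt0r_neq0 N1)); lra.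
apply: (mulfI (lt0r_neq0 N1)); rewrite mulrBr cE.
by have := row i; rewrite AE -natr1; lra.
Qed.

Let gram i j : dotv (x i) (x j) = (i == j)%:R / 2 - c.
Proof.
by have := d2 i j; rewrite sqr_enormB !gram_diag; lra.
Qed.

Let S k l := \sum_i x i ord0 k * x i ord0 l.

(** [S] is the sum of the [x_i^T x_i].  The Gram matrix of the vertices gives
    its trace and the sum of the squares of its entries, and these are the values for
    half the identity matrix; so [S] is at distance 0 from the latter. *)
Let frame_matrix k l : S k l = (k == l)%:R / 2.
Proof.
have sumS2 : \sum_k \sum_l S k l ^+ 2 = N%:R / 4.
  transitivity (\sum_i \sum_j dotv (x i) (x j) ^+ 2).
    transitivity (\sum_k \sum_l \sum_i \sum_j
        x i ord0 k * x i ord0 l * (x j ord0 k * x j ord0 l)).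
      apply: eq_bigr => k' _; apply: eq_bigr => l' _.
      by rewrite expr2 mulr_suml; apply: eq_bigr => i _; rewrite mulr_sumr.
    rewrite pair_big/= exchange_big/=; apply: eq_bigr => i _.
    rewrite exchange_big/=; apply: eq_bigr => j _.
    rewrite expr2 mulr_suml -(pair_big xpredT xpredT (fun k' l' =>
      x i ord0 k' * x i ord0 l' * (x j ord0 k' * x j ord0 l')))/=.
    apply: eq_bigr => k' _; rewrite mulr_sumr; apply: eq_bigr => l' _; ring.
  transitivity (\sum_(i < N.+1) (N.+1%:R * c ^+ 2 - (c - 1 / 4))).
    apply: eq_bigr => i _; rewrite -(sumd i); apply: eq_bigr => j _.
    by rewrite gram; case: (i == j) => /=; rewrite ?mulr1n ?mulr0n; field.
  rewrite sumc.
  have -> : N.+1%:R * (N.+1%:R * c ^+ 2 - (c - 1 / 4)) =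
    (N.+1%:R * c) ^+ 2 - N.+1%:R * c + N.+1%:R / 4 by ring.
  by rewrite cE -natr1; field.
have trS : \sum_k S k k = N%:R / 2.
  rewrite exchange_big/=; transitivity (\sum_(i < N.+1) (1 / 2 - c)).
    by apply: eq_bigr => i _; rewrite -(gram_diag i).
  by rewrite sumc mulrBr cE -natr1; field.
have : \sum_k \sum_l (S k l - (k == l)%:R / 2) ^+ 2 = 0.
  transitivity (\sum_k \sum_l (S k l ^+ 2 - (k == l)%:R * (S k k - 1 / 4))).
    apply: eq_bigr => k' _; apply: eq_bigr => l' _.
    have [->|_] := eqVneq k' l'; first by rewrite mulr1n; field.
    by rewrite mul0r !subr0 mul0r subr0.
  transitivity (\sum_k \sum_l S k l ^+ 2 - \sum_k (S k k - 1 / 4)).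
    rewrite -sumrB; apply: eq_bigr => k' _; rewrite sumrB; congr (_ - _).
    rewrite (bigD1 k')//= eqxx [true%:R * _]mul1r big1 ?addr0// => l' lk.
    by rewrite eq_sym (negPf lk) mul0r.
  rewrite sumS2 sumrB trS sumr_const card_ord -[1 / 4 *+ _]mulr_natl.
  by field.
move/eqP; rewrite psumr_eq0; last first.
  by move=> k' _; apply: sumr_ge0 => l' _; exact: sqr_ge0.
move/allP => /(_ k (mem_index_enum _))/=.
rewrite psumr_eq0; last by move=> l' _; exact: sqr_ge0.
move/allP => /(_ l (mem_index_enum _))/=.
by rewrite sqrf_eq0 subr_eq0 => /eqP.
Qed.

Lemma centered_simplex_frame v : \sum_i dotv v (x i) ^+ 2 = dotv v v / 2.
Proof.
transitivity (\sum_k \sum_l v ord0 k * v ord0 l * S k l).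
  under eq_bigr => i _.
    rewrite expr2 {1}/dotv mulr_suml.
    under eq_bigr => k _ do rewrite /dotv mulr_sumr.
    over.
  rewrite exchange_big/=; apply: eq_bigr => k _.
  rewrite exchange_big/=; apply: eq_bigr => l _.
  by rewrite mulr_sumr; apply: eq_bigr => i _; ring.
rewrite /dotv mulr_suml; apply: eq_bigr => k _.
rewrite (bigD1 k)//= frame_matrix eqxx big1 ?addr0; first by rewrite mulrA mulr1.
by move=> l lk; rewrite frame_matrix eq_sym (negPf lk) mul0r mulr0.
Qed.

(** Taking the vertex [j] as origin adds [(N+1) (v.x_j)^2] to the frame identity. *)
Lemma centered_simplex_frame_at v j :
  dotv v v / 2 <= \sum_i dotv v (x i - x j) ^+ 2.
Proof.
rewrite -centered_simplex_frame.
have -> : \sum_i dotv v (x i - x j) ^+ 2 =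
    \sum_i dotv v (x i) ^+ 2 + N.+1%:R * dotv v (x j) ^+ 2.
  transitivity (\sum_i (dotv v (x i) ^+ 2 - 2 * dotv v (x j) * dotv v (x i)
      + dotv v (x j) ^+ 2)).
    by apply: eq_bigr => i _; rewrite !dotvE; ring.
  rewrite big_split/= sumrB -mulr_sumr sumdot mulr0 subr0.
  by rewrite sumr_const card_ord mulr_natl.
by rewrite lerDl mulr_ge0 ?sqr_ge0.
Qed.

(** By the frame identity the sum is [1 + (N+1) (|z|^2 - rho^2)^2], where [rho] is
    the radius of the circumscribed sphere. *)
Lemma centered_simplex_quartic z : 1 <= \sum_i (enorm (z - x i) ^+ 2 - 1) ^+ 2.
Proof.
pose b := dotv z z + (1 / 2 - c) - 1.
have -> : \sum_i (enorm (z - x i) ^+ 2 - 1) ^+ 2 = N.+1%:R * b ^+ 2 + 2 * dotv z z.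
  transitivity (\sum_i (b ^+ 2 - 4 * b * dotv z (x i) + 4 * dotv z (x i) ^+ 2)).
    by apply: eq_bigr => i _; rewrite sqr_enormB gram_diag /b; ring.
  rewrite big_split/= sumrB -!mulr_sumr sumdot centered_simplex_frame.
  by rewrite sumc; field.
have -> : N.+1%:R * b ^+ 2 + 2 * dotv z z =
   N.+1%:R * (dotv z z - (1 / 2 - c)) ^+ 2 + (N.+1%:R * c) * 2.
  have -> : N.+1%:R * b ^+ 2 = N.+1%:R * (dotv z z - (1 / 2 - c)) ^+ 2 -
     (N.+1%:R * c) * (4 * dotv z z - 2) by rewrite /b; field.
  by rewrite cE; field.
rewrite cE divfK ?lt0r_neq0// lerDr mulr_ge0 ?sqr_ge0//.
Qed.

End centered.

Section uncentered.
Variable x : 'I_N.+1 -> 'rV[R]_N.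
Hypothesis x1 : unit_simplex x.

Let o := (N.+1%:R : R)^-1 *: \sum_i x i.
Let y i := x i - o.

Let y0 : \sum_i y i = 0.
Proof.
rewrite /y sumrB sumr_const card_ord /o -scaler_nat scalerA.
by rewrite mulfV ?lt0r_neq0// scale1r subrr.
Qed.

Let yB i j : y i - y j = x i - x j.
Proof. by rewrite /y opprB addrA subrK. Qed.

Let y1 : unit_simplex y.
Proof. by move=> i j ij; rewrite yB x1. Qed.

Lemma simplex_frame v j :
  enorm v ^+ 2 / 2 <= \sum_i dotv v (x i - x j) ^+ 2.
Proof.
rewrite sqr_enorm; under eq_bigr do rewrite -yB.
exact: centered_simplex_frame_at.
Qed.

Lemma simplex_quartic z : 1 <= \sum_i (enorm (z - x i) ^+ 2 - 1) ^+ 2.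
Proof.
have := centered_simplex_quartic y0 y1 (z - o).
by under eq_bigr do rewrite /y opprB addrA subrK.
Qed.

End uncentered.
End simplex.

(** * Rigid motions and almost regular simplices *)

Section rigid_motions.
Context (R : realType) (N : nat).
Implicit Types (x y z u w : 'rV[R]_N) (T S : 'rV[R]_N -> 'rV[R]_N) (Q : 'M[R]_N).

Lemma orthogonal_dotv Q x y : Q *m Q^T = 1%:M -> dotv (x *m Q) (y *m Q) = dotv x y.
Proof.
by move=> QQ; rewrite !dotv_mulmx trmx_mul mulmxA -(mulmxA x) QQ mulmx1.
Qed.

Lemma rigid_motion_id : rigid_motion (@idfun 'rV[R]_N).
Proof.
by exists 1%:M, 0; split=> [|x]; [rewrite trmx1 mulmx1|rewrite mulmx1 addr0].
Qed.

Lemma rigid_motion_comp S T : rigid_motion S -> rigid_motion T ->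
  rigid_motion (S \o T).
Proof.
move=> [Q [v [QQ SE]]] [P [w [PP TE]]]; exists (P *m Q), (w *m Q + v); split.
  by rewrite trmx_mul mulmxA -(mulmxA P) QQ mulmx1.
by move=> x; rewrite /= TE SE mulmxDl mulmxA addrA.
Qed.

Lemma rigid_motion_isometry T x y : rigid_motion T ->
  enorm (T x - T y) = enorm (x - y).
Proof.
move=> [Q [v [QQ TE]]]; rewrite !TE opprD addrACA subrr addr0 -mulmxBl.
by rewrite !enorm_dotv orthogonal_dotv.
Qed.

Lemma rigid_motion_inv T : rigid_motion T ->
  exists S, [/\ rigid_motion S, cancel T S & cancel S T].
Proof.
move=> [Q [v [QQ TE]]]; have QQ' := mulmx1C QQ.
exists (fun x => x *m Q^T + (- v *m Q^T)); split.
- by exists Q^T, (- v *m Q^T); split=> //; rewrite trmxK.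
- by move=> x; rewrite TE -mulmxDl addrK -mulmxA QQ mulmx1.
- by move=> x; rewrite TE -mulmxDl -mulmxA QQ' mulmx1 subrK.
Qed.

Lemma rigid_motion_conv T x y (t : R) : rigid_motion T ->
  T (t *: x + (1 - t) *: y) = t *: T x + (1 - t) *: T y.
Proof.
move=> [Q [v [QQ TE]]]; rewrite !TE mulmxDl -!scalemxAl !scalerDr addrACA.
by rewrite -scalerDl addrCA subrr addr0 scale1r.
Qed.

(** The reflection that exchanges [u] and [w].  The scalar product with the
    normal is written as a difference of squared distances, which is small for a
    point almost equidistant from [u] and [w]. *)
Definition reflection u w x : 'rV[R]_N :=
  x - ((enorm (x - w) ^+ 2 - enorm (x - u) ^+ 2) / enorm (u - w) ^+ 2) *: (u - w).

Lemma reflection_rigid u w : u != w -> rigid_motion (reflection u w).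
Proof.
move=> uw; pose n := u - w; pose d := dotv n n.
have d0 : d != 0.
  by apply: contra_neq uw => /dotv_eq0 /eqP; rewrite subr_eq0 => /eqP.
have nnT : n *m n^T = d%:M.
  by apply/matrixP => i j; rewrite !ord1 /d dotv_mulmx [RHS]mxE eqxx mulr1n.
pose A := n^T *m n; pose k := 2 / d.
have AT : A^T = A by rewrite trmx_mul trmxK.
have AA : A *m A = d *: A.
  by rewrite mulmxA -(mulmxA n^T n) nnT mul_mx_scalar -scalemxAl.
exists (1%:M - k *: A), (((dotv u u - dotv w w) / d) *: n); split.
  have -> : (1%:M - k *: A)^T = 1%:M - k *: A.
    by rewrite [LHS]raddfB/= [(k *: A)^T]linearZ/= AT trmx1.
  rewrite mulmxBl mul1mx mulmxBr mulmx1 -scalemxAl -scalemxAr AA !scalerA.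
  rewrite -addrA -opprD -[RHS]subr0; congr (_ - _).
  rewrite -scaleNr -!scalerDl (_ : _ + _ = 0) ?scale0r//.
  by rewrite /k; field.
move=> x; rewrite /reflection (sqr_enorm (u - w)) -/n -/d mulmxBr mulmx1 -addrA.
congr (_ + _); rewrite -scalemxAr mulmxA.
have -> : x *m n^T = (dotv x n)%:M.
  by apply/matrixP => i j; rewrite !ord1 dotv_mulmx [RHS]mxE eqxx mulr1n.
rewrite mul_scalar_mx scalerA.
have -> : (enorm (x - w) ^+ 2 - enorm (x - u) ^+ 2) / d =
    k * dotv x n - (dotv u u - dotv w w) / d.
  by rewrite !sqr_enormB /k /n !dotvE; field.
by rewrite scalerBl opprB addrC.
Qed.

Lemma reflection_swap u w : u != w -> reflection u w u = w.
Proof.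
move=> uw; rewrite /reflection subrr enorm0 expr0n/= subr0 divff.
  by rewrite scale1r opprB addrCA subrr addr0.
rewrite expf_neq0//; apply: contra_neq uw => /enorm_eq0/eqP.
by rewrite subr_eq0 => /eqP.
Qed.

Lemma reflection_move u w x : u != w -> enorm (reflection u w x - x) =
  `|enorm (x - w) ^+ 2 - enorm (x - u) ^+ 2| / enorm (u - w).
Proof.
move=> uw.
have n0 : enorm (u - w) != 0.
  by apply: contra_neq uw => /enorm_eq0/eqP; rewrite subr_eq0 => /eqP.
rewrite /reflection addrAC subrr add0r enormN enormZ normrM normfV.
by rewrite [`|enorm _ ^+ 2|]ger0_norm ?sqr_ge0//; field.
Qed.

(** The vertices are put in place one at a time.  When [k] of them are almost in
    place, the next one and its target are both almost at distance 1 from these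
    [k] points, so the reflection that exchanges the next one and its target almost
    fixes them. *)
Lemma almost_simplex_aligns (x : 'I_N.+1 -> 'rV[R]_N) (e : R) :
  unit_simplex x -> 0 < e ->
  exists2 d : R, 0 < d & forall y : 'I_N.+1 -> 'rV[R]_N,
    (forall i j, i != j -> `|enorm (y i - y j) - 1| < d) ->
    exists2 T, rigid_motion T & forall i, enorm (T (y i) - x i) < e.
Proof.
move=> x1 e0.
suff H k : forall e : R, 0 < e -> e <= 1 -> exists2 d : R, 0 < d &
    forall y : 'I_N.+1 -> 'rV[R]_N,
    (forall i j, i != j -> `|enorm (y i - y j) - 1| < d) ->
    exists2 T, rigid_motion T &
      forall i : 'I_N.+1, (i < k)%N -> enorm (T (y i) - x i) < e.
  have m0 : 0 < Num.min e 1 by rewrite lt_min e0 ltr01.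
  have m1 : Num.min e 1 <= 1 by rewrite ge_min lexx orbT.
  have [d d0 Hd] := H N.+1 _ m0 m1; exists d => // y /Hd[T rT HT].
  by exists T => // i; apply: lt_le_trans (HT i (ltn_ord i)) _; rewrite ge_min lexx.
elim: k => [|k IH] {e0}e e0 e1.
  by exists 1 => // y _; exists idfun => //; exact: rigid_motion_id.
(* A reflection is used only when [|u - w| >= e]; it then moves the placed
   vertices by at most [6 e' / e], a fraction of [e]. *)
pose e' := e ^+ 2 / 16.
have e'0 : 0 < e' by rewrite divr_gt0// exprn_gt0.
have e'e : e' <= e / 16 by rewrite ler_pM2r ?invr_gt0// expr2 ler_piMl// ltW.
have [d d0 Hd] := IH e' e'0 ltac:(lra).
exists (Num.min d e') => [|y Hy]; first by rewrite lt_min d0.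
have [i j ij|T rT HT] := Hd y.
  by apply: lt_le_trans (Hy i j ij) _; rewrite ge_min lexx.
have [kN|kN] := ltnP k N.+1; last first.
  exists T => // i _; have ik : (i < k)%N := leq_trans (ltn_ord i) kN.
  by have := HT i ik; lra.
pose K := Ordinal kN; pose u := T (y K); pose w := x K.
have [uwe|uwe] := ltP (enorm (u - w)) e.
  exists T => // i; rewrite ltnS leq_eqVlt => /predU1P[ik|ik].
    by have -> : i = K by exact: val_inj.
  by have := HT i ik; lra.
have uw : u != w by apply: contraTneq uwe => ->; rewrite subrr enorm0 -ltNge.
exists (reflection u w \o T).
  by apply: rigid_motion_comp => //; exact: reflection_rigid.
move=> i; rewrite ltnS leq_eqVlt => /predU1P[ik|ik].
  have -> : i = K by exact: val_inj.
  by rewrite /= reflection_swap// subrr enorm0.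
have iK : i != K by rewrite -val_eqE/= neq_ltn ik.
have Ti := HT i ik.
apply: le_lt_trans (enorm_trans (reflection u w (x i)) _ _) _.
rewrite /= (rigid_motion_isometry _ _ (reflection_rigid uw)) reflection_move//.
rewrite /w x1// expr1n -/w.
have h1 : `|enorm (T (y i) - u) - 1| < e'.
  rewrite rigid_motion_isometry//; apply: lt_le_trans (Hy i K iK) _.
  by rewrite ge_min lexx orbT.
have h2 := enorm_dist (x i) (T (y i)) u.
set r := enorm (x i - u) in h2 *.
have r0 : 0 <= r by exact: enorm_ge0.
have r1 : `|1 - r| <= 2 * e'.
  move: h1 h2; rewrite ltr_norml !ler_norml => /andP[? ?] /andP[? ?].
  by apply/andP; split; lra.
have r2 : `|1 - r ^+ 2| <= 6 * e'.
  have -> : 1 - r ^+ 2 = (1 - r) * (1 + r) by ring.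
  rewrite normrM [`|1 + r|]ger0_norm; last by lra.
  have : 1 + r <= 3 by move: r1; rewrite ler_norml => /andP[]; lra.
  by have := normr_ge0 (1 - r); nra.
have : `|1 - r ^+ 2| / enorm (u - w) <= 6 * e' / e.
  apply: ler_pM => //; first by rewrite invr_ge0 enorm_ge0.
  by rewrite lef_pV2 ?posrE//; exact: lt_le_trans uwe.
have -> : 6 * e' / e = 6 / 16 * e by rewrite /e'; field; exact: lt0r_neq0.
by lra.
Qed.

Lemma convex_setP (A : set 'rV[R]_N) :
  (forall x y (t : R), A x -> A y -> 0 <= t <= 1 -> A (t *: x + (1 - t) *: y)) ->
  convex_set (A : set (convex_lmodType 'rV[R]_N)).
Proof.
move=> H x y t; rewrite !inE => Ax Ay.
by apply: (H _ _ t%:num) => //; apply/andP; split.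
Qed.

Lemma eball_conv (c x y : 'rV[R]_N) (r t : R) :
  eball c r x -> eball c r y -> 0 <= t <= 1 -> eball c r (t *: x + (1 - t) *: y).
Proof.
rewrite /eball/= => hx hy t01.
have -> : t *: x + (1 - t) *: y - c = t *: (x - c) + (1 - t) *: (y - c).
  by rewrite !scalerBr addrACA -opprD -scalerDl addrCA subrr addr0 scale1r.
apply: le_lt_trans (enorm_conv _ _ t01) _; move: t01 => /andP[t0 t1].
have [->|tn0] := eqVneq t 0; first by lra.
have t0' : 0 < t by rewrite lt_neqAle eq_sym tn0.
have : t * enorm (x - c) < t * r by rewrite ltr_pM2l.
have : (1 - t) * enorm (y - c) <= (1 - t) * r.
  by apply: ler_wpM2l; [lra|exact: ltW].
by lra.
Qed.

End rigid_motions.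

(** * The energy of the quartic kernel *)

Section quartic_energy.
Context (R : realType) (N : nat).
Local Notation V := 'rV[R]_N.
Variables (L : (V -> R) -> R) (G : (V -> R) -> Prop).
Hypotheses (Gcst : forall a, G (fun=> a)) (Gcoord : forall k, G (fun x => x ord0 k)).
Hypotheses (GD : forall f g, G f -> G g -> G (fun x => f x + g x)).
Hypotheses (GM : forall f g, G f -> G g -> G (fun x => f x * g x)).
Hypotheses (LD : forall f g, G f -> G g -> L (fun x => f x + g x) = L f + L g).
Hypotheses (LZ : forall a f, G f -> L (fun x => a * f x) = a * L f).
Hypotheses (L_ge0 : forall f, G f -> (forall x, 0 <= f x) -> 0 <= L f).

Let LZr a f : G f -> L (fun x => f x * a) = L f * a.
Proof.
by move=> Gf; under eq_fun do rewrite mulrC; rewrite LZ// mulrC.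
Qed.

Let Gsum (I : Type) (s : seq I) (F : I -> V -> R) :
  (forall i, G (F i)) -> G (fun x => \sum_(i <- s) F i x).
Proof.
move=> GF; elim: s => [|i s IH]; first by under eq_fun do rewrite big_nil.
by under eq_fun do rewrite big_cons; exact: GD.
Qed.

Let Lsum (I : Type) (s : seq I) (F : I -> V -> R) :
  (forall i, G (F i)) -> L (fun x => \sum_(i <- s) F i x) = \sum_(i <- s) L (F i).
Proof.
move=> GF; elim: s => [|i s IH].
  under eq_fun do rewrite big_nil; rewrite big_nil.
  rewrite (_ : (fun=> _) = (fun=> 0 * 0)); last by apply/funext => x; rewrite mul0r.
  by rewrite LZ ?mul0r.
by under eq_fun do rewrite big_cons; rewrite big_cons LD ?IH//; exact: Gsum.
Qed.

(** The side conditions travel with the value [e] of the double sum of [K], so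
    that an expanded kernel can be summed term by term. *)
Let tensor (K : V -> V -> R) (e : R) : Prop :=
  [/\ forall x, G (K x), G (fun x => L (K x)) & L (fun x => L (K x)) = e].

Let tensorD K1 K2 e1 e2 : tensor K1 e1 -> tensor K2 e2 ->
  tensor (fun x y => K1 x y + K2 x y) (e1 + e2).
Proof.
move=> [g1 h1 <-] [g2 h2 <-].
have E : (fun x => L (fun y => K1 x y + K2 x y)) = (fun x => L (K1 x) + L (K2 x)).
  by apply/funext => x; rewrite LD.
by split; [move=> x; exact: GD|rewrite E; exact: GD|rewrite E LD].
Qed.

Let tensorZ a K e : tensor K e -> tensor (fun x y => a * K x y) (a * e).
Proof.
move=> [g h <-].
have E : (fun x => L (fun y => a * K x y)) = (fun x => a * L (K x)).
  by apply/funext => x; rewrite LZ.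
by split; [move=> x; exact: GM|rewrite E; exact: GM|rewrite E LZ].
Qed.

Let tensorM f g : G f -> G g -> tensor (fun x y => f x * g y) (L f * L g).
Proof.
move=> Gf Gg.
have E : (fun x => L (fun y => f x * g y)) = (fun x => f x * L g).
  by apply/funext => x; rewrite LZ.
by split; [move=> x; exact: GM|rewrite E; exact: GM|rewrite E LZr].
Qed.

Let tensor_sum (F : 'I_N -> V -> V -> R) (e : 'I_N -> R) :
  (forall k, tensor (F k) (e k)) ->
  tensor (fun x y => \sum_k F k x y) (\sum_k e k).
Proof.
move=> H.
have E : (fun x => L (fun y => \sum_k F k x y)) = (fun x => \sum_k L (F k x)).
  by apply/funext => x; rewrite Lsum// => k; have [] := H k.
split.
- by move=> x; apply: Gsum => k; have [] := H k.
- by rewrite E; apply: Gsum => k; have [] := H k.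
- rewrite E Lsum; last by move=> k; have [] := H k.
  by apply: eq_bigr => k _; have [] := H k.
Qed.

(** Here [L] is a sum over finitely many points or an integral, and [G] a class
    of functions on which it is linear.  With [U] the squared distance to the
    barycentre, [m] the total mass, [t] and [q] the values of [L] on [U] and [U^2],
    and [S] the sum of the squares of the entries of the second moment matrix, the
    odd moments drop out and the energy is [2 q m + m^2 + 2 t^2 - 4 t m + 4 S].
    By the Cauchy-Schwarz inequality [q m >= t^2] and [N S >= t^2], and what
    remains is a quadratic polynomial in [t], minimal at [2 (N+1) t = N m]. *)
Lemma quartic_energy_ge : (0 < N)%N -> 0 < L (fun=> 1) ->
  L (fun=> 1) ^+ 2 <=
  N.+1%:R * L (fun x => L (fun y => (enorm (x - y) ^+ 2 - 1) ^+ 2)).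
Proof.
move=> N0; set m := L (fun=> 1) => m0.
pose c k := L (fun x => x ord0 k) / m.
pose X k (x : V) := x ord0 k + - c k.
pose U x := \sum_k X k x * X k x.
have G1 : G (fun=> 1) by exact: Gcst.
have GX k : G (X k) by apply: GD.
have GU : G U by apply: Gsum => k; exact: GM.
have LX k : L (X k) = 0.
  rewrite LD// (_ : (fun=> - c k) = (fun=> - c k * 1)); last first.
    by apply/funext => x; rewrite mulr1.
  by rewrite LZ// -/m /c mulNr divfK ?lt0r_neq0// subrr.
pose q := L (fun x => U x * U x); pose t := L U.
pose M k l := L (fun x => X k x * X l x).
pose b k := L (fun x => U x * X k x).
have tE : t = \sum_k M k k by rewrite /t Lsum// => k; exact: GM.
have KE : (fun x y : V => (enorm (x - y) ^+ 2 - 1) ^+ 2) =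
    (fun x y => U x * U x * 1 + (1 * (U y * U y) + (1 * 1 + (2 * (U x * U y) +
      ((-2) * (U x * 1) + ((-2) * (1 * U y) +
      (4 * (\sum_k \sum_l (X k x * X l x) * (X k y * X l y)) +
      ((-4) * (\sum_k (U x * X k x) * X k y) +
      ((-4) * (\sum_k X k x * (U y * X k y)) +
       4 * \sum_k X k x * X k y))))))))).
  apply/funext => x; apply/funext => y.
  pose P := \sum_k X k x * X k y.
  have -> : enorm (x - y) ^+ 2 = U x + U y - 2 * P.
    rewrite sqr_enorm /dotv /U /P mulr_sumr -big_split -sumrB/=.
    by apply: eq_bigr => k _; rewrite !mxE /X; ring.
  have -> : \sum_k \sum_l (X k x * X l x) * (X k y * X l y) = P ^+ 2.
    rewrite expr2 {1}/P mulr_suml; apply: eq_bigr => k _.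
    by rewrite mulr_sumr; apply: eq_bigr => l _; ring.
  have -> : \sum_k (U x * X k x) * X k y = U x * P.
    by rewrite mulr_sumr; apply: eq_bigr => k _; ring.
  have -> : \sum_k X k x * (U y * X k y) = U y * P.
    by rewrite mulr_sumr; apply: eq_bigr => k _; ring.
  by rewrite -/P; ring.
have GUU : G (fun x => U x * U x) by exact: GM.
have GXX k l : G (fun x => X k x * X l x) by exact: GM.
have GUX k : G (fun x => U x * X k x) by exact: GM.
have [_ _] := tensorD (tensorM GUU G1) (tensorD (tensorM G1 GUU)
  (tensorD (tensorM G1 G1) (tensorD (tensorZ 2 (tensorM GU GU))
  (tensorD (tensorZ (-2) (tensorM GU G1)) (tensorD (tensorZ (-2) (tensorM G1 GU))
  (tensorD (tensorZ 4 (tensor_sum (fun k => tensor_sum (fun l =>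
     tensorM (GXX k l) (GXX k l)))))
  (tensorD (tensorZ (-4) (tensor_sum (fun k => tensorM (GUX k) (GX k))))
  (tensorD (tensorZ (-4) (tensor_sum (fun k => tensorM (GX k) (GUX k))))
  (tensorZ 4 (tensor_sum (fun k => tensorM (GX k) (GX k)))))))))))).
have := congr1 (fun K => L (fun x => L (K x))) KE => /= -> ->.
rewrite -/m -/q -/t.
have -> : \sum_k L (fun x => U x * X k x) * L (X k) = 0.
  by apply: big1 => k _; rewrite LX mulr0.
have -> : \sum_k L (X k) * L (fun x => U x * X k x) = 0.
  by apply: big1 => k _; rewrite LX mul0r.
have -> : \sum_k L (X k) * L (X k) = 0.
  by apply: big1 => k _; rewrite LX mul0r.
have qm : t ^+ 2 <= q * m.
  pose a := t / m.
  have am : a * m = t by rewrite /a divfK// lt0r_neq0.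
  have : 0 <= L (fun x => (U x + - a) * (U x + - a)).
    by apply: L_ge0 => [|x]; [apply: GM; exact: GD|rewrite -expr2 sqr_ge0].
  have -> : (fun x => (U x + - a) * (U x + - a)) =
      (fun x => U x * U x + ((-2 * a) * U x + a ^+ 2 * 1)).
    by apply/funext => x; ring.
  have GaU : G (fun x => -2 * a * U x) by exact: GM.
  have Ga1 : G (fun x => a ^+ 2 * 1) by exact: GM.
  rewrite LD//; last exact: GD.
  rewrite LD// !LZ// -/q -/t -/m => h.
  have : 0 <= m * (q + (-2 * a * t + a ^+ 2 * m)) by rewrite mulr_ge0// ltW.
  have -> : m * (q + (-2 * a * t + a ^+ 2 * m)) = q * m + (- 2 * (a * m) * t + (a * m) ^+ 2).
    by ring.
  by rewrite am; lra.
set S := \sum_k \sum_l _.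
have SM : t ^+ 2 <= N%:R * S.
  have NR : 0 < N%:R :> R by rewrite ltr0n.
  have h1 : \sum_k M k k ^+ 2 <= S.
    apply: ler_sum => k _; rewrite (bigD1 k)//= -expr2 lerDl.
    by apply: sumr_ge0 => l _; rewrite -expr2 sqr_ge0.
  have : 0 <= \sum_k (M k k - t / N%:R) ^+ 2.
    by apply: sumr_ge0 => k _; exact: sqr_ge0.
  have -> : \sum_k (M k k - t / N%:R) ^+ 2 = \sum_k M k k ^+ 2 - t ^+ 2 / N%:R.
    transitivity (\sum_k (M k k ^+ 2 - 2 * (t / N%:R) * M k k + (t / N%:R) ^+ 2)).
      by apply: eq_bigr => k _; ring.
    rewrite big_split/= sumrB -mulr_sumr -tE sumr_const card_ord.
    by rewrite -[_ ^+ 2 *+ _]mulr_natl; field; exact: lt0r_neq0.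
  rewrite subr_ge0 ler_pdivrMr// => /le_trans; apply.
  by rewrite mulrC ler_pM2l.
rewrite -natr1; have NR : 0 < N%:R :> R by rewrite ltr0n.
set n : R := N%:R in SM NR *.
rewrite !mulr0 !addr0.
rewrite -(ler_pM2l NR).
have := sqr_ge0 (2 * (n + 1) * t - n * m).
have : 0 <= n * (n + 1) * (2 * (q * m - t ^+ 2)).
  by rewrite !mulr_ge0//; lra.
have : 0 <= (n + 1) * (4 * (n * S - t ^+ 2)) by rewrite !mulr_ge0//; lra.
by nra.
Qed.

End quartic_energy.

Section almost_equidistant.
Context (R : realType) (N : nat).

Lemma finite_quartic_energy_ge n (x : 'I_n -> 'rV[R]_N) : (0 < N)%N ->
  n%:R ^+ 2 <= N.+1%:R * \sum_i \sum_j (enorm (x i - x j) ^+ 2 - 1) ^+ 2 :> R.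
Proof.
move=> N0; case: n x => [|n] x.
  by rewrite big_ord0 mulr0 expr0n.
pose L (f : 'rV[R]_N -> R) := \sum_i f (x i).
have L1 : L (fun=> 1) = n.+1%:R by rewrite /L sumr_const card_ord.
rewrite -L1; apply: (@quartic_energy_ge R N L (fun=> True)) => //.
- by move=> f g _ _; rewrite /L big_split.
- by move=> a f _; rewrite /L mulr_sumr.
- by move=> f _ f0; apply: sumr_ge0.
- by rewrite L1 ltr0n.
Qed.

(** For [n] points at mutual distances close to 1 the quartic energy is close to
    [n], the contribution of the diagonal, and [n^2 <= (N+1) n] fails for
    [n = N+2]. *)
Lemma almost_equidistant_bound : (0 < N)%N -> exists2 d : R, 0 < d &
  forall x : 'I_N.+2 -> 'rV[R]_N,
    ~ forall i j, i != j -> `|enorm (x i - x j) - 1| < d.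
Proof.
move=> N0; pose n : R := N.+2%:R; have n2 : 2 <= n by rewrite ler_nat.
exists (1 / (4 * n)) => [|x H]; first by rewrite divr_gt0//; lra.
set d := 1 / _ in H.
have d0 : 0 < d by rewrite divr_gt0//; lra.
have dn : 4 * d * n = 1 by rewrite /d; field; lra.
have d1 : d <= 1 / 8.
  by rewrite /d ler_pM2l// lef_pV2 ?posrE//; lra.
have := finite_quartic_energy_ge x N0; rewrite -/n.
have : \sum_i \sum_j (enorm (x i - x j) ^+ 2 - 1) ^+ 2 <=
    \sum_(i < N.+2) (1 + n * (9 * d ^+ 2)).
  apply: ler_sum => i _; rewrite (bigD1 i)//= subrr enorm0 expr0n/= sub0r sqrrN expr1n.
  rewrite lerD2l.
  have -> : n * (9 * d ^+ 2) = \sum_(j < N.+2) 9 * d ^+ 2.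
    by rewrite sumr_const card_ord /n mulr_natl.
  rewrite [leRHS](bigD1 i)//= -[leLHS]add0r; apply: lerD.
    by rewrite mulr_ge0// sqr_ge0.
  apply: ler_sum => j ji; have := H i j; rewrite eq_sym => /(_ ji).
  set r := enorm _; have r0 : 0 <= r by exact: enorm_ge0.
  rewrite ltr_norml => /andP[h1 h2].
  have -> : (r ^+ 2 - 1) ^+ 2 = (r - 1) ^+ 2 * (r + 1) ^+ 2 by ring.
  have : (r - 1) ^+ 2 <= d ^+ 2 by nra.
  have : (r + 1) ^+ 2 <= 9 by nra.
  have := sqr_ge0 (r - 1); have := sqr_ge0 (r + 1).
  by nra.
rewrite sumr_const card_ord -[(_ + _) *+ _]mulr_natl -/n => h1 h2.
have : n ^+ 2 <= N.+1%:R * (n * (1 + n * (9 * d ^+ 2))).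
  by apply: (le_trans h2); rewrite ler_pM2l.
have -> : N.+1%:R = n - 1 by rewrite /n -[N.+2%:R]natr1; ring.
have -> : n * (1 + n * (9 * d ^+ 2)) = n + 9 / 16 * (4 * d * n) ^+ 2 by field.
by rewrite dn; nra.
Qed.

End almost_equidistant.

(** * Lebesgue measure of sets of row vectors *)

Section lebesgue_translation.
Context (R : realType).

Lemma lebesgue_measure_translate (a : R) (A : set (measurableTypeR R)) :
  measurable A ->
  lebesgue_measure ((fun t : measurableTypeR R => t + a : measurableTypeR R) @^-1` A) =
  lebesgue_measure A.
Proof.
pose f (t : measurableTypeR R) : measurableTypeR R := t + a.
have mf : measurable_fun setT f by apply: measurable_funD.
move=> mA; apply/esym.
apply: (@lebesgue_measure_unique R (pushforward (@lebesgue_measure R) f)) => //.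
move=> X [[x y] /= xy <-]; rewrite /pushforward.
have -> : f @^-1` `]x, y] = `]x - a, y - a]%classic.
  by apply/seteqP; split => t /=; rewrite !in_itv/= /f ltrBlDr lerBrDr.
rewrite !lebesgue_measure_itv/= !lte_fin ltrD2r; case: ifPn => // _.
by rewrite -!EFinD opprD addrACA subrr addr0.
Qed.

End lebesgue_translation.

Section measurable_rV_operations.
Context (R : realType) (n : nat).
Context d (T : measurableType d).
Implicit Types f g : T -> 'rV[R]_n.

Lemma measurable_rV_coord f i : measurable_fun setT f ->
  measurable_fun setT (fun x => f x ord0 i : R).
Proof. by move=> mf; exact: (measurableT_comp (measurable_coord i) mf). Qed.

Lemma measurable_rVD f g : measurable_fun setT f -> measurable_fun setT g ->
  measurable_fun setT (fun x => f x + g x).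
Proof.
move=> mf mg; apply: measurable_rVP => i.
rewrite (_ : (fun x => _) = (fun x => f x ord0 i + g x ord0 i)); last first.
  by apply/funext => x; rewrite mxE.
by apply: measurable_funD; exact: measurable_rV_coord.
Qed.

Lemma measurable_rVB f g : measurable_fun setT f -> measurable_fun setT g ->
  measurable_fun setT (fun x => f x - g x).
Proof.
move=> mf mg; apply: measurable_rVP => i.
rewrite (_ : (fun x => _) = (fun x => f x ord0 i - g x ord0 i)); last first.
  by apply/funext => x; rewrite !mxE.
by apply: measurable_funB; exact: measurable_rV_coord.
Qed.

Lemma measurable_rV_mulmx f (Q : 'M[R]_n) : measurable_fun setT f ->
  measurable_fun setT (fun x => f x *m Q).
Proof.
move=> mf; apply: measurable_rVP => i.
rewrite (_ : (fun x => _) = (fun x => \sum_k f x ord0 k * Q k i)); last first.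
  by apply/funext => x; rewrite mxE.
apply: measurable_sum => k; apply: measurable_funM => //.
exact: measurable_rV_coord.
Qed.

Lemma measurable_enorm f : measurable_fun setT f ->
  measurable_fun setT (fun x => enorm (f x)).
Proof.
move=> mf; rewrite (_ : (fun x => _) =
    (fun x => (\sum_k f x ord0 k ^+ 2) `^ 2^-1)); last first.
  apply/funext => x; rewrite powR12_sqrt//.
  by apply: sumr_ge0 => k _; rewrite sqr_ge0.
apply: (@measurableT_comp _ _ _ _ _ _ (@powR R ^~ 2^-1)).
  exact: measurable_powR.
apply: measurable_sum => k; apply: measurable_funX.
exact: measurable_rV_coord.
Qed.

End measurable_rV_operations.

Section lebesgue_rV_properties.
Context (R : realType).
Local Notation mu n := (lebesgue_rV R n).

(** Uniqueness of product measures, one coordinate after the other. *)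
Lemma lebesgue_rV_translate n (v : 'rV[R]_n) (A : set 'rV[R]_n) :
  measurable A -> mu n ((fun x => x + v) @^-1` A) = mu n A.
Proof.
elim: n => [|n IH] in v A *.
  move=> mA; congr (mu 0 _); apply/seteqP; split => x /=;
  by rewrite (_ : x + v = x)//; apply/rowP; case.
move=> mA.
pose w : 'rV[R]_n := \row_j v ord0 (lift ord0 j).
pose f (p : measurableTypeR R * 'rV[R]_n) : measurableTypeR R * 'rV[R]_n :=
  (p.1 + v ord0 ord0, p.2 + w).
have mf : measurable_fun setT f.
  apply: measurable_fun_pair; first by apply: measurable_funD.
  by apply: measurable_rVD.
have mB : measurable (@rV_cons R n @^-1` A).
  by rewrite -[X in measurable X]setTI; exact: measurable_rV_cons.
rewrite /= /lebesgue_rV_succ /pushforward.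
have -> : @rV_cons R n @^-1` ((fun x => x + v) @^-1` A) =
    f @^-1` (@rV_cons R n @^-1` A).
  have E p : rV_cons p + v = rV_cons (f p).
    apply/rowP => j; rewrite mxE; case: (unliftP ord0 j) => [k|] ->.
      by rewrite !rV_consS /f/= !mxE.
    by rewrite !rV_cons0.
  by apply/seteqP; split => p /=; rewrite E.
apply/esym; apply: (@product_measure_unique _ _ _ _ _ _ (mu n)
  (pushforward (product_measure1 (@lebesgue_measure R) (mu n)) f)) => //.
move=> X Y mX mY; rewrite /pushforward.
pose X' := (fun t : measurableTypeR R => t + v ord0 ord0 : measurableTypeR R) @^-1` X.
pose Y' := (fun x => x + w) @^-1` Y.
transitivity (lebesgue_measure X' * mu n Y')%E; last first.
  by rewrite /Y' IH//; congr (_ * _)%E; exact: lebesgue_measure_translate.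
rewrite -product_measure1E//.
- rewrite -[X in measurable X]setTI.
  by apply: (@measurable_funD _ _ R setT id (fun=> v ord0 ord0)) => //;
    exact: measurable_id.
- by rewrite -[X in measurable X]setTI; apply: measurable_rVD.
Qed.

Definition cube n (c : 'rV[R]_n) (s : R) : set 'rV[R]_n :=
  [set x | forall k, c ord0 k <= x ord0 k <= c ord0 k + s].

Lemma measurable_cube n (c : 'rV[R]_n) (s : R) : measurable (cube c s).
Proof.
rewrite (_ : cube c s = \bigcap_(i in [set: 'I_n])
  (setT `&` (fun v : 'rV[R]_n => v ord0 i : measurableTypeR R) @^-1`
     `[c ord0 i, c ord0 i + s]%classic)).
  apply: fin_bigcap_measurable => [|i _]; first exact: finite_finset.
  apply: (@measurable_coord R n i measurableT); exact: measurable_itv.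
apply/seteqP; split => [x xc i _|x xc i]; first by split=> //=; rewrite in_itv/=.
by have [_ /=] := xc i I; rewrite in_itv.
Qed.

Lemma lebesgue_rV_cube n (c : 'rV[R]_n) (s : R) : 0 <= s ->
  mu n (cube c s) = (s ^+ n)%:E.
Proof.
move=> s0; rewrite (_ : cube c s = [set v | forall i,
    `[c ord0 i, c ord0 i + s]%classic (v ord0 i)]); last first.
  by apply/seteqP; split => x xc k; have := xc k; rewrite /= in_itv.
rewrite (@lebesgue_rV_box R n (fun i => `[c ord0 i, c ord0 i + s]%classic)).
  rewrite (eq_bigr (fun=> s%:E)); last first.
    move=> i _; rewrite lebesgue_measure_itv/= lte_fin ltrDl.
    have [s0'|s0'] := ltP 0 s; first by rewrite -EFinD addrAC subrr add0r.
    by congr EFin; apply/eqP; rewrite eq_le s0 s0'.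
  have H m : (\prod_(i < m) s%:E = (s ^+ m)%:E)%E.
    by elim: m => [|m IH]; rewrite ?big_ord0// big_ord_recl IH exprS.
  exact: H.
by move=> i; exact: measurable_itv.
Qed.

Lemma measurable_eball n (c : 'rV[R]_n) (r : R) : measurable (eball c r).
Proof.
have m : measurable_fun setT (fun x : 'rV[R]_n => enorm (x - c)).
  by apply: measurable_enorm; apply: measurable_rVB.
rewrite (_ : eball c r = setT `&` (fun x => enorm (x - c)) @^-1` `]-oo, r[%classic).
  by apply: m => //; exact: measurable_itv.
by apply/seteqP; split => x /=; rewrite in_itv/=; [|case].
Qed.

Lemma lebesgue_rV_eball_lty n (c : 'rV[R]_n) (r : R) : (mu n (eball c r) < +oo)%E.
Proof.
have [r0|r0] := leP 0 r; last first.
  rewrite (_ : eball c r = set0) ?measure0// -subset0 => x; rewrite /eball/=.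
  by rewrite ltNge (le_trans (ltW r0))// enorm_ge0.
pose c' : 'rV[R]_n := \row_k (c ord0 k - r).
apply: (@le_lt_trans _ _ (mu n (cube c' (r + r)))); last first.
  by rewrite lebesgue_rV_cube ?addr_ge0// ltry.
apply: le_measure; rewrite ?inE; [exact: measurable_eball|exact: measurable_cube|].
move=> x; rewrite /eball/= => xr k; rewrite /c' mxE.
have := coord_le_enorm (x - c) k; rewrite !mxE ler_norml => /andP[h1 h2].
by apply/andP; split; lra.
Qed.

Lemma lebesgue_rV_setT_neq0 n : mu n setT != 0%E.
Proof.
apply/eqP => h; have := @lebesgue_rV_cube n 0 1 ler01.
rewrite expr1n => h1.
have : (mu n (cube 0 1) <= mu n setT)%E.
  by apply: le_measure; rewrite ?inE//; exact: measurable_cube.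
by rewrite h h1 lee_fin ler10.
Qed.

(** A change of variables formula is avoided by averaging over all translations.
    Integrate the indicator of [A] at [y + x Q] over [x] and [y].  For fixed [x]
    the inner integral is the measure of a translate of [A], hence 0; for fixed
    [y] it is the measure of a translate of the set under consideration, a constant. *)
Lemma lebesgue_rV_orthogonal_null n (Q : 'M[R]_n) (v : 'rV[R]_n) (A : set 'rV[R]_n) :
  Q *m Q^T = 1%:M -> measurable A -> mu n A = 0%E ->
  mu n [set y | A (y *m Q + v)] = 0%E.
Proof.
move=> QQ mA A0.
pose B := [set y | A (y *m Q + v)].
have mB : measurable B.
  rewrite -[X in measurable X]setTI; apply: (measurable_rVD _ _ _ mA) => //.
  exact: measurable_rV_mulmx.
pose F (p : 'rV[R]_n * 'rV[R]_n) : \bar R := (\1_A (p.2 + p.1 *m Q))%:E.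
have mF : measurable_fun setT F.
  apply/measurable_EFinP.
  apply: (@measurableT_comp _ _ _ _ _ _ (\1_A : _ -> R)).
    exact: measurable_indic.
  by apply: measurable_rVD => //; exact: measurable_rV_mulmx.
have F0 p : (0 <= F p)%E by rewrite lee_fin.
have indicE (C : set 'rV[R]_n) (f : 'rV[R]_n -> 'rV[R]_n) :
    (fun x => (\1_C (f x))%:E) = (fun x => (\1_(f @^-1` C) x)%:E : \bar R).
  by [].
have := @fubini_tonelli _ _ _ _ _ (mu n) (mu n) F mF F0.
rewrite (_ : (\int[mu n]_y _)%E = 0%E); last first.
  apply: integral0_eq => y _; rewrite /F/= indicE integral_indic//.
    rewrite setIT -[RHS]A0 -(lebesgue_rV_translate (y *m Q) mA).
    by congr (mu n _); apply/seteqP; split.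
  by rewrite -[X in measurable X]setTI; apply: measurable_rVD.
rewrite (_ : (\int[mu n]_x _)%E = (\int[mu n]_x (cst (mu n B) x))%E).
  rewrite integral_cst// => /esym/eqP; rewrite mule_eq0 (negPf (lebesgue_rV_setT_neq0 n)).
  by rewrite orbF => /eqP.
apply: eq_integral => x _; rewrite /F/= indicE integral_indic//.
  rewrite setIT -(lebesgue_rV_translate ((x - v) *m Q^T) mB); congr (mu n _).
  apply/seteqP; split => y; rewrite /preimage /B /= mulmxDl -[_ *m Q^T *m Q]mulmxA;
  by rewrite (mulmx1C QQ) mulmx1 -addrA subrK addrC.
rewrite -[X in measurable X]setTI; apply: (measurable_rVD _ _ _ mA) => //.
exact: measurable_rV_mulmx.
Qed.

Lemma rigid_motion_negligible n (T : 'rV[R]_n -> 'rV[R]_n) (A : set 'rV[R]_n) :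
  rigid_motion T -> (mu n).-negligible A -> (mu n).-negligible (T @` A).
Proof.
move=> rT [B [mB B0 AB]]; have [S [[Q [v [QQ SE]]] TS ST]] := rigid_motion_inv rT.
exists [set y | B (y *m Q + v)]; split.
- rewrite -[X in measurable X]setTI; apply: (measurable_rVD _ _ _ mB) => //.
  exact: measurable_rV_mulmx.
- exact: lebesgue_rV_orthogonal_null.
- by move=> _ [x Ax <-]; rewrite /= -SE TS; exact: AB.
Qed.

(** Such a set meets every line in at most two points; apply Fubini's theorem to
    the lines parallel to the first axis. *)
Lemma betweenness_free_null n (A : set 'rV[R]_n) : (0 < n)%N -> measurable A ->
  (forall x y (t : R), A x -> A y -> x != y -> 0 < t < 1 ->
     ~ A (t *: x + (1 - t) *: y)) ->
  mu n A = 0%E.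
Proof.
case: n A => // n A _ mA H.
pose B := @rV_cons R n @^-1` A.
have mB : measurable B.
  by rewrite -[X in measurable X]setTI; exact: measurable_rV_cons.
rewrite /= /lebesgue_rV_succ /pushforward -/B.
have mF : measurable_fun setT (fun p => (\1_B p)%:E : \bar R).
  by apply/measurable_EFinP; exact: measurable_indic.
have F0 p : (0 <= (\1_B p)%:E :> \bar R)%E by rewrite lee_fin.
rewrite -(setIT B) -integral_indic//.
rewrite (@fubini_tonelli1 _ _ _ _ _ _ _ (fun p => (\1_B p)%:E))//.
rewrite /fubini_F (@fubini_tonelli _ _ _ _ _ _ _ (fun p => (\1_B p)%:E))//.
apply: integral0_eq => v _.
pose S : set (measurableTypeR R) := [set t | B (t, v)].
have mS : measurable S.
  rewrite (_ : S = ysection B v); first exact: measurable_ysection.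
  by apply/seteqP; split => t; rewrite /ysection/= inE.
rewrite (_ : (fun x => _) = (fun x => (\1_S x)%:E)); last by apply/funext.
rewrite integral_indic// setIT.
have S3 a b c : S a -> S b -> S c -> a < b -> b < c -> False.
  move=> Sa Sb Sc ab bc; pose t := (c - b) / (c - a).
  have ca : 0 < c - a by lra.
  apply: (H (rV_cons (a, v)) (rV_cons (c, v)) t) => //.
  - apply/eqP => /rowP/(_ ord0); rewrite !rV_cons0/=; lra.
  - by rewrite divr_gt0//=; [rewrite ltr_pdivrMr//; lra|lra].
  rewrite (_ : _ + _ = rV_cons (b, v))//; apply/rowP => j.
  have scaleE (r : R) (u : 'rV[R]_n.+1) k : (r *: u) ord0 k = r * u ord0 k.
    by rewrite mxE.
  rewrite mxE !scaleE; case: (unliftP ord0 j) => [k|] ->.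
    by rewrite !rV_consS/=; ring.
  by rewrite !rV_cons0/= /t; field; exact: lt0r_neq0.
suff cS : countable S by exact: countable_lebesgue_measure0.
have [[a Sa]|S0] := pselect (exists a, S a); last first.
  by rewrite (_ : S = set0)// -subset0 => x Sx; apply: S0; exists x.
have [[b [Sb ba]]|Sb] := pselect (exists b, S b /\ b != a); last first.
  apply: (@sub_countable _ _ _ [set a]) => //; apply: subset_card_le => x Sx.
  by apply/eqP/negP => /negP xa; apply: Sb; exists x.
apply: (@sub_countable _ _ _ [set a; b]); last first.
  by apply: finite_set_countable; rewrite finite_setU; split; exact: finite_set1.
apply: subset_card_le => c Sc.
have [->|ca] := eqVneq c a; first by left.
have [->|cb] := eqVneq c b; first by right.
exfalso; move: ba ca cb.
have [||] := ltgtP a b => // ab _; have [||] := ltgtP c a => // ca _;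
  have [||] := ltgtP c b => // cb _; try lra.
all: solve [exact: (S3 c a b)|exact: (S3 a c b)|exact: (S3 a b c)
  |exact: (S3 c b a)|exact: (S3 b c a)|exact: (S3 b a c)].
Qed.

End lebesgue_rV_properties.

(** * Integration against a density *)

Section weighted_integral.
Local Open Scope ereal_scope.
Context (R : realType) (N : nat).
Local Notation V := 'rV[R]_N.
Local Notation mu := (lebesgue_rV R N).
Implicit Types (h k : V -> R) (F G : V -> \bar R) (A : set V).

Definition weight h : Prop := measurable_fun setT h /\ forall x, (0 <= h x)%R.

Definition wint h F : \bar R := \int[mu]_x (F x * (h x)%:E).

Definition mass h A : \bar R := wint h (fun x => (\1_A x)%:E).

Let mFh h F : weight h -> measurable_fun setT F ->
  measurable_fun setT (fun x => F x * (h x)%:E).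
Proof.
by move=> [mh _] mF; apply: emeasurable_funM => //; exact/measurable_EFinP.
Qed.

Let Fh0 h F x : weight h -> (forall y, 0 <= F y) -> 0 <= F x * (h x)%:E.
Proof. by move=> [_ h0] F0; rewrite mule_ge0// lee_fin. Qed.

Lemma wint_ge0 h F : weight h -> (forall x, 0 <= F x) -> 0 <= wint h F.
Proof. by move=> wh F0; apply: integral_ge0 => x _; exact: Fh0. Qed.

Lemma eq_wint h F G : (forall x, F x = G x) -> wint h F = wint h G.
Proof. by move=> FG; apply: eq_integral => x _; rewrite FG. Qed.

Lemma le_wint h F G : weight h -> measurable_fun setT F -> measurable_fun setT G ->
  (forall x, 0 <= F x) -> (forall x, F x <= G x) -> wint h F <= wint h G.
Proof.
move=> wh mF mG F0 FG; apply: ge0_le_integral => //.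
- by move=> x _; exact: Fh0.
- exact: mFh.
- exact: mFh.
- by move=> x _; apply: lee_wpmul2r => //; rewrite lee_fin; exact: wh.2.
Qed.

Lemma wintD h F G : weight h -> measurable_fun setT F -> measurable_fun setT G ->
  (forall x, 0 <= F x) -> (forall x, 0 <= G x) ->
  wint h (fun x => F x + G x) = wint h F + wint h G.
Proof.
move=> wh mF mG F0 G0; rewrite /wint -ge0_integralD//.
- by apply: eq_integral => x _; rewrite ge0_muleDl.
- by move=> x _; exact: Fh0.
- exact: mFh.
- by move=> x _; exact: Fh0.
- exact: mFh.
Qed.

Lemma wintZ h F (c : R) : weight h -> measurable_fun setT F ->
  (forall x, 0 <= F x) -> (0 <= c)%R ->
  wint h (fun x => c%:E * F x) = c%:E * wint h F.
Proof.
move=> wh mF F0 c0; rewrite /wint -ge0_integralZl_EFin//.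
- by apply: eq_integral => x _; rewrite muleA.
- by move=> x _; exact: Fh0.
- exact: mFh.
Qed.

Lemma wint_sum h (I : Type) (s : seq I) (F : I -> V -> \bar R) : weight h ->
  (forall i, measurable_fun setT (F i)) -> (forall i x, 0 <= F i x) ->
  wint h (fun x => \sum_(i <- s) F i x) = \sum_(i <- s) wint h (F i).
Proof.
move=> wh mF F0; rewrite /wint -ge0_integral_sum//.
- by apply: eq_integral => x _; rewrite ge0_sume_distrl.
- by move=> i; exact: mFh.
- by move=> i x _; exact: Fh0.
Qed.

Lemma measurable_wint d (T : measurableType d) h (F : T * V -> \bar R) :
  weight h -> measurable_fun setT F -> (forall p, 0 <= F p) ->
  measurable_fun setT (fun x => wint h (fun y => F (x, y))).
Proof.
move=> [mh h0] mF F0.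
apply: (@measurable_fun_fubini_tonelli_F _ _ _ _ _ mu
  (fun p => F p * (h p.2)%:E)) => [|p].
  apply: emeasurable_funM => //; apply/measurable_EFinP.
  exact: (measurableT_comp mh).
by rewrite mule_ge0// lee_fin.
Qed.

Lemma wint_exchange h k (F : V * V -> \bar R) : weight h -> weight k ->
  measurable_fun setT F -> (forall p, 0 <= F p) ->
  wint h (fun x => wint k (fun y => F (x, y))) =
  wint k (fun y => wint h (fun x => F (x, y))).
Proof.
move=> [mh h0] [mk k0] mF F0.
pose K (p : V * V) := F p * (h p.1)%:E * (k p.2)%:E.
have mK : measurable_fun setT K.
  apply: emeasurable_funM; last first.
    by apply/measurable_EFinP; exact: (measurableT_comp mk).
  apply: emeasurable_funM => //.
  by apply/measurable_EFinP; exact: (measurableT_comp mh).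
have K0 p : 0 <= K p by rewrite !mule_ge0// lee_fin.
have mFx x : measurable_fun setT (fun y => F (x, y)).
  by apply: (measurableT_comp mF); exact: measurable_pair1.
have mFy y : measurable_fun setT (fun x => F (x, y)).
  by apply: (measurableT_comp mF); exact: measurable_pair2.
have mhE : measurable_fun setT (EFin \o h) by exact/measurable_EFinP.
have mkE : measurable_fun setT (EFin \o k) by exact/measurable_EFinP.
have := @fubini_tonelli _ _ _ _ _ mu mu K mK K0 => E.
have wh : weight h by split.
have wk : weight k by split.
transitivity (\int[mu]_x \int[mu]_y K (x, y)).
  apply: eq_integral => x _; rewrite muleC -(wintZ wk (mFx x) (fun y => F0 _) (h0 x)).
  by apply: eq_integral => y _; rewrite /K/= (muleC (F _)).
rewrite E; apply: eq_integral => y _.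
rewrite muleC -(wintZ wh (mFy y) (fun x => F0 _) (k0 y)).
by apply: eq_integral => x _; rewrite /K/= muleC muleA.
Qed.

Lemma wint_weightD h k F : weight h -> weight k -> measurable_fun setT F ->
  (forall x, 0 <= F x) -> wint (fun x => h x + k x)%R F = wint h F + wint k F.
Proof.
move=> wh wk mF F0; rewrite /wint -ge0_integralD//.
- apply: eq_integral => x _; rewrite EFinD ge0_muleDr// lee_fin.
  exact: wh.2.
  exact: wk.2.
- by move=> x _; exact: Fh0.
- exact: mFh.
- by move=> x _; exact: Fh0.
- exact: mFh.
Qed.

Lemma wint_weightZ h F (c : R) : weight h -> measurable_fun setT F ->
  (forall x, 0 <= F x) -> (0 <= c)%R -> wint (fun x => c * h x)%R F = c%:E * wint h F.
Proof.
move=> wh mF F0 c0; rewrite /wint -ge0_integralZl_EFin//.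
- by apply: eq_integral => x _; rewrite EFinM muleCA.
- by move=> x _; exact: Fh0.
- exact: mFh.
Qed.

Lemma weightD h k : weight h -> weight k -> weight (fun x => h x + k x)%R.
Proof.
move=> [mh h0] [mk k0]; split; first exact: measurable_funD.
by move=> x; rewrite addr_ge0.
Qed.

Lemma weightZ h (c : R) : weight h -> (0 <= c)%R -> weight (fun x => c * h x)%R.
Proof.
move=> [mh h0] c0; split; first exact: measurable_funM.
by move=> x; rewrite mulr_ge0.
Qed.

Lemma measurable_indicE A : measurable A ->
  measurable_fun setT (fun x : V => (\1_A x)%:E : \bar R).
Proof. by move=> mA; apply/measurable_EFinP; exact: measurable_indic. Qed.

Lemma indicE_ge0 A x : (0 : \bar R) <= (\1_A x)%:E.
Proof. by rewrite lee_fin. Qed.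

Lemma mass_setT h : mass h setT = \int[mu]_x (h x)%:E.
Proof. by apply: eq_integral => x _; rewrite indicT mul1e. Qed.

Lemma wint_cst h (c : R) : weight h -> (0 <= c)%R ->
  wint h (fun=> c%:E) = c%:E * mass h setT.
Proof.
move=> wh c0; rewrite -wintZ//; last exact: measurable_indicE.
by apply: eq_wint => x; rewrite indicT mule1.
Qed.

Lemma mass_ge0 h A : weight h -> 0 <= mass h A.
Proof. by move=> wh; apply: wint_ge0 => // x; rewrite lee_fin. Qed.

Lemma le_mass h A B : weight h -> measurable A -> measurable B -> A `<=` B ->
  mass h A <= mass h B.
Proof.
move=> wh mA mB AB; apply: le_wint => //; try exact: measurable_indicE.
move=> x; rewrite lee_fin !indicE ler_nat; case: (boolP (x \in A)) => //=.
by rewrite !inE => /AB xB; rewrite mem_set.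
Qed.

Lemma mass_setC h A : weight h -> measurable A ->
  mass h A + mass h (~` A) = mass h setT.
Proof.
move=> wh mA; rewrite /mass -wintD//; try exact: measurable_indicE.
  apply: eq_wint => x; rewrite -EFinD !indicE in_setC in_setT.
  by case: (x \in A) => /=; rewrite ?addr0 ?add0r.
by apply: measurable_indicE; exact: measurableC.
Qed.

End weighted_integral.

(** * Energy, potential and pointwise bounded minimizers *)

Section integral_difference.
Local Open Scope ereal_scope.
Context d (T : measurableType d) (R : realType) (nu : {measure set T -> \bar R}).

(** The integral of [a] may be infinite, as energies may be. *)
Lemma ge0_integralB_lty (a : T -> \bar R) (b : T -> R) :
  measurable_fun setT a -> measurable_fun setT b ->
  (forall x, 0 <= a x) -> (forall x, (0 <= b x)%R) ->
  \int[nu]_x (b x)%:E < +oo ->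
  \int[nu]_x (a x - (b x)%:E) = \int[nu]_x a x - \int[nu]_x (b x)%:E.
Proof.
move=> ma mb a0 b0 bfin.
have mbE : measurable_fun setT (EFin \o b) by exact/measurable_EFinP.
have ib : nu.-integrable setT (EFin \o b).
  apply/integrableP; split => //; apply: le_lt_trans bfin.
  by apply: ge0_le_integral => //; try (by apply: measurableT_comp);
    move=> x _ /=; rewrite ger0_norm.
have [afin|ainf] := ltP (\int[nu]_x a x) +oo.
  have ia : nu.-integrable setT a.
    apply/integrableP; split => //; apply: le_lt_trans afin.
    apply: ge0_le_integral => //; first exact: measurableT_comp.
    by move=> x _; rewrite gee0_abs.
  by rewrite (integralB measurableT ia ib).
have ay : \int[nu]_x a x = +oo by apply/eqP; rewrite -leye_eq.
pose f x := a x - (b x)%:E.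
have mf : measurable_fun setT f by exact: emeasurable_funB.
have fneg : \int[nu]_x f^\- x < +oo.
  apply: le_lt_trans bfin; apply: ge0_le_integral => //.
    exact: measurable_funeneg.
  move=> x _; rewrite funenegE /f ge_max lee_fin b0 andbT.
  by rewrite fin_num_oppeB// -[leRHS]add0e leeD2r// leeNl oppe0.
have fpos : \int[nu]_x f^\+ x = +oo.
  apply/eqP; rewrite -leye_eq leNgt; apply/negP => fposlt.
  suff : \int[nu]_x a x < +oo by rewrite ay ltxx.
  apply: (@le_lt_trans _ _ (\int[nu]_x (f^\+ x + (b x)%:E))).
    apply: ge0_le_integral => //.
      by apply: emeasurable_funD => //; exact: measurable_funepos.
    by move=> x _; rewrite -leeBlDr// funeposE le_max lexx.
  rewrite ge0_integralD//; first exact: lte_add_pinfty.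
    exact: measurable_funepos.
  by move=> x _; rewrite lee_fin.
rewrite ay addye; last by rewrite eqe_oppLR/= lt_eqF.
rewrite [LHS]integralE fpos addye// eqe_oppLR/= lt_eqF//.
Qed.

End integral_difference.

Section measurable_partial_integral.
Local Open Scope ereal_scope.
Context d1 d2 (T1 : measurableType d1) (T2 : measurableType d2) (R : realType).
Variable m2 : {sigma_finite_measure set T2 -> \bar R}.

Lemma measurable_partial_integral (F : T1 * T2 -> \bar R) :
  measurable_fun setT F ->
  measurable_fun setT (fun x => \int[m2]_y F (x, y)).
Proof.
move=> mF.
rewrite (_ : (fun x => _) = (fun x =>
  \int[m2]_y F^\+ (x, y) - \int[m2]_y F^\- (x, y))); last first.
  by apply/funext => x; rewrite integralE; congr (_ - _); apply: eq_integral => y _; rewrite ?funeposE ?funenegE.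
apply: emeasurable_funB.
- exact: (@measurable_fun_fubini_tonelli_F _ _ _ _ _ m2 _ (measurable_funepos mF)
    (fun p => funepos_ge0 F p)).
- exact: (@measurable_fun_fubini_tonelli_F _ _ _ _ _ m2 _ (measurable_funeneg mF)
    (fun p => funeneg_ge0 F p)).
Qed.

End measurable_partial_integral.

Section energy.
Local Open Scope ereal_scope.
Context (R : realType) (N : nat) (alpha beta : R).
Local Notation V := 'rV[R]_N.
Local Notation mu := (lebesgue_rV R N).
Hypotheses (ba : (beta < alpha)%R) (b2 : (2 <= beta)%R) (a4 : (4 <= alpha)%R).
Hypothesis abn : (alpha, beta) <> (4, 2)%R.
Local Notation g := (@power_kernel R N alpha beta).
Local Notation gam := (wdepth alpha beta).
Implicit Types (h k : V -> R) (E F : set V) (m : R).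

Definition pairpot (x y : V) : R := profile alpha beta (enorm (x - y)).

Definition potential h (x : V) : \bar R := wint h (fun y => (pairpot x y)%:E).

Definition interaction h k : \bar R := wint h (potential k).

Lemma pairpotE x y : pairpot x y = (g (x - y) + gam)%R.
Proof. by []. Qed.

Lemma pairpot_ge0 x y : (0 <= pairpot x y)%R.
Proof. by apply: profile_ge0 => //; exact: enorm_ge0. Qed.

Lemma measurable_radial (phi : R -> R) : measurable_fun setT phi ->
  measurable_fun setT (fun p : V * V => phi (enorm (p.1 - p.2))).
Proof.
move=> mphi; apply: (measurableT_comp mphi); apply: measurable_enorm.
exact: measurable_rVB.
Qed.

Lemma measurable_profile : measurable_fun setT (profile alpha beta).
Proof.
apply: measurable_funD => //; apply: measurable_funB;
by apply: measurable_funM => //; exact: measurable_powR.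
Qed.

Lemma measurable_pairpot :
  measurable_fun setT (fun p : V * V => (pairpot p.1 p.2)%:E).
Proof.
by apply/measurable_EFinP; apply: measurable_radial; exact: measurable_profile.
Qed.

Lemma measurable_pairpot1 x : measurable_fun setT (fun y : V => (pairpot x y)%:E).
Proof.
exact: (measurableT_comp measurable_pairpot (measurable_pair1 x)).
Qed.

Lemma pairpotE_ge0 x y : 0 <= (pairpot x y)%:E.
Proof. by rewrite lee_fin pairpot_ge0. Qed.

Lemma potential_ge0 h x : weight h -> 0 <= potential h x.
Proof. by move=> wh; apply: wint_ge0 => // y; exact: pairpotE_ge0. Qed.

Lemma measurable_potential h : weight h -> measurable_fun setT (potential h).
Proof.
move=> wh; apply: (measurable_wint wh measurable_pairpot) => p.
exact: pairpotE_ge0.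
Qed.

Lemma interaction_ge0 h k : weight h -> weight k -> 0 <= interaction h k.
Proof. by move=> wh wk; apply: wint_ge0 => // x; exact: potential_ge0. Qed.

Lemma interactionC h k : weight h -> weight k -> interaction h k = interaction k h.
Proof.
move=> wh wk; rewrite /interaction /potential.
rewrite (wint_exchange wh wk measurable_pairpot); last by move=> p; exact: pairpotE_ge0.
by apply: eq_wint => y; apply: eq_wint => x; rewrite /pairpot/= enormB.
Qed.

(** The correction depends on [m] only, so the energy and the interaction have
    the same minimizers of given mass. *)
Lemma energy_weight h m : weight h -> mass h setT = m%:E ->
  energy g h = interaction h h - (gam * m ^+ 2)%:E.
Proof.
move=> wh; have [mh h0] := wh; rewrite mass_setT => hm.
have g0 := wdepth_gt0 ba b2 a4.
have m0 : (0 <= m)%R by rewrite -lee_fin -hm integral_ge0// => x _; rewrite lee_fin.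
have mhE : measurable_fun setT (EFin \o h) by exact/measurable_EFinP.
have bint (c : R) : (0 <= c)%R -> \int[mu]_x (c * h x)%:E = (c * m)%:E.
  move=> c0; under eq_integral do rewrite EFinM.
  by rewrite ge0_integralZl_EFin ?hm// => x _; rewrite lee_fin.
have inner x : \int[mu]_y (g (x - y) * h x * h y)%:E =
    potential h x * (h x)%:E - (gam * m * h x)%:E.
  have c0 : (0 <= gam * h x)%R by rewrite mulr_ge0// ltW.
  transitivity (\int[mu]_y ((pairpot x y)%:E * (h x)%:E * (h y)%:E - (gam * h x * h y)%:E)).
    apply: eq_integral => y _; rewrite -!EFinM -EFinB; congr EFin.
    by rewrite pairpotE; ring.
  rewrite ge0_integralB_lty//.
  - rewrite bint//; congr (_ - _); last by congr EFin; ring.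
    rewrite muleC -(wintZ wh (measurable_pairpot1 x))//; last first.
      by move=> y; exact: pairpotE_ge0.
    by apply: eq_integral => y _; rewrite (muleC (pairpot _ _)%:E).
  - apply: emeasurable_funM => //; apply: emeasurable_funM => //.
    exact: measurable_pairpot1.
  - exact: measurable_funM.
  - by move=> y; rewrite !mule_ge0 ?pairpotE_ge0// lee_fin.
  - by move=> y; rewrite mulr_ge0.
  - by rewrite bint// ltry.
rewrite /energy; under eq_integral do rewrite inner.
have c0 : (0 <= gam * m)%R by rewrite mulr_ge0// ltW.
rewrite ge0_integralB_lty//.
- by rewrite bint// /interaction; congr (_ - _); congr EFin; ring.
- by apply: emeasurable_funM => //; exact: measurable_potential.
- exact: measurable_funM.
- by move=> x; rewrite mule_ge0// ?potential_ge0// lee_fin.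
- by move=> x; rewrite mulr_ge0.
- by rewrite bint// ltry.
Qed.

Lemma measurable_power_kernel : measurable_fun setT (fun p : V * V => g (p.1 - p.2)).
Proof.
rewrite (_ : (fun p => _) = (fun p => pairpot p.1 p.2 - gam)%R); last first.
  by apply/funext => p; rewrite pairpotE addrK.
by apply: measurable_funB => //; apply/measurable_EFinP; exact: measurable_pairpot.
Qed.

Lemma energy_ae h k : measurable_fun setT h -> measurable_fun setT k ->
  {ae mu, forall x, h x = k x} -> energy g h = energy g k.
Proof.
move=> mh mk hk; rewrite /energy.
have mI (u v : V -> R) : measurable_fun setT u -> measurable_fun setT v ->
    measurable_fun setT (fun p : V * V => (g (p.1 - p.2) * u p.1 * v p.2)%:E).
  move=> mu' mv; apply/measurable_EFinP; apply: measurable_funM; last first.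
    exact: (measurableT_comp mv).
  apply: measurable_funM; [exact: measurable_power_kernel|exact: (measurableT_comp mu')].
transitivity (\int[mu]_x \int[mu]_y (g (x - y) * h x * k y)%:E).
  apply: eq_integral => x _; apply: ae_eq_integral => //.
  - exact: (measurableT_comp (mI _ _ mh mh) (measurable_pair1 x)).
  - exact: (measurableT_comp (mI _ _ mh mk) (measurable_pair1 x)).
  - by apply: filterS hk => y hky _; rewrite hky.
apply: ae_eq_integral => //.
- exact: (@measurable_partial_integral _ _ _ _ _ mu _ (mI _ _ mh mk)).
- exact: (@measurable_partial_integral _ _ _ _ _ mu _ (mI _ _ mk mk)).
- by apply: filterS hk => y hky _; rewrite hky.
Qed.

(** A form of minimality without almost everywhere clauses in which all
    integrands are nonnegative. *)
Definition tame_minimizer m h : Prop :=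
  [/\ weight h, forall x, (h x <= 1)%R, mass h setT = m%:E &
    forall k, weight k -> (forall x, (k x <= 1)%R) -> mass k setT = m%:E ->
      interaction h h <= interaction k k].

Lemma density_weight m h : weight h -> (forall x, (h x <= 1)%R) ->
  mass h setT = m%:E -> density m h.
Proof.
move=> wh h1; have [mh h0] := wh; rewrite mass_setT => hm.
have absh : \int[mu]_x `|(EFin \o h) x| = m%:E.
  by rewrite -hm; apply: eq_integral => x _ /=; rewrite ger0_norm.
split.
- by apply/integrableP; split; [exact/measurable_EFinP|rewrite absh ltry].
- by apply: aeW => x; rewrite h0 h1.
- by rewrite Lnorm1.
Qed.

(** Truncation to the interval from 0 to 1 changes the density on a null set only. *)
Lemma density_minimizer_tame m h : density_minimizer g m h ->
  exists h', tame_minimizer m h' /\ {ae mu, forall x, h x = h' x}.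
Proof.
move=> [[ih h01 hm] hmin]; pose h' x := Num.max 0%R (Num.min (h x) 1%R).
have mh : measurable_fun setT h.
  by apply/measurable_EFinP; exact: (measurable_int _ ih).
have mh' : measurable_fun setT h'.
  by apply: measurable_maxr => //; exact: measurable_minr.
have hh' : {ae mu, forall x, h x = h' x}.
  apply: filterS h01 => x /andP[hx0 hx1]; rewrite /h'.
  by rewrite (min_idPl hx1) (max_idPr hx0).
have wh' : weight h' by split => // x; rewrite /h' le_max lexx.
have h'1 x : (h' x <= 1)%R by rewrite /h' ge_max ler01 ge_min lexx orbT.
have h'm : mass h' setT = m%:E.
  rewrite mass_setT -hm Lnorm1; apply: ae_eq_integral => //.
  - exact/measurable_EFinP.
  - by apply: measurableT_comp => //; exact/measurable_EFinP.
  - apply: filterS2 h01 hh' => x /andP[hx0 hx1] <- _ /=.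
    by rewrite ger0_norm.
exists h'; split; last exact: hh'.
split; [exact: wh'|exact: h'1|exact: h'm|move=> k wk k1 km].
have := hmin k (density_weight wk k1 km).
rewrite (energy_ae mh mh' hh') (energy_weight wh' h'm) (energy_weight wk km).
by rewrite leeD2rE.
Qed.

Lemma weight_indic E : measurable E -> weight (\1_E : V -> R).
Proof. by move=> mE; split => //; exact: measurable_indic. Qed.

Lemma mass_indic E F : measurable E -> measurable F ->
  mass (\1_E : V -> R) F = mu (E `&` F).
Proof.
move=> mE mF; rewrite /mass /wint.
rewrite (eq_integral (fun x => (\1_(E `&` F) x)%:E)).
  by rewrite integral_indic ?setIT//; exact: measurableI.
by move=> x _; rewrite -EFinM indicI/= mulrC.
Qed.

Lemma set_energyE E : set_energy g E = energy g (\1_E : V -> R).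
Proof.
rewrite /set_energy /energy integral_mkcond; apply: eq_integral => x _.
rewrite patchE indicE; case: ifPn => xE.
  rewrite integral_mkcond; apply: eq_integral => y _.
  by rewrite patchE indicE; case: ifPn => yE; rewrite !mulr1 ?mulr0.
rewrite integral0_eq// => y _.
by rewrite mulr0 mul0r.
Qed.

(** Characteristic functions of sets of measure [m] compete with [h]. *)
Lemma set_minimizer_of_density m h E : density_minimizer g m h ->
  ae_characteristic h E -> set_minimizer g m E.
Proof.
move=> hmin [mE hE]; have [[ih h01 hm] hle] := hmin.
have mh : measurable_fun setT h.
  by apply/measurable_EFinP; exact: (measurable_int _ ih).
have m1 (F : set V) : measurable F -> measurable_fun setT (\1_F : V -> R).
  exact: measurable_indic.
split; [exact: mE| |move=> F mF muF].
  rewrite -hm Lnorm1 -[E in LHS]setIT -integral_indic//.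
  apply: ae_eq_integral.
  - exact: measurableT.
  - exact: measurable_indicE.
  - by apply: measurableT_comp => //; exact/measurable_EFinP.
  - by apply: filterS hE => x hx _ /=; rewrite hx ger0_norm.
rewrite !set_energyE -(energy_ae mh (m1 _ mE) hE); apply: hle.
apply: density_weight; first exact: weight_indic.
  by move=> x; rewrite indicE lern1 leq_b1.
by rewrite mass_indic// setIT.
Qed.

End energy.

(** * First variation and the bathtub principle *)

Section ae_equality.
Local Open Scope ereal_scope.
Context d (T : measurableType d) (R : realType) (nu : {measure set T -> \bar R}).

Lemma ge0_le_integral_ae_eq (F G : T -> \bar R) :
  measurable_fun setT F -> measurable_fun setT G ->
  (forall x, 0 <= G x) -> (forall x, G x <= F x) ->
  \int[nu]_x F x <= \int[nu]_x G x -> \int[nu]_x G x < +oo ->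
  {ae nu, forall x, F x = G x /\ F x \is a fin_num}.
Proof.
move=> mF mG G0 GF FG Gfin.
have F0 x : 0 <= F x by exact: le_trans (G0 x) (GF x).
have ig (f : T -> \bar R) : measurable_fun setT f -> (forall x, 0 <= f x) ->
    \int[nu]_x f x < +oo -> nu.-integrable setT f.
  move=> mf f0 ffin; apply/integrableP; split => //; apply: le_lt_trans ffin.
  apply: ge0_le_integral => //; first exact: measurableT_comp.
  by move=> x _; rewrite gee0_abs.
have iG := ig G mG G0 Gfin; have iF := ig F mF F0 (le_lt_trans FG Gfin).
have mD : measurable_fun setT (fun x => F x - G x) by exact: emeasurable_funB.
have Gf : \int[nu]_x G x \is a fin_num by rewrite ge0_fin_numE// integral_ge0.
have D0 : \int[nu]_x `|F x - G x| = 0.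
  transitivity (\int[nu]_x (F x - G x)).
    apply: ae_eq_integral => //; first exact: measurableT_comp.
    apply: filterS (integrable_ae measurableT iG) => x Gx _.
    by rewrite gee0_abs// sube_ge0// Gx// orbT.
  rewrite (integralB measurableT iF iG); apply/eqP; rewrite eq_le; apply/andP; split.
    by rewrite sube_le0.
  rewrite sube_ge0 ?Gf ?orbT//.
  by apply: ge0_le_integral.
have := (ae_eq_integral_abs nu measurableT mD).1 D0.
apply: filterS2 (filterI (integrable_ae measurableT iG) (integrable_ae measurableT iF)) => x [Gx Fx] h.
have Gx' := Gx I; have Fx' := Fx I; split => //.
have : F x - G x == 0 by apply/eqP; exact: h.
by rewrite sube_eq ?fin_num_adde_defl// add0e => /eqP.
Qed.

End ae_equality.

Section sublevels.
Local Open Scope ereal_scope.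
Context d (T : measurableType d) (R : realType) (nu : {measure set T -> \bar R}).
Variable psi : T -> \bar R.
Hypotheses (mpsi : measurable_fun setT psi) (psi0 : forall x, 0 <= psi x).

Lemma measurable_sublevel (s : \bar R) : measurable [set x | psi x < s].
Proof.
by rewrite -[X in measurable X]setTI; exact: emeasurable_fun_infty_o.
Qed.

Lemma measurable_closed_sublevel (s : \bar R) : measurable [set x | psi x <= s].
Proof.
by rewrite -[X in measurable X]setTI; exact: emeasurable_fun_infty_c.
Qed.

Let le_sublevel (s t : \bar R) : s <= t ->
  nu [set x | psi x < s] <= nu [set x | psi x < t].
Proof.
move=> st; apply: le_measure; rewrite ?inE; try exact: measurable_sublevel.
by move=> x /= /lt_le_trans; exact.
Qed.

(** The level is the supremum of the [s] for which the strict sublevel has measure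
    at most [m]; the two bounds are continuity of the measure from below and from
    above, the latter thanks to the finite measure at a level above [s1]. *)
Lemma bathtub_level (m s1 s2 : R) : (0 <= m)%R -> (s1 < s2)%R ->
  m%:E < nu [set x | psi x < s1%:E] -> nu [set x | psi x < s2%:E] < +oo ->
  exists lam : R, [/\ (0 <= lam <= s1)%R, nu [set x | psi x < lam%:E] <= m%:E
    & m%:E <= nu [set x | psi x <= lam%:E]].
Proof.
move=> m0 s12 ms1 s2fin.
pose S := [set s : R | (0 <= s)%R /\ nu [set x | psi x < s%:E] <= m%:E].
have S0 : S 0%R.
  split => //; rewrite (_ : [set x | _] = set0) ?measure0// -subset0 => x /=.
  by rewrite ltNge psi0.
have Sub : ubound S s1.
  move=> s [s0 sm]; rewrite leNgt; apply/negP => s1s.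
  have := lt_le_trans ms1 (le_trans (le_sublevel _) sm).
  by rewrite lee_fin => /(_ (ltW s1s)); rewrite ltxx.
have supS : has_sup S by split; [exists 0%R|exists s1].
pose lam := sup S.
have lam0 : (0 <= lam)%R by exact: ub_le_sup supS.2 _ S0.
have lams1 : (lam <= s1)%R by exact: ge_sup supS.1 Sub.
exists lam; split; first by rewrite lam0 lams1.
- pose F (n : nat) := [set x | psi x < (lam - n.+1%:R^-1)%:E].
  have FE : [set x | psi x < lam%:E] = \bigcup_n F n.
    apply/seteqP; split => x /=; last first.
      by move=> [n _] /lt_le_trans; apply; rewrite lee_fin gerBl invr_ge0.
    move=> xl; have xf : psi x \is a fin_num.
      by rewrite ge0_fin_numE//; exact: lt_trans xl (ltry _).
    have : (0 < lam - fine (psi x))%R by rewrite subr_gt0 -lte_fin fineK.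
    move/ltr_add_invr => [n]; rewrite add0r => hn; exists n => //.
    by rewrite /F/= -(fineK xf) lte_fin ltrBrDr -ltrBrDl.
  have mF n : measurable (F n) by exact: measurable_sublevel.
  have ndF : {homo F : n k / (n <= k)%N >-> (n <= k)%O}.
    move=> n k nk; apply/subsetPset => x /lt_le_trans; apply.
    by rewrite lee_fin lerD2l lerN2 lef_pV2 ?posrE// ler_nat ltnS.
  have c := @nondecreasing_cvg_mu _ _ _ nu F mF (bigcup_measurable (fun n _ => mF n)) ndF.
  rewrite FE -(cvg_lim _ c)//; apply: lime_le.
    by apply/cvg_ex; exists (nu (\bigcup_n F n)); exact: c.
  apply: nearW => n; have n0 : (0 < n.+1%:R^-1 :> R)%R by rewrite invr_gt0.
  have [s [s0 sm] ls] := sup_adherent n0 supS.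
  by apply: le_trans sm; apply: le_sublevel; rewrite lee_fin ltW.
- pose dl := (s2 - s1)%R; have dl0 : (0 < dl)%R by rewrite subr_gt0.
  pose F (n : nat) := [set x | psi x < (lam + dl / n.+1%:R)%:E].
  have FE : [set x | psi x <= lam%:E] = \bigcap_n F n.
    apply/seteqP; split => x /=.
      by move=> /le_lt_trans + n _; apply; rewrite lte_fin ltrDl divr_gt0.
    move=> H; rewrite leNgt; apply/negP => lx.
    have xf : psi x \is a fin_num.
      by rewrite ge0_fin_numE//; exact: lt_trans (H 0%N I) (ltry _).
    have : (0 < (fine (psi x) - lam) / dl)%R.
      by rewrite divr_gt0// subr_gt0 -lte_fin fineK.
    move/ltr_add_invr => [n]; rewrite add0r ltr_pdivlMr// => hn.
    have := H n I; rewrite /F/= -(fineK xf) lte_fin.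
    by move: hn; rewrite [(_^-1 * dl)%R]mulrC ; rewrite ltrBrDl => /lt_trans h /h; rewrite ltxx.
  have mF n : measurable (F n) by exact: measurable_sublevel.
  have niF : {homo F : n k / (n <= k)%N >-> (k <= n)%O}.
    move=> n k nk; apply/subsetPset => x /lt_le_trans; apply.
    by rewrite lee_fin lerD2l ler_pM2l// lef_pV2 ?posrE// ler_nat ltnS.
  have F0 : nu (F 0%N) < +oo.
    apply: le_lt_trans s2fin; apply: le_sublevel.
    by rewrite lee_fin divr1 /dl; lra.
  have c := @nonincreasing_cvg_mu _ _ _ nu F F0 mF (bigcap_measurable (ex_intro _ 0%N I)
    (fun n _ => mF n)) niF.
  rewrite FE -(cvg_lim _ c)//; apply: lime_ge.
    by apply/cvg_ex; exists (nu (\bigcap_n F n)); exact: c.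
  apply: nearW => n; rewrite leNgt; apply/negP => Fm.
  have n0 : (0 < dl / n.+1%:R)%R by rewrite divr_gt0.
  have : (lam + dl / n.+1%:R <= lam)%R.
    apply: ub_le_sup; first exact: supS.2.
    by split; [rewrite addr_ge0// ltW|exact: ltW Fm].
  by rewrite gerDl leNgt n0.
Qed.

End sublevels.

Section optimality.
Local Open Scope ereal_scope.
Context (R : realType) (N : nat) (alpha beta : R).
Local Notation V := 'rV[R]_N.
Local Notation mu := (lebesgue_rV R N).
Hypotheses (ba : (beta < alpha)%R) (b2 : (2 <= beta)%R) (a4 : (4 <= alpha)%R).
Hypothesis abn : (alpha, beta) <> (4, 2)%R.
Local Notation potential := (@potential R N alpha beta).
Local Notation interaction := (@interaction R N alpha beta).
Implicit Types (h k : V -> R) (m : R).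

Let pot_ge0 h x : weight h -> 0 <= potential h x.
Proof. by move=> wh; exact: potential_ge0. Qed.

Let mpot h : weight h -> measurable_fun setT (potential h).
Proof. by move=> wh; exact: measurable_potential. Qed.

Let mixE h k u (t : R) : (0 <= t <= 1)%R -> weight h -> weight k -> weight u ->
  interaction (fun x => (1 - t) * h x + t * k x)%R u =
  (1 - t)%:E * interaction h u + t%:E * interaction k u.
Proof.
move=> /andP[t0 t1] wh wk wu; have t1' : (0 <= 1 - t)%R by rewrite subr_ge0.
rewrite /interaction wint_weightD ?wint_weightZ//; try exact: mpot;
  try (by move=> x; exact: pot_ge0); exact: weightZ.
Qed.

(** The first variation along [(1 - t) h + t k].  If [a - b] were positive, where
    [a] and [b] are the two sides, [2 (a - b) <= t C] would hold for all small [t]. *)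
Lemma minimizer_linear_optimal m h k : tame_minimizer alpha beta m h ->
  weight k -> (forall x, (k x <= 1)%R) -> mass k setT = m%:E ->
  interaction k k < +oo -> interaction h h <= interaction k h.
Proof.
move=> [wh h1 hm hmin] wk k1 km kfin.
have := leey (interaction k h); rewrite le_eqVlt => /predU1P[->|kh]; first exact: leey.
have hh : interaction h h < +oo by exact: le_lt_trans (hmin k wk k1 km) kfin.
have [a aE] : exists a, interaction h h = a%:E.
  by exists (fine (interaction h h)); rewrite fineK// ge0_fin_numE// interaction_ge0.
have [b bE] : exists b, interaction k h = b%:E.
  by exists (fine (interaction k h)); rewrite fineK// ge0_fin_numE// interaction_ge0.
have [c cE] : exists c, interaction k k = c%:E.
  by exists (fine (interaction k k)); rewrite fineK// ge0_fin_numE// interaction_ge0.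
have ineq t : (0 <= t <= 1)%R ->
    (a <= (1 - t) * ((1 - t) * a + t * b) + t * ((1 - t) * b + t * c))%R.
  move=> t01; have /andP[t0 t1] := t01; have t1' : (0 <= 1 - t)%R by rewrite subr_ge0.
  pose u x := ((1 - t) * h x + t * k x)%R.
  have wu : weight u by apply: weightD; exact: weightZ.
  have u1 x : (u x <= 1)%R by rewrite /u; have := h1 x; have := k1 x; nra.
  have um : mass u setT = m%:E.
    rewrite /mass wint_weightD ?wint_weightZ//; try exact: measurable_indicE;
      try exact: weightZ.
    rewrite -[wint h _]/(mass h setT) -[wint k _]/(mass k setT) hm km.
    by rewrite -!EFinM -EFinD; congr EFin; ring.
  have := hmin u wu u1 um; rewrite mixE// (interactionC _ _ _ _ wh wu)//.
  rewrite (interactionC _ _ _ _ wk wu)// !mixE// (interactionC _ _ _ _ wh wk)//.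
  by rewrite aE bE cE -!EFinM -?EFinD -?EFinM -?EFinD lee_fin.
rewrite aE bE lee_fin leNgt; apply/negP => ba'.
have c0 : (0 <= c)%R by rewrite -lee_fin -cE interaction_ge0.
have a0 : (0 <= a)%R by rewrite -lee_fin -aE interaction_ge0.
pose C := (a - 2 * b + c)%R.
have key t : (0 < t <= 1)%R -> (2 * (a - b) <= t * C)%R.
  move=> /andP[t0 t1]; have := ineq t; rewrite (ltW t0) t1 => /(_ isT) hh'.
  have : (0 <= t * (t * C - 2 * (a - b)))%R by rewrite /C; nra.
  by rewrite pmulr_rge0// subr_ge0.
have D0 : (0 < `|C| + (a - b) + 1)%R by have := normr_ge0 C; lra.
pose t := ((a - b) / (`|C| + (a - b) + 1))%R.
have t0 : (0 < t)%R by rewrite divr_gt0//; lra.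
have t1 : (t <= 1)%R by rewrite ler_pdivrMr// mul1r; have := normr_ge0 C; lra.
have := key t; rewrite t0 t1 => /(_ isT).
have tC : (t * C <= t * `|C|)%R by rewrite ler_pM2l// ler_norm.
have : (t * (`|C| + (a - b) + 1) = a - b)%R by rewrite /t divfK// gt_eqF.
by nra.
Qed.

Lemma interaction_bounded k m (c : V) (r : R) : weight k -> mass k setT = m%:E ->
  (forall x, ~ eball c r x -> k x = 0%R) -> interaction k k < +oo.
Proof.
move=> wk km kc.
pose C := ((r + r) `^ alpha + wdepth alpha beta)%R.
have C0 : (0 <= C)%R by rewrite addr_ge0 ?powR_ge0// ltW// wdepth_gt0.
have m0 : (0 <= m)%R by rewrite -lee_fin -km mass_ge0.
have bound x y : eball c r x -> eball c r y -> (pairpot alpha beta x y <= C)%R.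
  move=> xr yr; have h : (enorm (x - y) <= r + r)%R.
    apply: (le_trans (enorm_trans c _ _)); rewrite (enormB c).
    by apply: lerD; exact: ltW.
  apply: (le_trans (profile_le_powR b2 a4 _)); rewrite lerD2r.
  apply: ge0_ler_powR => //; rewrite ?nnegrE ?enorm_ge0//; first by move: a4; lra.
  exact: le_trans (enorm_ge0 _) h.
have pot_le x : eball c r x -> potential k x <= (C * m)%:E.
  move=> xr; rewrite EFinM -km -(wint_cst wk C0); apply: ge0_le_integral => //.
  - move=> y _; rewrite mule_ge0//; first exact: pairpotE_ge0.
    by rewrite lee_fin; exact: wk.2.
  - apply: emeasurable_funM; first exact: measurable_pairpot1.
    by apply/measurable_EFinP; exact: wk.1.
  - by apply: emeasurable_funM => //; apply/measurable_EFinP; exact: wk.1.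
  - move=> y _; rewrite -!EFinM lee_fin.
    have [yr|/kc ->] := pselect (eball c r y); last by rewrite !mulr0.
    by apply: ler_wpM2r; [exact: wk.2|exact: bound].
apply: (@le_lt_trans _ _ (C * m * m)%:E); last exact: ltry.
have Cm0 : (0 <= C * m)%R by rewrite mulr_ge0.
rewrite EFinM -[X in _ * X]km -(wint_cst wk Cm0); apply: ge0_le_integral => //.
- by move=> y _; rewrite mule_ge0 ?pot_ge0// lee_fin; exact: wk.2.
- apply: emeasurable_funM; first exact: mpot.
  by apply/measurable_EFinP; exact: wk.1.
- by apply: emeasurable_funM => //; apply/measurable_EFinP; exact: wk.1.
- move=> x _; have [xr|/kc ->] := pselect (eball c r x); last by rewrite !mule0.
  by apply: lee_wpmul2r; [rewrite lee_fin; exact: wk.2|exact: pot_le].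
Qed.

(** Compare [h] with the density [k] that fills the strict sublevel and the
    fraction of the level set that completes the mass to [m].  Pointwise
    [(potential - lam) (h - k) >= 0], and by the first variation the integral of the
    left-hand side is at most 0, so it vanishes almost everywhere.  The products are
    regrouped as sums of nonnegative terms because the potential may be infinite. *)
Lemma minimizer_bathtub m h (lam r : R) (c : V) : tame_minimizer alpha beta m h ->
  (0 <= lam)%R ->
  [set x | potential h x <= lam%:E] `<=` eball c r ->
  mu [set x | potential h x < lam%:E] <= m%:E ->
  m%:E <= mu [set x | potential h x <= lam%:E] ->
  {ae mu, forall x, (potential h x < lam%:E -> h x = 1%R) /\
                    (lam%:E < potential h x -> h x = 0%R)}.
Proof.
move=> hmin lam0 Lc Am mL; have [wh h1 hm _] := hmin.
pose A := [set x | potential h x < lam%:E].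
pose L := [set x | potential h x = lam%:E].
have AL : [set x | potential h x <= lam%:E] = A `|` L.
  apply/seteqP; split => x /=.
    by rewrite le_eqVlt => /predU1P[|]; [right|left].
  by case=> [/ltW//|->].
have mA : measurable A by apply: measurable_sublevel; exact: mpot.
have mL' : measurable L.
  rewrite (_ : L = [set x | potential h x <= lam%:E] `\` A).
    by apply: measurableD => //; apply: measurable_closed_sublevel; exact: mpot.
  apply/seteqP; split => x /=; first by move=> xl; split; rewrite ?/A/= xl// ltxx.
  by move=> [xl] /negP; rewrite -leNgt => lx; apply/eqP; rewrite eq_le xl lx.
have AL0 : A `&` L = set0.
  by rewrite -subset0 => x [/= + xL]; rewrite /A/= xL ltxx.
have fin (B : set V) : measurable B -> B `<=` A `|` L -> exists a : R,
    mu B = a%:E /\ (0 <= a)%R.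
  move=> mB BAL; have Bfin : mu B < +oo.
    apply: le_lt_trans (lebesgue_rV_eball_lty c r); apply: le_measure; rewrite ?inE//.
      exact: measurable_eball.
    by apply: subset_trans Lc; rewrite AL.
  exists (fine (mu B)); split; last exact: fine_ge0.
  by rewrite fineK// ge0_fin_numE.
have [a [aE a0]] := fin A mA (@subsetUl _ _ _).
have [l [lE l0]] := fin L mL' (@subsetUr _ _ _).
have {}mL : m%:E <= a%:E + l%:E.
  apply: (le_trans mL); rewrite AL -aE -lE; exact: measureU2.
rewrite -/A aE lee_fin in Am; rewrite -EFinD lee_fin in mL.
pose th := ((m - a) / l)%R.
have thl : (th * l = m - a)%R.
  rewrite /th; have [l00|ln0] := eqVneq l 0%R; last by rewrite divfK.
  by move: mL; rewrite l00 mulr0; lra.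
have th0 : (0 <= th)%R by rewrite divr_ge0//; lra.
have th1 : (th <= 1)%R.
  rewrite /th; have [->|ln0] := eqVneq l 0%R; first by rewrite invr0 mulr0.
  by rewrite ler_pdivrMr ?mul1r; [lra|rewrite lt_neqAle eq_sym ln0].
pose k x := (\1_A x + th * \1_L x)%R.
have wk : weight k by apply: weightD; [|apply: weightZ => //]; exact: weight_indic.
have kA x : A x -> k x = 1%R.
  move=> xA; rewrite /k !indicE mem_set// memNset ?mulr0 ?addr0//.
  by move=> xL; suff : (A `&` L) x by rewrite AL0.
have kL x : L x -> k x = th.
  move=> xL; rewrite /k !indicE memNset ?mem_set ?mulr1 ?add0r//.
  by move=> xA; suff : (A `&` L) x by rewrite AL0.
have kC x : lam%:E < potential h x -> k x = 0%R.
  move=> lx; have nA : ~ A x.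
    by move=> xl; have := lt_trans lx xl; rewrite ltxx.
  have nL : ~ L x by rewrite /L/= => xl; move: lx; rewrite xl ltxx.
  by rewrite /k !indicE !memNset ?mulr0 ?addr0.
have k1 x : (k x <= 1)%R.
  have [/kA ->//|/kL ->//|/kC ->//] : [\/ A x, L x | lam%:E < potential h x].
  rewrite /A /L/=; have [xl|lx|->] := ltgtP (potential h x) lam%:E.
  - exact: Or31.
  - exact: Or33.
  - exact: Or32.
have km : mass k setT = m%:E.
  rewrite /mass wint_weightD ?wint_weightZ//; try exact: measurable_indicE;
    try exact: weight_indic; try (apply: weightZ => //; exact: weight_indic).
  rewrite -[wint \1_A _]/(mass \1_A setT) -[wint \1_L _]/(mass \1_L setT).
  rewrite !mass_indic// !setIT aE lE -EFinM thl -EFinD; congr EFin; ring.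
have kkfin : interaction k k < +oo.
  apply: (interaction_bounded wk km (c := c) (r := r)) => x xc; apply: kC.
  by rewrite ltNge; apply/negP => xl; apply: xc; exact: Lc.
have hk := minimizer_linear_optimal hmin wk k1 km kkfin.
have kh : interaction k h <= (lam * m)%:E.
  rewrite EFinM -km -(wint_cst wk lam0); apply: ge0_le_integral => //.
  - by move=> y _; rewrite mule_ge0 ?pot_ge0// lee_fin; exact: wk.2.
  - apply: emeasurable_funM; first exact: mpot.
    by apply/measurable_EFinP; exact: wk.1.
  - by apply: emeasurable_funM => //; apply/measurable_EFinP; exact: wk.1.
  - move=> x _; have [xl|/kC ->] := leP (potential h x) lam%:E; last by rewrite !mule0.
    by apply: lee_wpmul2r => //; rewrite lee_fin; exact: wk.2.
pose F x := potential h x * (h x)%:E + lam%:E * (k x)%:E.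
pose G x := potential h x * (k x)%:E + lam%:E * (h x)%:E.
have mw u : weight u -> measurable_fun setT (EFin \o u).
  by move=> wu; apply/measurable_EFinP; exact: wu.1.
have w0 u x : weight u -> 0 <= (u x)%:E by move=> wu; rewrite lee_fin; exact: wu.2.
have m1 u : weight u -> measurable_fun setT (fun x => potential h x * (u x)%:E).
  by move=> wu; apply: emeasurable_funM; [exact: mpot|exact: mw].
have m2 u : weight u -> measurable_fun setT (fun x => lam%:E * (u x)%:E).
  by move=> wu; apply: emeasurable_funM => //; exact: mw.
have p1 u x : weight u -> 0 <= potential h x * (u x)%:E.
  by move=> wu; rewrite mule_ge0 ?pot_ge0 ?w0.
have p2 u x : weight u -> 0 <= lam%:E * (u x)%:E.
  by move=> wu; apply: mule_ge0; [rewrite lee_fin|exact: w0].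
have sumint u v : weight u -> weight v -> mass v setT = m%:E ->
    \int[mu]_x (potential h x * (u x)%:E + lam%:E * (v x)%:E) =
    interaction u h + (lam * m)%:E.
  move=> wu wv vm; rewrite ge0_integralD//.
  - congr (_ + _); rewrite EFinM -vm mass_setT ge0_integralZl_EFin//.
      by move=> x _; exact: w0.
    exact: mw.
  - by move=> x _; exact: p1.
  - exact: m1.
  - by move=> x _; exact: p2.
  - exact: m2.
have GF x : G x <= F x.
  rewrite /G /F.
  have [xl|lx|xl] := ltgtP (potential h x) lam%:E.
  - rewrite (kA x xl); have xf : potential h x \is a fin_num.
      by rewrite ge0_fin_numE ?pot_ge0//; exact: lt_trans xl (ltry _).
    move: xl; rewrite -(fineK xf) -!EFinM -!EFinD lee_fin lte_fin.
    by have := h1 x; have := wh.2 x; nra.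
  - rewrite (kC x lx) !mule0 addr0 add0r; apply: lee_wpmul2r; last exact: ltW.
    exact: w0.
  - by rewrite xl addeC.
have mF : measurable_fun setT F.
  by apply: emeasurable_funD; [exact: m1|exact: m2].
have mG : measurable_fun setT G.
  by apply: emeasurable_funD; [exact: m1|exact: m2].
have G0 x : 0 <= G x by rewrite adde_ge0 ?p1 ?p2.
have FG : \int[mu]_x F x <= \int[mu]_x G x by rewrite !sumint// leeD2r.
have Gfin : \int[mu]_x G x < +oo.
  by rewrite sumint//; apply: lte_add_pinfty; [exact: le_lt_trans kh (ltry _)|exact: ltry].
have := ge0_le_integral_ae_eq mF mG G0 GF FG Gfin.
apply: filterS => x [FGx Ff]; rewrite /F /G in FGx Ff; split => [xl|lx].
  have xf : potential h x \is a fin_num.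
    by rewrite ge0_fin_numE ?pot_ge0//; exact: lt_trans xl (ltry _).
  have kx := kA x xl; move: FGx xl; rewrite kx -(fineK xf) -!EFinM -!EFinD lte_fin.
  move=> [e] xl; have : ((lam - fine (potential h x)) * (1 - h x) = 0)%R by lra.
  by move/eqP; rewrite mulf_eq0 subr_eq0 gt_eqF//= subr_eq0 => /eqP.
move: FGx Ff; rewrite (kC x lx) !mule0 adde0 add0e => FGx Ff.
apply/eqP/negPn/negP => hx0.
have hx : (0 < h x)%R by rewrite lt_neqAle eq_sym hx0; exact: wh.2.
have : lam%:E * (h x)%:E < potential h x * (h x)%:E.
  by rewrite lte_pmul2r// ?lte_fin.
by rewrite FGx ltxx.
Qed.

End optimality.

(** * The quartic interaction of a density *)

Section weighted_integral_comparison.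
Local Open Scope ereal_scope.
Context (R : realType) (N : nat).
Local Notation V := 'rV[R]_N.
Local Notation mu := (lebesgue_rV R N).
Implicit Types (h : V -> R) (F G : V -> \bar R).

Lemma le_wint_ae h F G : weight h -> measurable_fun setT F -> measurable_fun setT G ->
  (forall x, 0 <= F x) -> (forall x, 0 <= G x) ->
  {ae mu, forall x, (0 < h x)%R -> F x <= G x} -> wint h F <= wint h G.
Proof.
move=> wh mF mG F0 G0 FG; have mh : measurable_fun setT (EFin \o h).
  by apply/measurable_EFinP; exact: wh.1.
apply: ae_ge0_le_integral => //.
- by move=> x _; rewrite mule_ge0// lee_fin; exact: wh.2.
- exact: emeasurable_funM.
- by move=> x _; rewrite mule_ge0// lee_fin; exact: wh.2.
- exact: emeasurable_funM.
- apply: filterS FG => x FGx _; have := wh.2 x.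
  rewrite le_eqVlt => /predU1P[<-|hx]; first by rewrite !mule0.
  by apply: lee_wpmul2r; [rewrite lee_fin ltW|exact: FGx].
Qed.

Lemma le_wint_supp h F G : weight h -> measurable_fun setT F -> measurable_fun setT G ->
  (forall x, 0 <= F x) -> (forall x, 0 <= G x) ->
  (forall x, (0 < h x)%R -> F x <= G x) -> wint h F <= wint h G.
Proof. by move=> wh mF mG F0 G0 FG; apply: le_wint_ae => //; exact: aeW. Qed.

Lemma mass_bounded_approx h (m : R) : weight h -> mass h setT = m%:E ->
  fine (mass h (eball 0 n.+1%:R)) @[n --> \oo] --> m.
Proof.
move=> wh hm; apply: fine_cvg; rewrite -hm.
have mh : measurable_fun setT (EFin \o h) by apply/measurable_EFinP; exact: wh.1.
have indE (A : set V) : measurable A -> mass h A = \int[mu]_(x in A) (h x)%:E.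
  move=> mA; rewrite integral_mkcond; apply: eq_integral => x _.
  by rewrite patchE indicE; case: ifPn => _; rewrite ?mul1e ?mul0e.
have mB n : measurable (eball (0 : V) n.+1%:R) by exact: measurable_eball.
under eq_cvg do rewrite indE//.
rewrite mass_setT (_ : setT = \bigcup_n eball (0 : V) n.+1%:R); last first.
  apply/esym; rewrite -subTset => x _; exists (Num.truncn (enorm x)) => //=.
  by rewrite /eball/= subr0; apply: truncnS_gt.
apply: ge0_nondecreasing_set_cvg_integral => //.
- move=> n k nk; apply/subsetPset => x; rewrite /eball/= => /lt_le_trans; apply.
  by rewrite ler_nat ltnS.
- by move=> n; exact: measurable_funTS.
- by move=> n x _; rewrite lee_fin; exact: wh.2.
Qed.

(** [quartic_energy_ge] applies to the restriction of [h] to a ball, where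
    polynomials are integrable; let the radius tend to infinity. *)
Lemma quartic_wint_ge h (m : R) : (0 < N)%N -> weight h -> mass h setT = m%:E ->
  (m ^+ 2 / N.+1%:R)%:E <=
  wint h (fun x => wint h (fun y => ((enorm (x - y) ^+ 2 - 1) ^+ 2)%:E)).
Proof.
move=> N0 wh hm.
have [mh h0] := wh.
pose q (p : V * V) : R := ((enorm (p.1 - p.2) ^+ 2 - 1) ^+ 2)%R.
have mq : measurable_fun setT q.
  apply: (@measurable_radial R N (fun r => (r ^+ 2 - 1) ^+ 2)%R).
  by apply: measurable_funX; apply: measurable_funB => //; apply: measurable_funX.
have q0 p : (0 <= q p)%R by exact: sqr_ge0.
pose W x := wint h (fun y => (q (x, y))%:E).
have mqE : measurable_fun setT (EFin \o q) by exact/measurable_EFinP.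
have W0 x : 0 <= W x by apply: wint_ge0 => // y; rewrite lee_fin.
have mW : measurable_fun setT W by apply: (measurable_wint wh mqE) => p; rewrite lee_fin.
rewrite -/(wint h W).
have := leey (wint h W); rewrite le_eqVlt => /predU1P[->|Wfin]; first exact: leey.
have [e eE] : exists e, wint h W = e%:E.
  by exists (fine (wint h W)); rewrite fineK// ge0_fin_numE// wint_ge0.
rewrite eE lee_fin.
have ih : mu.-integrable setT (EFin \o h).
  apply/integrableP; split; first exact/measurable_EFinP.
  rewrite (_ : (\int[mu]_x _) = m%:E) ?ltry// -hm mass_setT.
  by apply: eq_integral => x _ /=; rewrite ger0_norm.
pose B n := eball (0 : V) n.+1%:R.
have mB n : measurable (B n) by exact: measurable_eball.
pose u n := fine (mass h (B n)).
have un n : (u n ^+ 2 <= N.+1%:R * e)%R.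
  pose G (f : V -> R) := measurable_fun setT f /\
    exists M : R, forall x, B n x -> (`|f x| <= M)%R.
  pose L (f : V -> R) := (\int[mu]_(x in B n) (f x * h x))%R.
  have intG f : G f -> mu.-integrable (B n) (EFin \o (fun x => f x * h x)%R).
    move=> [mf [M fM]].
    apply: (@le_integrable _ _ _ _ _ _ _ (EFin \o (fun x => M * h x)%R)) => //.
    - apply/measurable_EFinP; apply: measurable_funTS; exact: measurable_funM.
    - move=> x Bx; rewrite !abse_EFin lee_fin !normrM; apply: ler_wpM2r => //.
      exact: le_trans (fM x Bx) (ler_norm _).
    - rewrite (_ : EFin \o _ = (fun x => M%:E * (EFin \o h) x)); last by [].
      by apply: integrableZl => //; apply: integrableS ih.
  have Gcst a : G (fun=> a) by split => //; exists `|a|%R.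
  have L1 : L (fun=> 1%R) = u n.
    rewrite /L /Rintegral /u; congr fine; rewrite /mass /wint integral_mkcond.
    apply: eq_integral => x _; rewrite patchE indicE.
    by case: ifPn => _; rewrite /= -EFinM// mul0r.
  have u0 : (0 <= u n)%R by rewrite fine_ge0// mass_ge0.
  have [un0|un0] := leP (u n) 0%R.
    have -> : u n = 0%R by apply/eqP; rewrite eq_le un0.
    rewrite expr0n/= mulr_ge0// -lee_fin -eE; exact: wint_ge0.
  have := @quartic_energy_ge R N L G; rewrite L1 => key.
  apply: (@le_trans _ _ (N.+1%:R * L (fun x => L (fun y => q (x, y))))%R).
    apply: key => //.
    - move=> k; split.
        by apply: (@measurable_rV_coord _ _ _ _ id).
      exists n.+1%:R => x; rewrite /B /eball/= subr0 => xn.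
      by apply: le_trans (coord_le_enorm x k) _; exact: ltW.
    - move=> f g [mf [M1 f1]] [mg [M2 g2]]; split; first exact: measurable_funD.
      exists (M1 + M2)%R => x Bx; apply: le_trans (ler_normD _ _) _.
      by apply: lerD; [exact: f1|exact: g2].
    - move=> f g [mf [M1 f1]] [mg [M2 g2]]; split; first exact: measurable_funM.
      by exists (M1 * M2)%R => x Bx; rewrite normrM ler_pM// ?f1// ?g2.
    - move=> f g Gf Gg; rewrite /L -RintegralD//; try exact: intG.
      by apply: eq_Rintegral => x _; rewrite mulrDl.
    - move=> a f Gf; rewrite /L -RintegralZl//; last exact: intG.
      by apply: eq_Rintegral => x _; rewrite mulrA.
    - by move=> f Gf f0; apply: Rintegral_ge0 => x _; rewrite mulr_ge0.
  apply: ler_wpM2l => //.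
  have mqx x : measurable_fun setT (fun y => q (x, y)).
    by apply: (measurableT_comp mq); exact: measurable_pair1.
  have Gq x : G (fun y => q (x, y)).
    split => //; exists (((enorm x + n.+1%:R) ^+ 2 + 1) ^+ 2)%R => y.
    rewrite /B /eball/= subr0 => yn; rewrite ger0_norm// /q/=.
    set r := enorm _; have r0 : (0 <= r)%R by exact: enorm_ge0.
    have rx : (r <= enorm x + n.+1%:R)%R.
      by apply: le_trans (enormD _ _) _; rewrite enormN lerD2l ltW.
    set s := (enorm x + _)%R in rx *.
    have rs : (r ^+ 2 <= s ^+ 2)%R by rewrite ler_pXn2r// nnegrE; lra.
    have : (0 <= r ^+ 2)%R by exact: sqr_ge0.
    by nra.
  pose Ln x := L (fun y => q (x, y)).
  have Ln0 x : (0 <= Ln x)%R by apply: Rintegral_ge0 => y _; rewrite mulr_ge0.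
  have LnW x : (Ln x)%:E <= W x.
    rewrite /Ln /L /Rintegral fineK; last first.
      by apply: integrable_fin_num => //; exact: intG.
    apply: ge0_subset_integral => //.
      by apply/measurable_EFinP; exact: measurable_funM.
    by move=> y _; rewrite lee_fin mulr_ge0.
  have mLn : measurable_fun setT Ln.
    apply: (measurableT_comp (@fine_measurable R setT measurableT)).
    pose K (p : V * V) : \bar R := (q p * h p.2 * \1_(B n) p.2)%:E.
    have mK : measurable_fun setT K.
      apply/measurable_EFinP; apply: measurable_funM; last first.
        have mI : measurable_fun setT (\1_(B n) : V -> R) by exact: measurable_indic.
        exact: (measurableT_comp mI (@measurable_snd _ _ V V)).
      apply: measurable_funM => //; exact: (measurableT_comp mh).
    rewrite (_ : (fun x => _) = (fun x => \int[mu]_y K (x, y))); last first.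
      apply/funext => x; rewrite integral_mkcond; apply: eq_integral => y _.
      by rewrite patchE /K/= indicE; case: ifPn => _; rewrite ?mulr1 ?mulr0.
    exact: (@measurable_partial_integral _ _ _ _ _ mu K mK).
  rewrite -lee_fin -eE /L /Rintegral.
  have [Lfin|Linf] := ltP (\int[mu]_(x in B n) (Ln x * h x)%:E) +oo; last first.
    rewrite (_ : fine _ = 0%R); first exact: wint_ge0.
    by have := leey (\int[mu]_(x in B n) (Ln x * h x)%:E); rewrite le_eqVlt ltNge Linf orbF => /eqP ->.
  have Lh0 x : 0 <= (Ln x * h x)%:E by rewrite lee_fin; exact: mulr_ge0 (Ln0 x) (h0 x).
  have Lf : \int[mu]_(x in B n) (Ln x * h x)%:E \is a fin_num.
    by rewrite ge0_fin_numE//; exact: integral_ge0.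
  rewrite (fineK Lf); apply: (@le_trans _ _ (\int[mu]_x (Ln x * h x)%:E)).
    by apply: ge0_subset_integral => //; apply/measurable_EFinP; exact: measurable_funM.
  apply: ge0_le_integral => //.
  - by apply/measurable_EFinP; exact: measurable_funM.
  - by apply: emeasurable_funM => //; exact/measurable_EFinP.
  - by move=> x _; rewrite EFinM; apply: lee_wpmul2r => //; rewrite lee_fin.
have cu := mass_bounded_approx wh hm.
have cu2 : (u n ^+ 2 @[n --> \oo] --> m ^+ 2)%R.
  by under eq_cvg do rewrite expr2; rewrite expr2; apply: cvgM.
rewrite ler_pdivrMr ?ltr0n// mulrC -(cvg_lim _ cu2)//.
apply: limr_le; first by apply/cvg_ex; exists (m ^+ 2)%R.
exact: nearW.
Qed.

End weighted_integral_comparison.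

(** * Densities of small mass on a regular simplex *)

Section competitor.
Local Open Scope ereal_scope.
Context (R : realType) (N : nat) (alpha beta : R).
Local Notation V := 'rV[R]_N.
Local Notation mu := (lebesgue_rV R N).
Hypotheses (ba : (beta < alpha)%R) (b2 : (2 <= beta)%R) (a4 : (4 <= alpha)%R).
Hypothesis abn : (alpha, beta) <> (4, 2)%R.
Hypothesis N0 : (0 < N)%N.
Local Notation gam := (wdepth alpha beta).
Local Notation potential := (@potential R N alpha beta).
Local Notation interaction := (@interaction R N alpha beta).
Variable x : 'I_N.+1 -> V.
Hypothesis x1 : unit_simplex x.

Lemma cube_enorm (c y : V) (s : R) : (0 <= s)%R -> cube c s y ->
  (enorm (y - c) <= N%:R * s)%R.
Proof.
move=> s0 yc; apply: enorm_le_coord => // k; rewrite !mxE ler_norml.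
by have /andP[h1 h2] := yc k; apply/andP; split; lra.
Qed.

(** Small cubes of measure [m / (N+1)] with a corner at each vertex: the kernel
    is about [wdepth] within a cube and about 0 between two cubes. *)
Lemma small_mass_competitor (eta : R) : (0 < eta)%R -> exists2 m0 : R, (0 < m0)%R &
  forall m : R, (0 < m)%R -> (m < m0)%R -> exists k : V -> R,
    [/\ weight k, forall y, (k y <= 1)%R, mass k setT = m%:E &
        interaction k k <= (m ^+ 2 * (gam / N.+1%:R + eta))%:E].
Proof.
move=> eta0.
have g0 := wdepth_gt0 ba b2 a4.
have NR : (0 < N%:R :> R)%R by rewrite ltr0n.
have MR : (0 < N.+1%:R :> R)%R by rewrite ltr0n.
have [d1 d10 Hd1] := profile_near1 b2 a4 eta0.
pose t := (Num.min d1 (Num.min eta 1) / (4 * N%:R))%R.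
have t0 : (0 < t)%R by rewrite divr_gt0 ?mulr_gt0// !lt_min d10 eta0 ltr01.
have tE : (4 * (N%:R * t) = Num.min d1 (Num.min eta 1))%R.
  by rewrite /t; field; exact: lt0r_neq0.
have td : (4 * (N%:R * t) <= d1)%R by rewrite tE ge_min lexx.
have te : (4 * (N%:R * t) <= eta)%R by rewrite tE !ge_min lexx orbT.
have tl : (4 * (N%:R * t) <= 1)%R by rewrite tE !ge_min lexx !orbT.
exists (N.+1%:R * t ^+ N)%R; first by rewrite mulr_gt0// exprn_gt0.
move=> m m0 mlt.
pose s := ((m / N.+1%:R) `^ (N%:R^-1))%R.
have s0 : (0 <= s)%R by exact: powR_ge0.
have mM0 : (0 <= m / N.+1%:R)%R by rewrite divr_ge0// ltW.
have sN : (s ^+ N = m / N.+1%:R)%R.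
  by rewrite -powR_mulrn// /s -powRrM mulVf ?gt_eqF// powRr1.
have st : (s < t)%R.
  rewrite -(@ltr_pXn2r _ N)// ?nnegrE// ?(ltW t0)// sN ltr_pdivrMr//.
  by rewrite mulrC.
have Ns : (N%:R * s < N%:R * t)%R by rewrite ltr_pM2l.
pose r := (N%:R * s)%R; have r0 : (0 <= r)%R by rewrite mulr_ge0.
have [rd re rl] : [/\ (4 * r < d1)%R, (4 * r < eta)%R & (4 * r < 1)%R].
  by rewrite /r; split; lra.
pose C i := cube (x i) s.
have mC i : measurable (C i) by exact: measurable_cube.
have Cr i y : C i y -> (enorm (y - x i) <= r)%R by exact: cube_enorm.
have CC i j y z : C i y -> C j z -> i != j -> (`|enorm (y - z) - 1| < d1)%R.
  move=> yi zj ij; have hy := Cr i y yi; have hz := Cr j z zj.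
  have h1 := enorm_dist (x i) y z; have h2 := enorm_dist (x j) z (x i).
  rewrite (enormB z) (enormB (x j)) x1// in h2.
  move: h1 h2; rewrite !ler_norml ltr_norml => /andP[? ?] /andP[? ?].
  by apply/andP; split; lra.
have CD i j y : C i y -> C j y -> i = j.
  move=> yi yj; apply/eqP/negPn/negP => ij.
  have := enorm_trans y (x i) (x j); rewrite x1// (enormB (x i)).
  by have := Cr i y yi; have := Cr j y yj; lra.
have Cs i : mu (C i) = (m / N.+1%:R)%:E by rewrite lebesgue_rV_cube// sN.
pose F := \bigcup_(i in [set: 'I_N.+1]) C i.
have mF : measurable F by apply: fin_bigcup_measurable; [exact: finite_finset|move=> i _].
have wF : weight (\1_F : V -> R) by exact: weight_indic.
have Fs i : mass (\1_F : V -> R) (C i) = (m / N.+1%:R)%:E.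
  rewrite mass_indic// setIidr ?Cs// => y yi; by exists i.
have sumC : \sum_(i < N.+1) (m / N.+1%:R)%:E = m%:E.
  by rewrite sumEFin sumr_const card_ord -[(_ *+ N.+1)%R]mulr_natl mulrC divfK ?gt_eqF.
have mI i : measurable_fun setT (fun y : V => (\1_(C i) y)%:E : \bar R).
  exact: measurable_indicE.
have indF y : F y -> 1 = \sum_(i < N.+1) (\1_(C i) y)%:E :> \bar R.
  move=> [i _ yi]; rewrite (bigD1 i)//= big1 ?adde0 ?indicE ?mem_set//.
  move=> j ji; rewrite indicE memNset// => yj.
  by move: ji; rewrite (CD j i y yj yi) eqxx.
have hF y : (0 < \1_F y :> R)%R -> F y.
  by rewrite indicE; have [/set_mem//|] := boolP (y \in F); rewrite ltxx.
have Fm : mass (\1_F : V -> R) setT = m%:E.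
  transitivity (\sum_i mass (\1_F : V -> R) (C i)); last first.
    by rewrite -sumC; apply: eq_bigr => i _; rewrite Fs.
  rewrite /mass -wint_sum//; apply: eq_integral => y _.
  have [yF|yF] := pselect (F y); first by rewrite -indF// indicT.
  have F0 : \1_F y = 0%R :> R by rewrite indicE memNset.
  by rewrite F0 !mule0.
exists (\1_F); split; [exact: wF| |exact: Fm|].
  by move=> y; rewrite indicE lern1 leq_b1.
pose c i j : R := ((i == j :> 'I_N.+1)%:R * gam + eta)%R.
have c0 i j : (0 <= c i j)%R.
  by rewrite /c addr_ge0 ?(ltW eta0)// mulr_ge0 ?(ltW g0).
have pc i j y z : C i y -> C j z -> (pairpot alpha beta y z <= c i j)%R.
  move=> yi zj; rewrite /c; have [ij|ij] := eqVneq i j.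
    subst j; rewrite mul1r; have h : (enorm (y - z) <= 2 * r)%R.
      have := enorm_trans (x i) y z; rewrite (enormB (x i)).
      by have := Cr i y yi; have := Cr i z zj; lra.
    have h1 : (enorm (y - z) <= 1)%R by lra.
    apply: le_trans (profile_near0 b2 a4 (enorm_ge0 _) h1) _.
    by rewrite lerD2l; lra.
  rewrite mul0r add0r; apply: Hd1; first exact: enorm_ge0.
  exact: CC yi zj ij.
have sumc i : (\sum_j c i j = gam + N.+1%:R * eta)%R.
  rewrite big_split/= sumr_const card_ord mulr_natl -mulr_suml; congr (_ + _)%R.
  rewrite (bigD1 i)//= eqxx big1 ?addr0 ?mul1r// => j ji.
  by rewrite eq_sym (negPf ji).
pose K : R := (m * (gam / N.+1%:R + eta))%R.
have K0 : (0 <= K)%R by rewrite mulr_ge0 ?(ltW m0)// addr_ge0 ?(ltW eta0)// divr_ge0 ?(ltW g0).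
have potK y : F y -> potential \1_F y <= K%:E.
  move=> [i _ yi].
  have mcI j : measurable_fun setT (fun z => (c i j)%:E * (\1_(C j) z)%:E).
    exact: emeasurable_funM.
  have cI0 j z : 0 <= (c i j)%:E * (\1_(C j) z)%:E by rewrite mule_ge0// lee_fin.
  apply: (@le_trans _ _ (wint \1_F (fun z => \sum_j (c i j)%:E * (\1_(C j) z)%:E))).
    apply: le_wint_supp => //.
    - exact: measurable_pairpot1.
    - exact: emeasurable_sum.
    - by move=> z; exact: pairpotE_ge0.
    - by move=> z; exact: sume_ge0.
    - move=> z /hF[j _ zj]; rewrite (bigD1 j)//= indicE mem_set// mule1.
      apply: (@le_trans _ _ (c i j)%:E); first by rewrite lee_fin; exact: pc.
      by rewrite leeDl// sume_ge0.
  rewrite wint_sum//.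
  rewrite (eq_bigr (fun j => (c i j * (m / N.+1%:R))%:E)); last first.
    by move=> j _; rewrite wintZ// -[wint _ _]/(mass \1_F (C j)) Fs EFinM.
  rewrite sumEFin -mulr_suml sumc lee_fin /K le_eqVlt; apply/orP; left.
  by apply/eqP; field; exact: lt0r_neq0.
rewrite (_ : (m ^+ 2 * _)%:E = K%:E * mass (\1_F : V -> R) setT); last first.
  by rewrite Fm -EFinM /K; congr EFin; ring.
rewrite -wint_cst//; apply: le_wint_supp.
- exact: wF.
- exact: measurable_potential.
- exact: measurable_cst.
- by move=> y; exact: potential_ge0.
- by move=> y; rewrite lee_fin.
- by move=> y /hF; exact: potK.
Qed.

End competitor.

(** * Clusters in a density of almost minimal energy *)

Section clusters.
Local Open Scope ereal_scope.
Context (R : realType) (N : nat) (alpha beta : R).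
Local Notation V := 'rV[R]_N.
Hypotheses (ba : (beta < alpha)%R) (b2 : (2 <= beta)%R) (a4 : (4 <= alpha)%R).
Hypothesis abn : (alpha, beta) <> (4, 2)%R.
Hypothesis N0 : (0 < N)%N.
Local Notation gam := (wdepth alpha beta).
Local Notation gap := (profile_gap alpha beta).
Local Notation pairpot := (@pairpot R N alpha beta).
Local Notation potential := (@potential R N alpha beta).
Local Notation interaction := (@interaction R N alpha beta).
Implicit Types (h : V -> R) (m : R).

Lemma wint_markov h (F : V -> \bar R) (A : set V) (t : R) : weight h ->
  measurable_fun setT F -> (forall x, 0 <= F x) -> measurable A -> (0 <= t)%R ->
  (forall x, A x -> t%:E <= F x) -> t%:E * mass h A <= wint h F.
Proof.
move=> wh mF F0 mA t0 AF; have mI := measurable_indicE mA.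
rewrite /mass -wintZ//; apply: le_wint => //.
- exact: emeasurable_funM.
- by move=> x; rewrite mule_ge0// lee_fin.
- move=> x; rewrite indicE; have [/set_mem xA|_] := boolP (x \in A).
    by rewrite mule1; exact: AF.
  by rewrite mule0.
Qed.

Let gapk (p : V * V) : \bar R := (gap (enorm (p.1 - p.2)))%:E.

Let mgapk : measurable_fun setT gapk.
Proof.
apply/measurable_EFinP; apply: (@measurable_radial R N gap).
apply: measurable_funB; first exact: measurable_profile.
by apply: measurable_funM => //; apply: measurable_funX; apply: measurable_funB.
Qed.

Let gapk0 p : 0 <= gapk p.
Proof. by rewrite lee_fin; apply: profile_gap_ge0 => //; exact: enorm_ge0. Qed.

Let mgapx x : measurable_fun setT (fun y => gapk (x, y)).
Proof. exact: (measurableT_comp mgapk (measurable_pair1 x)). Qed.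

Definition gap_potential h (x : V) : \bar R :=
  wint h (fun y => (gap (enorm (x - y)))%:E).

Let gap_pot_ge0 h x : weight h -> 0 <= gap_potential h x.
Proof. by move=> wh; apply: wint_ge0 => // y; exact: (gapk0 (x, y)). Qed.

Let mgap_pot h : weight h -> measurable_fun setT (gap_potential h).
Proof. by move=> wh; exact: (measurable_wint wh mgapk gapk0). Qed.

(** By [quartic_wint_ge] the quartic part of the kernel uses up
    [wdepth m^2 / (N+1)], and only the excess is left for the gap. *)
Lemma gap_energy_le h m (eta : R) : weight h -> mass h setT = m%:E ->
  interaction h h <= (m ^+ 2 * (gam / N.+1%:R + eta))%:E ->
  wint h (gap_potential h) <= (m ^+ 2 * eta)%:E.
Proof.
move=> wh hm hI; have g0 := wdepth_gt0 ba b2 a4.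
have := quartic_wint_ge N0 wh hm.
pose q (p : V * V) : \bar R := ((enorm (p.1 - p.2) ^+ 2 - 1) ^+ 2)%:E.
have mq : measurable_fun setT q.
  apply/measurable_EFinP; apply: (@measurable_radial R N (fun r => (r ^+ 2 - 1) ^+ 2)%R).
  by apply: measurable_funX; apply: measurable_funB.
have q0 p : 0 <= q p by rewrite lee_fin sqr_ge0.
have mqx x : measurable_fun setT (fun y => q (x, y)).
  exact: (measurableT_comp mq (measurable_pair1 x)).
pose Q x := wint h (fun y => q (x, y)).
have mQ : measurable_fun setT Q by exact: (measurable_wint wh mq q0).
have Q0 x : 0 <= Q x by exact: wint_ge0.
rewrite -[wint h _]/(wint h Q) => Qge.
have E : interaction h h = gam%:E * wint h Q + wint h (gap_potential h).
  rewrite -wintZ ?(ltW g0)// -wintD//.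
  - apply: eq_wint => x; rewrite -wintZ ?(ltW g0)// -wintD//.
    + apply: eq_wint => y; rewrite -EFinM -EFinD; congr EFin.
      by rewrite -[pairpot x y]/(profile alpha beta (enorm (x - y))) /profile_gap; ring.
    + exact: emeasurable_funM.
    + exact: mgapx.
    + by move=> y; rewrite mule_ge0// lee_fin ltW.
    + by move=> y; exact: (gapk0 (x, y)).
  - exact: emeasurable_funM.
  - exact: mgap_pot.
  - by move=> x; rewrite mule_ge0// lee_fin ltW.
  - by move=> x; exact: gap_pot_ge0.
have gq : (gam * (m ^+ 2 / N.+1%:R))%:E <= gam%:E * wint h Q.
  by rewrite EFinM lee_pmul2l.
have : (gam * (m ^+ 2 / N.+1%:R))%:E + wint h (gap_potential h) <=
       (gam * (m ^+ 2 / N.+1%:R))%:E + (m ^+ 2 * eta)%:E.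
  apply: (@le_trans _ _ (interaction h h)); first by rewrite E leeD2r.
  by apply: (le_trans hI); rewrite -EFinD (_ : (_ * _)%R = (gam * (m ^+ 2 / N.+1%:R) + m ^+ 2 * eta)%R) //; ring.
by rewrite leeD2lE.
Qed.

(** Call a point good if its gap potential is at most [z m].  By Markov's
    inequality most of the mass is at good points, and most of the mass is at
    distance close to 0 or 1 from any given good point.  Take a family of good points
    almost at distance 1 from each other with as many members as possible, hence at
    most [N+1].  A good point outside the balls around them cannot be added to the
    family, so its distance to some member is far from both 0 and 1. *)
Lemma clusters_exist h m (d c z : R) : weight h -> mass h setT = m%:E -> (0 < m)%R ->
  (0 < c)%R -> (0 < z)%R ->
  (forall r, (d <= r)%R -> (d <= `|r - 1|)%R -> (c <= gap r)%R) ->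
  (forall y : 'I_N.+2 -> V,
    ~ forall i j, i != j -> (`|enorm (y i - y j) - 1| < d)%R) ->
  wint h (gap_potential h) <= (m ^+ 2 * z ^+ 2)%:E ->
  exists n (p : 'I_n -> V), [/\ (n <= N.+1)%N,
    forall i j, i != j -> (`|enorm (p i - p j) - 1| < d)%R &
    mass h (~` \bigcup_i eball (p i) d) <= (m * (z * (1 + N.+1%:R / c)))%:E].
Proof.
move=> wh hm m0 c0 z0 gapd noeq gz.
have zm0 : (0 < z * m)%R by rewrite mulr_gt0.
pose S := [set x | gap_potential h x <= (z * m)%:E].
pose bad x := [set y : V | c%:E <= gapk (x, y)].
have mS : measurable S.
  by rewrite -[X in measurable X]setTI; apply: emeasurable_fun_infty_c => //; exact: mgap_pot.
have mbad x : measurable (bad x).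
  by rewrite -[X in measurable X]setTI; apply: emeasurable_fun_c_infty => //; exact: mgapx.
have SC : mass h (~` S) <= (z * m)%:E.
  have := wint_markov wh (mgap_pot wh) (fun x => gap_pot_ge0 x wh)
    (measurableC mS) (ltW zm0).
  have AF x : (~` S) x -> (z * m)%:E <= gap_potential h x.
    by move=> /= /negP; rewrite -ltNge => /ltW.
  move=> /(_ AF) /le_trans/(_ gz) H; rewrite -(lee_pmul2l _ (x := (z * m)%:E))// ?lte_fin//.
  by apply: (le_trans H); rewrite -EFinM lee_fin; lra.
have Sbad x : S x -> mass h (bad x) <= (z * m / c)%:E.
  move=> xS; have := wint_markov wh (mgapx x) (fun y => gapk0 _) (mbad x) (ltW c0).
  move=> /(_ (fun y H => H)) /le_trans/(_ xS) H.
  rewrite -(lee_pmul2l _ (x := c%:E))// ?lte_fin//.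
  by apply: (le_trans H); rewrite -EFinM lee_fin [(c * _)%R]mulrC divfK// gt_eqF.
pose P n := exists p : 'I_n -> V, (forall i, S (p i)) /\
  forall i j, i != j -> (`|enorm (p i - p j) - 1| < d)%R.
have P0 : P 0%N by exists (fun=> 0%R); split; case.
have [n [nN Pn Pn1]] : exists n, [/\ (n <= N.+1)%N, P n & ~ P n.+1].
  apply: contrapT => H.
  suff : P N.+2 by move=> [p [_ /noeq]].
  have : (N.+2 <= N.+2)%N by [].
  elim: {1 3}N.+2 => // n IH nN; apply: contrapT => Pn1; apply: H; exists n.
  by split => //; apply: IH; exact: ltnW.
have [p [pS pp]] := Pn; exists n, p; split => //.
pose W := \bigcup_i eball (p i) d.
have mW : measurable W.
  by apply: fin_bigcup_measurable; [exact: finite_finset|move=> i _; exact: measurable_eball].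
have cover y : ~ W y -> ~ S y \/ exists i, bad (p i) y.
  move=> yW; have [yS|] := pselect (S y); last by left.
  right; apply: contrapT => nb; apply: Pn1.
  have dy i : (`|enorm (y - p i) - 1| < d)%R.
    rewrite ltNge; apply/negP => dr; apply: nb; exists i.
    rewrite /bad/= /gapk/= lee_fin enormB; apply: gapd => //.
    by rewrite leNgt; apply/negP => yd; apply: yW; exists i.
  exists (fun i => if unlift ord0 i is Some j then p j else y); split.
    by move=> i; case: (unliftP ord0 i) => [j|] _; [exact: pS|exact: yS].
  move=> i j; case: (unliftP ord0 i) => [k|] ->; case: (unliftP ord0 j) => [l|] ->.
  - by rewrite (inj_eq (@lift_inj _ ord0)); exact: pp.
  - by move=> _; rewrite enormB.
  - by move=> _.
  - by rewrite eqxx.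
have mIS := measurable_indicE (measurableC mS).
have mIb i := measurable_indicE (mbad (p i)).
apply: (@le_trans _ _ (wint h (fun y => (\1_(~` S) y)%:E + \sum_i (\1_(bad (p i)) y)%:E))).
  apply: le_wint => //.
  - by apply: measurable_indicE; exact: measurableC.
  - by apply: emeasurable_funD => //; exact: emeasurable_sum.
  move=> y; rewrite indicE; have [/set_mem/= /cover|_] := boolP (y \in _); last first.
    by rewrite adde_ge0// sume_ge0.
  case=> [nS|[i bi]].
    by rewrite [\1_(~` S) y]indicE mem_set// leeDl// sume_ge0.
  rewrite (bigD1 i)//= [\1_(bad _) y]indicE mem_set// addeA addeAC leeDr//.
  by rewrite adde_ge0// sume_ge0.
rewrite wintD//; last 2 first.
- exact: emeasurable_sum.
- by move=> y; exact: sume_ge0.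
rewrite wint_sum//.
apply: (@le_trans _ _ ((z * m)%:E + \sum_(i < n) (z * m / c)%:E)).
  by apply: leeD => //; apply: lee_sum => i _; exact: Sbad.
rewrite sumEFin sumr_const card_ord -EFinD lee_fin.
have zc : (0 <= z * m / c)%R by rewrite divr_ge0// ltW.
have : (z * m / c *+ n <= z * m / c *+ N.+1)%R by apply: ler_wpMn2l.
rewrite -[(_ *+ N.+1)%R]mulr_natl.
have -> : (m * (z * (1 + N.+1%:R / c)) = z * m + N.+1%:R * (z * m / c))%R.
  by field; exact: lt0r_neq0.
by move=> ?; rewrite lerD2l.
Qed.

Definition tail_potential h (W : set V) (x : V) : \bar R :=
  wint h (fun y => (\1_(~` W) y)%:E * (pairpot x y)%:E).

Lemma tail_potential_ge0 h W x : weight h -> 0 <= tail_potential h W x.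
Proof.
move=> wh; apply: wint_ge0 => // y.
by rewrite mule_ge0 ?pairpotE_ge0 ?lee_fin.
Qed.

Lemma measurable_tail (W : set V) x : measurable W ->
  measurable_fun setT (fun y => (\1_(~` W) y)%:E * (pairpot x y)%:E).
Proof.
move=> mW; apply: emeasurable_funM; last exact: measurable_pairpot1.
by apply: measurable_indicE; exact: measurableC.
Qed.

Lemma measurable_tail_potential h W : weight h -> measurable W ->
  measurable_fun setT (tail_potential h W).
Proof.
move=> wh mW.
pose K (p : V * V) : \bar R := (\1_(~` W) p.2)%:E * (pairpot p.1 p.2)%:E.
have mK : measurable_fun setT K.
  apply: emeasurable_funM; last exact: measurable_pairpot.
  exact: (measurableT_comp (measurable_indicE (measurableC mW)) (@measurable_snd _ _ V V)).
apply: (measurable_wint wh mK) => p.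
by rewrite mule_ge0 ?pairpotE_ge0 ?lee_fin.
Qed.

(** Within a ball of radius [d] the kernel is at least [wdepth (1 - 8 d^2)]; the
    interactions that do not appear on the left are nonnegative. *)
Lemma interaction_ge_clusters h n (p : 'I_n -> V) (d : R)
    (W := \bigcup_i eball (p i) d) : weight h ->
  (d <= 1 / 4)%R -> (forall i j, i != j -> (`|enorm (p i - p j) - 1| < d)%R) ->
  (gam * (1 - 8 * d ^+ 2))%:E * (\sum_i mass h (eball (p i) d) * mass h (eball (p i) d))
    + wint h (fun x => (\1_W x)%:E * tail_potential h W x) <= interaction h h.
Proof.
move=> wh d4 pp; have g0 := wdepth_gt0 ba b2 a4.
have mB i : measurable (eball (p i) d) by exact: measurable_eball.
have mW : measurable W by apply: fin_bigcup_measurable; [exact: finite_finset|move=> i _].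
have mIB i := measurable_indicE (mB i).
have mIW := measurable_indicE mW; have mIWC := measurable_indicE (measurableC mW).
have [d0|d0] := ltP 0%R d; last first.
  have B0 i : eball (p i) d = set0.
    rewrite -subset0 => y; rewrite /eball/= => /lt_le_trans/(_ d0).
    by rewrite ltNge enorm_ge0.
  have W0 : W = set0 by apply: bigcup0 => i _; exact: B0.
  rewrite W0; under eq_bigr do rewrite B0.
  have m0 : mass h set0 = 0 by rewrite /mass /wint; apply: integral0_eq => y _; rewrite indicE in_set0 mul0e.
  rewrite big1; last by move=> i _; rewrite m0 mule0.
  rewrite mule0 add0e /wint integral0_eq ?interaction_ge0// => y _.
  by rewrite indicE in_set0 !mul0e.
have c0 : (0 <= gam * (1 - 8 * d ^+ 2))%R.
  by apply: mulr_ge0; [exact: ltW|nra].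
set c := (gam * _)%R in c0 *.
have disj i j y : eball (p i) d y -> eball (p j) d y -> i = j.
  rewrite /eball/= => yi yj; apply/eqP/negPn/negP => ij.
  have := pp i j ij; have := enorm_trans y (p i) (p j); rewrite (enormB (p i) y).
  by rewrite ltr_norml => h1 /andP[h2 _]; lra.
have mt := measurable_tail_potential wh mW.
have t0 x : 0 <= tail_potential h W x by exact: tail_potential_ge0.
have mb0 i : 0 <= mass h (eball (p i) d) by exact: mass_ge0.
have mcB i : measurable_fun setT (fun x => (\1_(eball (p i) d) x)%:E * mass h (eball (p i) d)).
  by apply: emeasurable_funM.
have cB0 i x : 0 <= (\1_(eball (p i) d) x)%:E * mass h (eball (p i) d).
  by rewrite mule_ge0// lee_fin.
apply: (@le_trans _ _ (wint h (fun x =>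
   c%:E * (\sum_i (\1_(eball (p i) d) x)%:E * mass h (eball (p i) d))
   + (\1_W x)%:E * tail_potential h W x))).
  rewrite wintD//; last 4 first.
  - by apply: emeasurable_funM => //; exact: emeasurable_sum.
  - exact: emeasurable_funM.
  - by move=> x; rewrite mule_ge0 ?lee_fin// sume_ge0.
  - by move=> x; rewrite mule_ge0 ?lee_fin.
  rewrite wintZ//; last 2 first.
  - exact: emeasurable_sum.
  - by move=> x; rewrite sume_ge0.
  rewrite wint_sum// leeD2r//; apply: lee_wpmul2l => //; apply: lee_sum => i _.
  rewrite le_eqVlt; apply/orP; left; apply/eqP.
  set mi := mass h _; rewrite {1}/mi /mass /wint -ge0_integralZr//.
  - by apply: eq_integral => x _; rewrite muleAC.
  - by apply: emeasurable_funM => //; apply/measurable_EFinP; exact: wh.1.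
  - by move=> x _; rewrite mule_ge0 ?lee_fin//; exact: wh.2.
  - exact: mb0.
rewrite -[interaction h h]/(wint h (potential h)); apply: le_wint => //.
- apply: emeasurable_funD; last exact: emeasurable_funM.
  by apply: emeasurable_funM => //; exact: emeasurable_sum.
- exact: measurable_potential.
- by move=> x; rewrite adde_ge0// mule_ge0 ?lee_fin// sume_ge0.
move=> x; have [[i _ xi]|xW] := pselect (W x); last first.
  rewrite [\1_W x]indicE memNset// mul0e adde0 big1 ?mule0 ?potential_ge0//.
  by move=> i _; rewrite indicE memNset ?mul0e// => xi; apply: xW; exists i.
rewrite [\1_W x]indicE mem_set ?mul1e; last by exists i.
rewrite (bigD1 i)//= big1 ?adde0; last first.
  move=> j ji; rewrite indicE memNset ?mul0e// => xj.
  by move: ji; rewrite (disj j i x xj xi) eqxx.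
have mu1 : measurable_fun setT (fun y => c%:E * (\1_(eball (p i) d) y)%:E).
  exact: emeasurable_funM.
have u10 y : 0 <= c%:E * (\1_(eball (p i) d) y)%:E by rewrite mule_ge0 ?lee_fin.
have v0 y : 0 <= (\1_(~` W) y)%:E * (pairpot x y)%:E.
  by rewrite mule_ge0 ?pairpotE_ge0 ?lee_fin.
rewrite indicE mem_set// mul1e /mass -(wintZ wh (mIB i) (indicE_ge0 _) c0).
rewrite /tail_potential -(wintD wh mu1 (measurable_tail x mW) u10 v0).
apply: le_wint => //.
- by apply: emeasurable_funD; [exact: emeasurable_funM|exact: measurable_tail].
- exact: measurable_pairpot1.
- by move=> y; rewrite adde_ge0.
move=> y; have [yi|yi] := pselect (eball (p i) d y).
  rewrite [\1_(~` W) y]indicE memNset; last by move=> /=; apply; exists i.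
  rewrite mul0e adde0 indicE mem_set// mule1 lee_fin.
  apply: le_trans (profile_ge_quartic ba b2 a4 abn (enorm_ge0 _)).
  rewrite /c ler_pM2l//; have := enorm_trans (p i) x y; rewrite (enormB (p i) y).
  move: xi yi; rewrite /eball/= => xi yi; set r := enorm (x - y) => rxy.
  have r0 : (0 <= r)%R by exact: enorm_ge0.
  have r2 : (r ^+ 2 <= 4 * d ^+ 2)%R by nra.
  by have := sqr_ge0 (r ^+ 2)%R; nra.
rewrite [\1_(eball _ _) y]indicE memNset// mule0 add0e.
rewrite indicE; case: (y \in _); first by rewrite mul1e.
by rewrite mul0e; exact: pairpotE_ge0.
Qed.

End clusters.

(** * Concentration of minimizers at the vertices of a simplex *)

Section cluster_arithmetic.
Context (R : realType).

(** Here [a] lists the masses of the clusters and [w] is their interaction with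
    the remaining mass.  The sum of the squares of the [n] masses is at least about
    [m^2 / n], and the energy bound says that it is at most about [m^2 / (N+1)]:
    this leaves no room for [n < N+1], for unequal masses or for a large [w]. *)
Lemma cluster_arithmetic (N n : nat) (a : 'I_n -> R) (g d th eta om w m : R) :
  (n <= N.+1)%N -> 0 < m -> 0 < g -> 0 <= th -> 0 <= w -> d ^+ 2 <= 1 / 16 ->
  m * (1 - th) <= \sum_i a i ->
  g * (1 - 8 * d ^+ 2) * \sum_i a i ^+ 2 + w <= m ^+ 2 * (g / N.+1%:R + eta) ->
  eta + g / N.+1%:R * (8 * d ^+ 2 + 2 * th) <= om -> om < g / (2 * N.+1%:R ^+ 2) ->
  [/\ n = N.+1, w <= m ^+ 2 * om &
     forall i, (a i - m / N.+1%:R) ^+ 2 <= 2 * om / g * m ^+ 2].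
Proof.
move=> nN m0 g0 th0 w0 d16 sa ea eo og.
pose M : R := N.+1%:R; rewrite -/M in ea eo og *.
have M0 : 0 < M by rewrite /M ltr0n.
have nM : n%:R <= M by rewrite /M ler_nat.
have nM1 : (n < N.+1)%N -> 1 <= M - n%:R.
  by move=> nlt; rewrite lerBrDr /M -natr1 addrC lerD2r ler_nat.
clearbody M.
pose D := \sum_i (a i - m / M) ^+ 2.
pose e := (M - n%:R) * (m / M) ^+ 2.
have D0 : 0 <= D by apply: sumr_ge0 => i _; exact: sqr_ge0.
have e0 : 0 <= e by rewrite mulr_ge0 ?sqr_ge0// subr_ge0.
have DE : D + e = \sum_i a i ^+ 2 - 2 * (m / M) * \sum_i a i + m ^+ 2 / M.
  have -> : D = \sum_i (a i ^+ 2 - 2 * (m / M) * a i + (m / M) ^+ 2).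
    by apply: eq_bigr => i _; ring.
  rewrite big_split/= sumrB -mulr_sumr sumr_const card_ord -[_ ^+ 2 *+ n]mulr_natl.
  by rewrite /e; field; exact: lt0r_neq0.
have mM : 0 < m / M by rewrite divr_gt0.
have A2 : D + e + (1 - 2 * th) * (m ^+ 2 / M) <= \sum_i a i ^+ 2.
  have h : 2 * (m / M) * (m * (1 - th)) <= 2 * (m / M) * \sum_i a i.
    by rewrite ler_pM2l// mulr_gt0.
  have -> : (1 - 2 * th) * (m ^+ 2 / M) = 2 * (m / M) * (m * (1 - th)) - m ^+ 2 / M.
    by ring.
  move: h; rewrite DE; set u := 2 * (m / M) * (m * _); set v := 2 * (m / M) * _.
  by lra.
have c0 : g / 2 <= g * (1 - 8 * d ^+ 2) by rewrite ler_pM2l//; lra.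
have cp : 0 < g * (1 - 8 * d ^+ 2) by apply: lt_le_trans c0; rewrite divr_gt0.
have : g * (1 - 8 * d ^+ 2) * (D + e + (1 - 2 * th) * (m ^+ 2 / M)) <=
       g * (1 - 8 * d ^+ 2) * \sum_i a i ^+ 2 by rewrite ler_pM2l.
have : g / 2 * (D + e) <= g * (1 - 8 * d ^+ 2) * (D + e).
  by apply: ler_wpM2r => //; rewrite addr_ge0.
have gm : 0 <= g * (m ^+ 2 / M) by rewrite mulr_ge0 ?divr_ge0 ?sqr_ge0// ltW.
have : g * (m ^+ 2 / M) * (1 - (8 * d ^+ 2 + 2 * th)) <=
    g * (1 - 8 * d ^+ 2) * ((1 - 2 * th) * (m ^+ 2 / M)).
  have -> : g * (1 - 8 * d ^+ 2) * ((1 - 2 * th) * (m ^+ 2 / M)) =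
    g * (m ^+ 2 / M) * ((1 - 8 * d ^+ 2) * (1 - 2 * th)) by ring.
  apply: ler_wpM2l => //; have : 0 <= d ^+ 2 * th by rewrite mulr_ge0 ?sqr_ge0.
  by lra.
have : m ^+ 2 * (eta + g / M * (8 * d ^+ 2 + 2 * th)) <= m ^+ 2 * om.
  by rewrite ler_pM2l// exprn_gt0.
have -> : m ^+ 2 * (eta + g / M * (8 * d ^+ 2 + 2 * th)) = m ^+ 2 * (g / M + eta) -
   g * (m ^+ 2 / M) * (1 - (8 * d ^+ 2 + 2 * th)) by field; exact: lt0r_neq0.
move=> h1 h2 h3 h4.
have main : g / 2 * (D + e) + w <= m ^+ 2 * om.
  rewrite [X in X <= _]mulrDr in h4.
  set G := g * (1 - 8 * d ^+ 2) in ea h2 h3 h4 *.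
  clearbody G; lra.
have gD : 0 <= g / 2 * D by rewrite mulr_ge0// divr_ge0// ltW.
have ge : 0 <= g / 2 * e by rewrite mulr_ge0// divr_ge0// ltW.
rewrite mulrDr in main.
split; last 2 first.
- by lra.
- move=> i; have : (a i - m / M) ^+ 2 <= D.
    by rewrite /D (bigD1 i)//= lerDl; apply: sumr_ge0 => j _; exact: sqr_ge0.
  move=> h; have : g / 2 * (a i - m / M) ^+ 2 <= m ^+ 2 * om.
    apply: (@le_trans _ _ (g / 2 * D)); last by lra.
    by rewrite ler_pM2l// divr_gt0.
  have -> : 2 * om / g * m ^+ 2 = (g / 2)^-1 * (m ^+ 2 * om).
    by field; exact: lt0r_neq0.
  by rewrite ler_pdivlMl// divr_gt0.
apply/eqP; rewrite eqn_leq nN leqNgt; apply/negP => nlt.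
have n1 := nM1 nlt.
have : (m / M) ^+ 2 <= e by rewrite /e ler_peMl// sqr_ge0.
move=> he; have : g / 2 * (m / M) ^+ 2 <= m ^+ 2 * om.
  apply: (@le_trans _ _ (g / 2 * e)); last by lra.
  by rewrite ler_pM2l// divr_gt0.
have -> : g / 2 * (m / M) ^+ 2 = m ^+ 2 * (g / (2 * M ^+ 2)).
  by field; exact: lt0r_neq0.
by rewrite ler_pM2l ?exprn_gt0// leNgt og.
Qed.

End cluster_arithmetic.

Section concentration.
Local Open Scope ereal_scope.
Context (R : realType) (N : nat) (alpha beta : R).
Local Notation V := 'rV[R]_N.
Hypotheses (ba : (beta < alpha)%R) (b2 : (2 <= beta)%R) (a4 : (4 <= alpha)%R).
Hypothesis abn : (alpha, beta) <> (4, 2)%R.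
Hypothesis N0 : (0 < N)%N.
Local Notation gam := (wdepth alpha beta).
Local Notation pairpot := (@pairpot R N alpha beta).
Local Notation interaction := (@interaction R N alpha beta).
Local Notation tail_potential := (@tail_potential R N alpha beta).
Variable Delta : 'I_N.+1 -> V.
Hypothesis D1 : unit_simplex Delta.
Implicit Types (h : V -> R) (m : R).

Lemma tail_potential_transfer h (W X : set V) (A : R) (y z : V) : weight h ->
  measurable W -> measurable X -> W `<=` X -> (0 < A)%R ->
  (forall r s, 0 <= r -> 0 <= s -> r <= s + 1 ->
    profile alpha beta r <= A * (1 + profile alpha beta s))%R ->
  (enorm (y - z) <= 1)%R ->
  tail_potential h X y <= A%:E * (mass h (~` W) + tail_potential h W z).
Proof.
move=> wh mW mX WX A0 HA yz.
have mI := measurable_indicE (measurableC mW).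
have mt := @measurable_tail R N alpha beta W z mW.
have t0 (B : set V) u v : 0 <= (\1_(~` B) v)%:E * (pairpot u v)%:E.
  by rewrite mule_ge0 ?lee_fin//; exact: pairpot_ge0.
pose F v : \bar R := (\1_(~` W) v)%:E + (\1_(~` W) v)%:E * (pairpot z v)%:E.
have mF : measurable_fun setT F by exact: (emeasurable_funD mI mt).
have F0 v : 0 <= F v by apply: adde_ge0; [rewrite lee_fin|exact: t0].
rewrite /mass -(wintD wh mI mt (indicE_ge0 _) (t0 W z)) -(wintZ wh mF F0 (ltW A0)).
apply: (le_wint wh (@measurable_tail R N alpha beta X y mX)).
- by apply: emeasurable_funM => //; exact: measurable_cst.
- exact: t0.
move=> v; have AF0 : 0 <= A%:E * F v by rewrite mule_ge0// lee_fin ltW.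
have [vX|vX] := pselect (X v).
  by rewrite indicE memNset ?mul0e//=; apply.
have nW : ~ W v by move=> /WX.
have eX : \1_(~` X) v = 1%R :> R by rewrite indicE mem_set.
have eW : \1_(~` W) v = 1%R :> R by rewrite indicE mem_set.
have -> : F v = (1 + pairpot z v)%:E by rewrite /F eW mul1e EFinD.
rewrite eX mul1e -EFinM lee_fin.
apply: HA; try exact: enorm_ge0.
by apply: (le_trans (enorm_trans z y v)); rewrite addrC lerD2l.
Qed.

(** The bound on the tail potential is first obtained at one point of each
    cluster, from the bound on its average over the cluster, and then carried to
    nearby points by [tail_potential_transfer]. *)
Lemma minimizers_concentrate (tau : R) : (0 < tau)%R -> (tau <= 1 / 8)%R ->
  exists2 m0 : R, (0 < m0)%R & forall m h, (0 < m)%R -> (m < m0)%R ->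
  tame_minimizer alpha beta m h ->
  exists (T : V -> V) (x : 'I_N.+1 -> V),
    [/\ rigid_motion T, forall i, T (x i) = Delta i,
        forall i, (m * (N.+1%:R^-1 - tau))%:E <= mass h (eball (x i) tau) &
        forall j z, (enorm (z - x j) <= 1 / 2)%R ->
          tail_potential h (\bigcup_i eball (x i) tau) z <= (tau * m)%:E].
Proof.
move=> tau0 tau8; have g0 := wdepth_gt0 ba b2 a4.
pose M : R := N.+1%:R; have M0 : (0 < M)%R by rewrite ltr0n.
have M1 : (1 <= M)%R by rewrite ler1n.
have [A A0 HA] := profile_doubling ba b2 a4 abn.
(* [om] bounds the excess energy: its first bound forces [N+1] clusters, the
   second one almost equal masses, the third one a small tail potential. *)
pose om := (Num.min (gam / (8 * M ^+ 2)) (Num.min (gam * tau ^+ 2 / 2) (tau / (8 * M * A))))%R.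
have om0 : (0 < om)%R.
  by rewrite !lt_min !divr_gt0 ?mulr_gt0 ?exprn_gt0//.
have omM : (om < gam / (2 * M ^+ 2))%R.
  apply: (@le_lt_trans _ _ (gam / (8 * M ^+ 2))%R); first by rewrite ge_min lexx.
  rewrite ltr_pM2l// ltf_pV2 ?posrE ?mulr_gt0 ?exprn_gt0// ltr_pM2r ?exprn_gt0//; lra.
have omt : (2 * om / gam <= tau ^+ 2)%R.
  have : (om <= gam * tau ^+ 2 / 2)%R by rewrite !ge_min lexx orbT.
  by rewrite ler_pdivrMr//; lra.
have omA : (4 * M * om * A <= tau / 2)%R.
  have : (om <= tau / (8 * M * A))%R by rewrite !ge_min lexx !orbT.
  by rewrite ler_pdivlMr ?mulr_gt0//; lra.
have omM8 : (om <= gam / (8 * M ^+ 2))%R by rewrite ge_min lexx.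
clearbody om.
have t20 : (0 < tau / 2)%R by lra.
have [da da0 Hda] := almost_simplex_aligns D1 t20.
have [db db0 Hdb] := @almost_equidistant_bound R N N0.
(* Below [da] the clusters align with [Delta], below [db] there are at most
   [N+1] of them; the last bound makes the loss [8 d^2] harmless. *)
pose d := (Num.min (Num.min da db) (Num.min (tau / 2) (om * M / (32 * gam))))%R.
have dc0 : (0 < om * M / (32 * gam))%R by rewrite divr_gt0 ?mulr_gt0.
have d0 : (0 < d)%R by rewrite !lt_min da0 db0 t20.
have dda : (d <= da)%R by rewrite !ge_min lexx.
have ddb : (d <= db)%R by rewrite !ge_min lexx !orbT.
have dt : (d <= tau / 2)%R by rewrite !ge_min lexx !orbT.
have dom : (d <= om * M / (32 * gam))%R by rewrite !ge_min lexx !orbT.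
clearbody d.
have d16 : (d ^+ 2 <= 1 / 16)%R by nra.
have dd2 : (gam / M * (8 * d ^+ 2) <= om / 4)%R.
  have : (d ^+ 2 <= d)%R by rewrite expr2 ler_piMl//; clear -d0 dt tau8 ba b2 a4 abn N0 D1; lra.
  move=> h; apply: (@le_trans _ _ (gam / M * (8 * (om * M / (32 * gam))))%R).
    by rewrite ler_pM2l ?divr_gt0//; lra.
  by rewrite le_eqVlt; apply/orP; left; apply/eqP; field; rewrite !lt0r_neq0.
have [c c0 Hc] := profile_gap_bounded_below ba b2 a4 abn d0.
pose K := (1 + M / c)%R.
have K1 : (1 <= K)%R by rewrite /K lerDl divr_ge0// ltW.
(* [z^2] is the relative excess energy that is tolerated, and [th] bounds the
   proportion of the mass outside the clusters. *)
pose z := (Num.min (Num.min 1 (om / 4)) (Num.min (om * M / (8 * gam * K)) (tau / (2 * A * K))))%R.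
have K0 : (0 < K)%R by lra.
have z0 : (0 < z)%R.
  by rewrite !lt_min ltr01 !divr_gt0 ?mulr_gt0.
have z1 : (z <= 1)%R by rewrite !ge_min lexx.
have zo : (z <= om / 4)%R by rewrite !ge_min lexx !orbT.
pose th := (z * K)%R.
have th0 : (0 <= th)%R by rewrite mulr_ge0// ltW.
have tho : (gam / M * (2 * th) <= om / 4)%R.
  have : (z <= om * M / (8 * gam * K))%R by rewrite !ge_min lexx !orbT.
  rewrite ler_pdivlMr ?mulr_gt0// => h.
  rewrite mulrAC ler_pdivrMr// /th; lra.
have thA : (A * th <= tau / 2)%R.
  have : (z <= tau / (2 * A * K))%R by rewrite !ge_min lexx !orbT.
  by rewrite ler_pdivlMr ?mulr_gt0// /th; lra.
clearbody z.
have z2o : (z ^+ 2 + gam / M * (8 * d ^+ 2 + 2 * th) <= om)%R.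
  have z2 : (z ^+ 2 <= z)%R by rewrite expr2 ler_piMl// ltW.
  rewrite mulrDr; apply: (@le_trans _ _ (om / 4 + (om / 4 + om / 4))%R); last by lra.
  by apply: lerD; [exact: le_trans z2 zo|exact: lerD].
clear zo z1 tho dd2 da0 db0 dom dc0 K1 K0.
have eta0 : (0 < z ^+ 2)%R by rewrite exprn_gt0.
have [m0 m00 Hm0] := small_mass_competitor ba b2 a4 abn N0 D1 eta0.
exists m0 => // m h mp mm hmin; have [wh h1 hm hle] := hmin.
have [k [wk k1 km kI]] := Hm0 m mp mm.
have hI : interaction h h <= (m ^+ 2 * (gam / N.+1%:R + z ^+ 2))%:E.
  exact: le_trans (hle k wk k1 km) kI.
have hgap := gap_energy_le ba b2 a4 abn N0 wh hm hI.
have noeq (y : 'I_N.+2 -> V) :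
    ~ forall i j, i != j -> (`|enorm (y i - y j) - 1| < d)%R.
  move=> H; apply: (Hdb y) => i j ij; exact: lt_le_trans (H i j ij) ddb.
have [n [p [nN pp pW]]] := clusters_exist ba b2 a4 abn wh hm mp c0 z0 Hc noeq hgap.
have d4 : (d <= 1 / 4)%R by clear -dt tau8 ba b2 a4 abn N0 D1; lra.
have split := interaction_ge_clusters ba b2 a4 abn wh d4 pp.
pose W := \bigcup_i eball (p i) d; rewrite -/W in pW split.
have mB i : measurable (eball (p i) d) by exact: measurable_eball.
have mW : measurable W by apply: fin_bigcup_measurable; [exact: finite_finset|move=> i _].
have massfin (B : set V) : measurable B -> exists2 b : R, mass h B = b%:E & (0 <= b)%R.
  move=> mB'; have b0 : 0 <= mass h B by exact: mass_ge0.
  exists (fine (mass h B)); last exact: fine_ge0.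
  rewrite fineK// ge0_fin_numE//; apply: (@le_lt_trans _ _ (mass h setT)).
    exact: le_mass.
  by rewrite hm ltry.
pose a i := fine (mass h (eball (p i) d)).
have aE i : mass h (eball (p i) d) = (a i)%:E.
  by rewrite /a; have [b -> _] := massfin _ (mB i).
have mt := measurable_tail_potential ba b2 a4 abn wh mW.
have t0 x : 0 <= tail_potential h W x by exact: tail_potential_ge0.
have mIW := measurable_indicE mW.
have mIB i := measurable_indicE (mB i).
set w' := wint h _ in split.
have w'0 : 0 <= w' by apply: wint_ge0 => // x; rewrite mule_ge0 ?lee_fin.
have sumaE : \sum_i mass h (eball (p i) d) * mass h (eball (p i) d) = (\sum_i a i ^+ 2)%:E.
  by rewrite -sumEFin; apply: eq_bigr => i _; rewrite aE -EFinM expr2.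
rewrite sumaE -EFinM in split.
have [w wE w0] : exists2 w : R, w' = w%:E & (0 <= w)%R.
  exists (fine w'); last exact: fine_ge0.
  rewrite fineK// ge0_fin_numE//; apply: (@le_lt_trans _ _ (interaction h h)).
    apply: le_trans split; rewrite leeDr// lee_fin; apply: mulr_ge0.
      by apply: mulr_ge0; [exact: ltW|clear -d16 ba b2 a4 abn N0 D1; lra].
    by apply: sumr_ge0 => i _; exact: sqr_ge0.
  exact: le_lt_trans hI (ltry _).
have ea := le_trans split hI; rewrite wE -EFinD lee_fin in ea.
have sa : (m * (1 - th) <= \sum_i a i)%R.
  have sumB : mass h W <= (\sum_i a i)%:E.
    rewrite -sumEFin; under eq_bigr do rewrite -aE.
    rewrite /mass -wint_sum//; apply: le_wint => //; first exact: emeasurable_sum.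
    move=> y; rewrite indicE; have [/set_mem[i _ yi]|_] := boolP (y \in W); last first.
      by rewrite sume_ge0.
    by rewrite (bigD1 i)//= indicE mem_set// leeDl// sume_ge0.
  have := mass_setC wh mW; rewrite hm; have [u uE u0] := massfin _ mW.
  have [v vE v0] := massfin _ (measurableC mW).
  rewrite uE lee_fin in sumB; rewrite vE lee_fin in pW.
  rewrite uE vE -EFinD => -[] uv; move: pW; rewrite -/M -/K -/th => pW.
  by rewrite mulrBr mulr1; clear -pW sumB uv ba b2 a4 abn N0 D1; lra.
have [nE wo adev] := cluster_arithmetic nN mp g0 th0 w0 d16 sa ea z2o omM.
subst n.
have adev' i : (`|a i - m / M| <= tau * m)%R.
  rewrite -(@ler_pXn2r _ 2)// ?nnegrE ?mulr_ge0// ?(ltW mp) ?(ltW tau0)//.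
  rewrite real_normK ?num_real//; apply: (le_trans (adev i)).
  by rewrite exprMn ler_pM2r// exprn_gt0.
have [i j ij|T rT HT] := Hda p.
  exact: lt_le_trans (pp i j ij) dda.
have [S [rS TS ST]] := rigid_motion_inv rT.
pose x i := S (Delta i).
have px i : (enorm (p i - x i) < tau / 2)%R.
  by rewrite -(rigid_motion_isometry _ _ rT) /x ST.
have sub i : eball (p i) d `<=` eball (x i) tau.
  move=> y; rewrite /eball/= => yi; apply: le_lt_trans (enorm_trans (p i) _ _) _.
  by have := px i; clear -yi dt ba b2 a4 abn N0 D1; lra.
have mX i : measurable (eball (x i) tau) by exact: measurable_eball.
exists T, x; split => //.
- by move=> i; rewrite /x ST.
- move=> i; apply: (@le_trans _ _ (mass h (eball (p i) d))).
    rewrite aE lee_fin; have := adev' i; rewrite ler_norml -/M => /andP[h2 _].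
    by rewrite mulrBr [(m * tau)%R]mulrC lerBlDr -lerBlDl -lerN2 opprB.
  exact: le_mass.
move=> j y yj.
have [x' x'j tx'] : exists2 x', eball (p j) d x' &
    tail_potential h W x' <= (4 * M * om * m)%:E.
  apply: contrapT => H.
  have Hx x' : eball (p j) d x' -> (4 * M * om * m)%:E <= tail_potential h W x'.
    move=> xj; rewrite leNgt; apply/negP => tl; apply: H; exists x' => //; exact: ltW.
  have q0 : (0 <= 4 * M * om * m)%R.
    by rewrite !mulr_ge0// ltW.
  have : (4 * M * om * m)%:E * mass h (eball (p j) d) <= w'.
    apply: wint_markov => //.
    - exact: emeasurable_funM.
    - by move=> x'; rewrite mule_ge0// lee_fin.
    - move=> x' xj; rewrite indicE mem_set ?mul1e; first exact: Hx.
      by exists j.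
  rewrite aE wE -EFinM lee_fin => h2.
  have aj2 : (m / (2 * M) <= a j)%R.
    have : (`|a j - m / M| <= m / (2 * M))%R.
      have mM0 : (0 <= m / (2 * M))%R by rewrite divr_ge0 ?mulr_ge0// ltW.
      rewrite -(@ler_pXn2r _ 2)// ?nnegrE// real_normK ?num_real//.
      apply: (le_trans (adev j)).
      have -> : ((m / (2 * M)) ^+ 2 = 2 * (gam / (8 * M ^+ 2)) / gam * m ^+ 2)%R.
        by field; rewrite !lt0r_neq0.
      by rewrite ler_pM2r ?exprn_gt0// ler_pM2r ?invr_gt0// ler_pM2l.
    rewrite ler_norml => /andP[h3 _].
    have E : (m / M = m / (2 * M) + m / (2 * M))%R by field; exact: lt0r_neq0.
    by move: h3; rewrite E lerBrDr addrA addNr add0r.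
  have : (4 * M * om * m * (m / (2 * M)) <= m ^+ 2 * om)%R.
    by apply: (le_trans _ (le_trans h2 wo)); apply: ler_wpM2l.
  have -> : (4 * M * om * m * (m / (2 * M)) = 2 * (m ^+ 2 * om))%R.
    by field; exact: lt0r_neq0.
  have : (0 < m ^+ 2 * om)%R by rewrite mulr_gt0// exprn_gt0.
  by move: (m ^+ 2 * om)%R => Z; clear -ba b2 a4 abn N0 D1; lra.
have mX' : measurable (\bigcup_i eball (x i) tau).
  by apply: fin_bigcup_measurable; [exact: finite_finset|move=> i _].
have WX : W `<=` \bigcup_i eball (x i) tau.
  by move=> v [i _ vi]; exists i => //; exact: sub.
have yx' : (enorm (y - x') <= 1)%R.
  apply: (le_trans (enorm_trans (x j) _ _)).
  apply: (@le_trans _ _ (1 / 2 + (tau / 2 + d))%R); last first.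
    by clear -tau8 dt ba b2 a4 abn N0 D1; lra.
  apply: lerD => //; apply: (le_trans (enorm_trans (p j) _ _)).
  by apply: lerD; [rewrite enormB ltW|rewrite enormB; exact: ltW].
apply: (le_trans (tail_potential_transfer wh mW mX' WX A0 HA yx')).
apply: (@le_trans _ _ (A%:E * ((m * th)%:E + (4 * M * om * m)%:E))).
  by apply: lee_wpmul2l; [rewrite lee_fin ltW|exact: leeD].
rewrite -EFinD -EFinM lee_fin.
have -> : (A * (m * th + 4 * M * om * m) = (A * th + 4 * M * om * A) * m)%R by ring.
rewrite ler_pM2r//; clear -thA omA ba b2 a4 abn N0 D1; lra.
Qed.

End concentration.

(** * The potential of a minimizer *)

Section potential_bounds.
Local Open Scope ereal_scope.
Context (R : realType) (N : nat) (alpha beta : R).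
Local Notation V := 'rV[R]_N.
Hypotheses (ba : (beta < alpha)%R) (b2 : (2 <= beta)%R) (a4 : (4 <= alpha)%R).
Hypothesis abn : (alpha, beta) <> (4, 2)%R.
Hypothesis N0 : (0 < N)%N.
Local Notation gam := (wdepth alpha beta).
Local Notation gap := (profile_gap alpha beta).
Local Notation pairpot := (@pairpot R N alpha beta).
Local Notation potential := (@potential R N alpha beta).
Local Notation tail_potential := (@tail_potential R N alpha beta).
Implicit Types (h : V -> R) (m tau : R) (x : 'I_N.+1 -> V).
Local Notation M := (N.+1%:R : R).

Let M0 : (0 < M)%R. Proof. by rewrite ltr0n. Qed.
Let M1 : (1 <= M)%R. Proof. by rewrite ler1n. Qed.
Let sumc (a : R) : (\sum_(i < N.+1) a = M * a)%R.
Proof. by rewrite sumr_const card_ord mulr_natl. Qed.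
Let M2 : (2 <= M)%R. Proof. by rewrite ler_nat. Qed.

Section disjoint_balls.
Variables (x : 'I_N.+1 -> V) (tau : R).
Hypotheses (x1 : unit_simplex x) (tau8 : (tau <= 1 / 8)%R).
Local Notation B := (fun i => eball (x i) tau).

Lemma simplex_balls_disjoint i j y : B i y -> B j y -> i = j.
Proof.
rewrite /eball/= => yi yj; apply/eqP/negPn/negP => ij.
have := enorm_trans y (x i) (x j); rewrite (enormB (x i) y) x1//.
by move: tau8; lra.
Qed.

Let mI i : measurable_fun setT (fun y => (\1_(B i) y)%:E : \bar R).
Proof. by apply: measurable_indicE; exact: measurable_eball. Qed.

Lemma sum_mass_balls h m : weight h -> mass h setT = m%:E ->
  \sum_i mass h (B i) <= m%:E.
Proof.
move=> wh hm; rewrite -hm /mass -wint_sum//; apply: le_wint => //.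
- exact: emeasurable_sum.
- exact: measurable_indicE.
- by move=> y; rewrite sume_ge0.
move=> y; rewrite indicT; have [[i yi]|H] := pselect (exists i, B i y); last first.
  rewrite big1// => i _; rewrite indicE memNset// => yi.
  by apply: H; exists i.
rewrite (bigD1 i)//= big1 ?adde0 ?lee_fin ?indicE ?lern1 ?leq_b1// => j ji.
rewrite indicE memNset// => yj.
by move: ji; rewrite (simplex_balls_disjoint yj yi) eqxx.
Qed.

Lemma potential_ge_balls h z (b : 'I_N.+1 -> R) : weight h ->
  (forall i, 0 <= b i)%R -> (forall i y, B i y -> b i <= pairpot z y)%R ->
  \sum_i (b i)%:E * mass h (B i) <= potential h z.
Proof.
move=> wh b0 bB.
rewrite (eq_bigr (fun i => wint h (fun y => (b i)%:E * (\1_(B i) y)%:E))); last first.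
  by move=> i _; rewrite wintZ.
have mbI i : measurable_fun setT (fun y => (b i)%:E * (\1_(B i) y)%:E).
  exact: emeasurable_funM.
have bI0 i y : 0 <= (b i)%:E * (\1_(B i) y)%:E by rewrite mule_ge0// lee_fin.
rewrite -wint_sum//; apply: le_wint => //.
- exact: emeasurable_sum.
- exact: measurable_pairpot1.
- by move=> y; rewrite sume_ge0.
move=> y; have [[i yi]|H] := pselect (exists i, B i y); last first.
  rewrite big1 ?pairpotE_ge0// => i _; rewrite indicE memNset ?mule0// => yi.
  by apply: H; exists i.
rewrite (bigD1 i)//= big1 ?adde0.
  by rewrite indicE mem_set// mule1 lee_fin; exact: bB.
move=> j ji; rewrite indicE memNset ?mule0// => yj.
by move: ji; rewrite (simplex_balls_disjoint yj yi) eqxx.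
Qed.

Lemma potential_le_balls h z (b : 'I_N.+1 -> R) : weight h ->
  (forall i, 0 <= b i)%R -> (forall i y, B i y -> pairpot z y <= b i)%R ->
  potential h z <= \sum_i (b i)%:E * mass h (B i) + tail_potential h (\bigcup_i B i) z.
Proof.
move=> wh b0 bB.
rewrite (eq_bigr (fun i => wint h (fun y => (b i)%:E * (\1_(B i) y)%:E))); last first.
  by move=> i _; rewrite wintZ.
have mbI i : measurable_fun setT (fun y => (b i)%:E * (\1_(B i) y)%:E).
  exact: emeasurable_funM.
have bI0 i y : 0 <= (b i)%:E * (\1_(B i) y)%:E by rewrite mule_ge0// lee_fin.
have mW : measurable (\bigcup_i B i).
  by apply: fin_bigcup_measurable; [exact: finite_finset|move=> i _; exact: measurable_eball].
have mS : measurable_fun setT (fun y => \sum_i (b i)%:E * (\1_(B i) y)%:E).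
  exact: emeasurable_sum.
have S0 y : 0 <= \sum_i (b i)%:E * (\1_(B i) y)%:E by rewrite sume_ge0.
have mt := @measurable_tail R N alpha beta (\bigcup_i B i) z mW.
have t0 y : 0 <= (\1_(~` \bigcup_i B i) y)%:E * (pairpot z y)%:E.
  by rewrite mule_ge0 ?lee_fin//; exact: pairpot_ge0.
rewrite -wint_sum// -(wintD wh mS mt S0 t0); apply: (le_wint wh).
- exact: measurable_pairpot1.
- exact: emeasurable_funD.
- by move=> y; exact: pairpotE_ge0.
move=> y; have [[i yi]|H] := pselect (exists i, B i y); last first.
  have eW : \1_(~` \bigcup_i B i) y = 1%R :> R.
    by rewrite indicE mem_set// => -[i _ yi]; apply: H; exists i.
  by rewrite eW mul1e leeDr.
apply: (@le_trans _ _ (\sum_i (b i)%:E * (\1_(B i) y)%:E)); last by rewrite leeDl.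
rewrite (bigD1 i)//= indicE mem_set// mule1.
apply: (@le_trans _ _ (b i)%:E); first by rewrite lee_fin; exact: bB.
by rewrite leeDl// sume_ge0.
Qed.

End disjoint_balls.

(** By [simplex_quartic] the quartic parts of the kernel seen from the vertices
    add up to at least [wdepth], which accounts for [m wdepth / (N+1)].  The same
    inequality shows that some distance to a vertex is not close to 1; if it is not
    close to 0 either, the gap adds a fixed amount.  At distance 3 or more from
    some vertex the kernel itself is large at all vertices. *)
Lemma potential_large_away (e : R) : (0 < e)%R -> exists2 k : R, (0 < k)%R &
  exists2 t0 : R, (0 < t0)%R & forall tau x h m z, (0 < tau)%R -> (tau <= t0)%R ->
    unit_simplex x -> weight h -> (0 < m)%R ->
    (forall i, (m * (M^-1 - tau))%:E <= mass h (eball (x i) tau)) ->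
    (forall i, e <= enorm (z - x i))%R ->
    (m * (gam / M + k))%:E <= potential h z.
Proof.
move=> e0; have g0 := wdepth_gt0 ba b2 a4.
pose d := Num.min (e / 2)%R (1 / (8 * M))%R.
have d0 : (0 < d)%R by rewrite lt_min !divr_gt0 ?mulr_gt0.
have de : (d <= e / 2)%R by rewrite ge_min lexx.
have dM : (d * (8 * M) <= 1)%R.
  by rewrite -ler_pdivlMr ?mulr_gt0//; rewrite ge_min lexx orbT.
clearbody d.
have d8 : (d <= 1 / 8)%R.
  have h : (d * 8 <= d * (8 * M))%R by rewrite ler_pM2l// ler_peMr.
  by have := le_trans h dM; lra.
have [c c0 Hc] := profile_gap_bounded_below ba b2 a4 abn d0.
pose k := Num.min (c / (2 * M))%R (gam / 2)%R.
have k0 : (0 < k)%R by rewrite lt_min !divr_gt0 ?mulr_gt0.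
have kc : (k <= c / (2 * M))%R by rewrite ge_min lexx.
have kg : (k <= gam / 2)%R by rewrite ge_min lexx orbT.
clearbody k.
pose D := (176 * gam + c)%R; have D0 : (0 < D)%R by rewrite addr_gt0 ?mulr_gt0.
pose t0 := Num.min (Num.min (1 / 8)%R (1 / (5 * M))%R) (Num.min d (c / (2 * M * D))%R).
have t00 : (0 < t0)%R by rewrite !lt_min d0 !divr_gt0 ?mulr_gt0.
have t8 : (t0 <= 1 / 8)%R by rewrite !ge_min lexx.
have tM : (t0 <= 1 / (5 * M))%R by rewrite !ge_min lexx !orbT.
have td : (t0 <= d)%R by rewrite !ge_min lexx !orbT.
have tc : (t0 <= c / (2 * M * D))%R by rewrite !ge_min lexx !orbT.
clearbody t0.
exists k => //; exists t0 => // tau x h m z tau0 tt x1 wh m0 hx ze.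
have tau8 : (tau <= 1 / 8)%R by exact: le_trans tt t8.
have tMt : (5 * (M * tau) <= 1)%R.
  have : (tau <= 1 / (5 * M))%R by exact: le_trans tt tM.
  by rewrite ler_pdivlMr ?mulr_gt0//; lra.
have w0 : (0 <= M^-1 - tau)%R.
  rewrite subr_ge0 -(ler_pM2l M0) mulfV ?gt_eqF//; lra.
have sumb (b : 'I_N.+1 -> R) : (forall i, 0 <= b i)%R ->
    (m * (M^-1 - tau) * \sum_i b i)%:E <=
    \sum_i (b i)%:E * mass h (eball (x i) tau).
  move=> b0; rewrite mulr_sumr -sumEFin; apply: lee_sum => i _.
  by rewrite mulrC EFinM; apply: lee_wpmul2l; [rewrite lee_fin|exact: hx].
pose r i := enorm (z - x i).
have r0 i : (0 <= r i)%R by exact: enorm_ge0.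
have dist i y : eball (x i) tau y -> (`|enorm (z - y) - r i| < tau)%R.
  rewrite /eball/= => yi; apply: le_lt_trans yi.
  by have := enorm_dist (x i) y z; rewrite (enormB y z) (enormB (x i) z).
(* Far from one vertex means at distance at least 2 from all of them. *)
have [[i ri]|near] := pselect (exists i, (3 <= r i)%R).
  have rk j : (2 <= r j)%R.
    have [->|ji] := eqVneq j i; first by lra.
    by have := enorm_trans (x j) z (x i); rewrite x1// -/(r i) -/(r j); lra.
  apply: le_trans (potential_ge_balls x1 tau8 (z := z) (b := fun=> gam * (25 / 16))%R wh _ _).
  - apply: le_trans (sumb (fun=> gam * (25 / 16))%R _); last first.
      by move=> _; rewrite mulr_ge0// ltW.
    rewrite lee_fin sumc -mulrA ler_pM2l//.
    have -> : ((M^-1 - tau) * (M * (gam * (25 / 16))) = gam * (25 / 16) * (1 - M * tau))%R.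
      by field; exact: lt0r_neq0.
    have : (gam / M <= gam / 2)%R by rewrite ler_pM2l// lef_pV2 ?posrE.
    have : (gam * (4 / 5) <= gam * (1 - M * tau))%R.
      by rewrite ler_pM2l//; move: tMt; lra.
    have -> : (gam * (25 / 16) * (1 - M * tau) = 25 / 16 * (gam * (1 - M * tau)))%R by ring.
    by move: (gam * (1 - M * tau))%R (gam / M)%R => u q; lra.
  - by move=> _; rewrite mulr_ge0// ltW.
  - move=> j y yj; apply: le_trans (profile_ge_quartic ba b2 a4 abn (enorm_ge0 _)).
    rewrite ler_pM2l//; have := dist j y yj; have := rk j.
    set s := enorm (z - y); rewrite ltr_norml => h2 /andP[h3 _].
    have s32 : (3 / 2 <= s)%R by lra.
    have : (9 / 4 <= s ^+ 2)%R by nra.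
    by nra.
have {}near i : (r i < 3)%R by rewrite ltNge; apply/negP => ri; apply: near; exists i.
have quart := simplex_quartic x1 z; rewrite -/M in quart.
(* If all distances were within [2 d] of 1, the sum in [simplex_quartic] would
   be at most [36 M d^2], which is less than 1. *)
have [i0 ri0] : exists i, (2 * d <= `|r i - 1|)%R.
  apply: contrapT => H.
  have {}H i : (`|r i - 1| < 2 * d)%R.
    by rewrite ltNge; apply/negP => ri; apply: H; exists i.
  have : (\sum_i (enorm (z - x i) ^+ 2 - 1) ^+ 2 <= \sum_(i < N.+1) 36 * d ^+ 2)%R.
    apply: ler_sum => i _; rewrite -/(r i).
    have := H i; have := r0 i; move: (r i) => s s0; rewrite ltr_norml => /andP[h2 h3].
    have -> : ((s ^+ 2 - 1) ^+ 2 = (s - 1) ^+ 2 * (s + 1) ^+ 2)%R by ring.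
    have : ((s - 1) ^+ 2 <= 4 * d ^+ 2)%R by nra.
    have : ((s + 1) ^+ 2 <= 9)%R by nra.
    by have := sqr_ge0 (s - 1)%R; have := sqr_ge0 (s + 1)%R; nra.
  rewrite sumc => h2.
  have : (M * (36 * d ^+ 2) < 1)%R.
    have : ((d * (8 * M)) ^+ 2 <= 1)%R by rewrite expr_le1// mulr_ge0 ?mulr_ge0// ltW.
    have -> : ((d * (8 * M)) ^+ 2 = M * d ^+ 2 * 64 * M)%R by ring.
    have : (0 < M * d ^+ 2)%R by rewrite mulr_gt0// exprn_gt0.
    move: (M * d ^+ 2)%R (M2) => u M2'; rewrite [(M * (36 * _))%R]mulrCA; nra.
  by move: quart; lra.
(* The quartic part of the kernel changes by at most [175 gam tau] on a ball of
   radius [tau]; the ball [i0] also gets the lower bound [c] of the gap. *)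
pose b0 i := (gam * ((r i ^+ 2 - 1) ^+ 2 - 175 * tau) + (i == i0)%:R * c)%R.
pose b i := Num.max 0%R (b0 i).
have sb : (gam - 175 * gam * M * tau + c <= \sum_i b i)%R.
  apply: (@le_trans _ _ (\sum_i b0 i)%R); last first.
    by apply: ler_sum => i _; rewrite le_max lexx orbT.
  have e1 : (\sum_i (i == i0 :> 'I_N.+1)%:R = 1 :> R)%R.
    by rewrite (bigD1 i0)//= eqxx big1 ?addr0// => j /negPf ->.
  rewrite big_split/= -[X in (_ <= _ + X)%R]mulr_suml e1 mul1r lerD2r.
  rewrite -mulr_sumr sumrB sumc.
  have : (gam * 1 <= gam * \sum_i (r i ^+ 2 - 1) ^+ 2)%R by rewrite ler_pM2l.
  rewrite mulr1 => h2; rewrite [leRHS](_ : _ =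
    (gam * \sum_i (r i ^+ 2 - 1) ^+ 2 - 175 * gam * M * tau)%R); last by ring.
  by rewrite lerD2r.
apply: le_trans (potential_ge_balls x1 tau8 (z := z) (b := b) wh _ _); last 2 first.
- by move=> i; rewrite le_max lexx.
- move=> i y yi; rewrite ge_max pairpot_ge0//= /b0.
  have -> : pairpot z y = (gam * (enorm (z - y) ^+ 2 - 1) ^+ 2 + gap (enorm (z - y)))%R.
    by rewrite -[pairpot z y]/(profile alpha beta (enorm (z - y))) /profile_gap; ring.
  have := dist i y yi; set s := enorm (z - y); have s0 : (0 <= s)%R by exact: enorm_ge0.
  rewrite ltr_norml => /andP[h2 h3].
  apply: lerD.
    rewrite ler_pM2l//; have := near i; have := r0 i; move: (r i) h2 h3 => q h2 h3 q0 q3.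
    have -> : ((s ^+ 2 - 1) ^+ 2 = (q ^+ 2 - 1) ^+ 2 + (s - q) * ((s + q) * (s ^+ 2 + q ^+ 2 - 2)))%R by ring.
    have : (`|(s + q) * (s ^+ 2 + q ^+ 2 - 2)| <= 175)%R.
      have s4 : (s <= 4)%R by lra.
      rewrite normrM ger0_norm ?addr_ge0//.
      have : (`|s ^+ 2 + q ^+ 2 - 2| <= 25)%R.
        by rewrite ler_norml; apply/andP; split; nra.
      have := normr_ge0 (s ^+ 2 + q ^+ 2 - 2)%R; move: `|_|%R => u u0 u25; nra.
    move: ((s + q) * _)%R => u hu.
    have : (`|(s - q) * u| <= tau * 175)%R.
      by rewrite normrM ler_pM// ler_norml; apply/andP; split; lra.
    by rewrite ler_norml => /andP[+ _]; lra.
  have [ii|_] := eqVneq i i0; last by rewrite mul0r; exact: profile_gap_ge0.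
  rewrite mul1r; apply: Hc.
    by have := ze i; rewrite -/(r i); move: td tt de; lra.
  have h4 := ler_distD s (r i) 1%R.
  have h5 : (`|r i - s| <= d)%R by rewrite ler_norml; apply/andP; split; lra.
  by have := ri0; rewrite -ii; lra.
apply: le_trans (sumb b _); last by move=> i; rewrite le_max lexx.
rewrite lee_fin -mulrA ler_pM2l//.
apply: (@le_trans _ _ ((M^-1 - tau) * (gam - 175 * gam * M * tau + c))%R); last first.
  exact: ler_wpM2l.
have h2 : (tau * D <= c / (2 * M))%R.
  have : (tau <= c / (2 * M * D))%R by exact: le_trans tt tc.
  by rewrite invfM mulrA ler_pdivlMr.
have -> : ((M^-1 - tau) * (gam - 175 * gam * M * tau + c) =
    gam / M + c / M - tau * D + 175 * gam * M * tau ^+ 2)%R.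
  by rewrite /D; field; exact: lt0r_neq0.
have h4 : (0 <= 175 * gam * M * tau ^+ 2)%R by rewrite !mulr_ge0 ?sqr_ge0// ltW.
have h5 : (c / M = c / (2 * M) + c / (2 * M))%R by field; exact: lt0r_neq0.
rewrite h5 -!addrA lerD2l; apply: (le_trans kc); rewrite lerDl.
by rewrite addrA addr_ge0// subr_ge0.
Qed.

End potential_bounds.

Section ball_masses.
Local Open Scope ereal_scope.
Context (R : realType) (N : nat).
Local Notation V := 'rV[R]_N.
Local Notation M := (N.+1%:R : R).

Let M0 : (0 < M)%R. Proof. by rewrite ltr0n. Qed.
Let sumc (a : R) : (\sum_(i < N.+1) a = M * a)%R.
Proof. by rewrite sumr_const card_ord mulr_natl. Qed.

(** The upper bounds come from the lower bounds for the other balls. *)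
Lemma ball_masses (x : 'I_N.+1 -> V) (tau m : R) (h : V -> R) :
  unit_simplex x -> (0 < tau)%R -> (tau <= 1 / 8)%R -> weight h ->
  mass h setT = m%:E -> (0 < m)%R ->
  (forall i, (m * (M^-1 - tau))%:E <= mass h (eball (x i) tau)) ->
  exists p : 'I_N.+1 -> R, [/\ forall i, mass h (eball (x i) tau) = (p i)%:E,
    forall i, (m * (M^-1 - tau) <= p i)%R,
    forall i, (p i <= m * (M^-1 + M * tau))%R & (\sum_i p i <= m)%R].
Proof.
move=> x1 tau0 tau8 wh hm m0 hx.
have massfin i : exists2 p : R, mass h (eball (x i) tau) = p%:E & (m * (M^-1 - tau) <= p)%R.
  have q0 : 0 <= mass h (eball (x i) tau) by exact: mass_ge0.
  have qf : mass h (eball (x i) tau) \is a fin_num.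
    rewrite ge0_fin_numE//; apply: (@le_lt_trans _ _ (mass h setT)).
      by apply: le_mass => //; exact: measurable_eball.
    by rewrite hm ltry.
  by exists (fine (mass h (eball (x i) tau))); rewrite -?lee_fin fineK.
pose p i := fine (mass h (eball (x i) tau)).
have pE i : mass h (eball (x i) tau) = (p i)%:E by rewrite /p; have [q -> _] := massfin i.
have pge i : (m * (M^-1 - tau) <= p i)%R by rewrite /p; have [q -> /=] := massfin i.
have sp : (\sum_i p i <= m)%R.
  rewrite -lee_fin -sumEFin; have := sum_mass_balls x1 tau8 wh hm.
  by under eq_bigr do rewrite pE.
exists p; split=> // j.
have h1 : (\sum_(i < N.+1 | i != j) (m * (M^-1 - tau)) <= \sum_(i < N.+1 | i != j) p i)%R.
    exact: ler_sum.
  have h2 : (\sum_(i < N.+1) (m * (M^-1 - tau)) = m * (M^-1 - tau) +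
     \sum_(i < N.+1 | i != j) (m * (M^-1 - tau)))%R by rewrite (bigD1 j).
  rewrite sumc in h2; rewrite (bigD1 j)//= in sp.
  have h3 : (M * (m * (M^-1 - tau)) = m - M * (m * tau))%R by field; exact: lt0r_neq0.
  rewrite h3 in h2; have h4 : (0 <= m * tau)%R by rewrite mulr_ge0// ltW.
  rewrite mulrDr; rewrite mulrBr in h2 h1; rewrite [(m * (M * tau))%R]mulrCA.
  by move: h1 h2 sp h4; move: (m / M)%R (M * (m * tau))%R => A1 A2; lra.
Qed.

End ball_masses.

Section potential_at_vertex.
Local Open Scope ereal_scope.
Context (R : realType) (N : nat) (alpha beta : R).
Local Notation V := 'rV[R]_N.
Hypotheses (ba : (beta < alpha)%R) (b2 : (2 <= beta)%R) (a4 : (4 <= alpha)%R).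
Hypothesis abn : (alpha, beta) <> (4, 2)%R.
Local Notation gam := (wdepth alpha beta).
Local Notation pairpot := (@pairpot R N alpha beta).
Local Notation potential := (@potential R N alpha beta).
Local Notation tail_potential := (@tail_potential R N alpha beta).
Implicit Types (h : V -> R) (m tau : R) (x : 'I_N.+1 -> V).
Local Notation M := (N.+1%:R : R).

Let M0 : (0 < M)%R. Proof. by rewrite ltr0n. Qed.

(** From the vertex [j] the kernel is about [wdepth] on the ball around [x j],
    of mass about [m / (N+1)], and about 0 on the other balls. *)
Lemma potential_small_near (k : R) : (0 < k)%R -> exists2 rho : R, (0 < rho <= 1 / 2)%R &
  exists2 t0 : R, (0 < t0)%R & forall tau x h m z j, (0 < tau)%R -> (tau <= t0)%R ->
    unit_simplex x -> weight h -> mass h setT = m%:E -> (0 < m)%R ->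
    (forall i, (m * (M^-1 - tau))%:E <= mass h (eball (x i) tau)) ->
    tail_potential h (\bigcup_i eball (x i) tau) z <= (tau * m)%:E ->
    (enorm (z - x j) <= rho)%R ->
    potential h z <= (m * (gam / M + k))%:E.
Proof.
move=> k0; have g0 := wdepth_gt0 ba b2 a4.
pose eta := (k / 3)%R; have eta0 : (0 < eta)%R by rewrite divr_gt0.
have [d d0 Hd] := profile_near1 b2 a4 eta0.
pose u := Num.min (Num.min (1 / 4)%R (d / 4)%R) (eta / 4)%R.
have u0 : (0 < u)%R by rewrite !lt_min !divr_gt0.
have u4 : (u <= 1 / 4)%R by rewrite !ge_min lexx.
have ud : (u <= d / 4)%R by rewrite !ge_min lexx !orbT.
have ue : (u <= eta / 4)%R by rewrite !ge_min lexx !orbT.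
clearbody u.
have gN : (0 < gam * M)%R by rewrite mulr_gt0.
pose t0 := Num.min (Num.min u (1 / 8)%R) (Num.min eta (eta / (gam * M))%R).
have t00 : (0 < t0)%R by rewrite !lt_min u0 eta0 !divr_gt0.
have tu : (t0 <= u)%R by rewrite !ge_min lexx.
have t8 : (t0 <= 1 / 8)%R by rewrite !ge_min lexx !orbT.
have te : (t0 <= eta)%R by rewrite !ge_min lexx !orbT.
have tg : (t0 <= eta / (gam * M))%R by rewrite !ge_min lexx !orbT.
clearbody t0.
exists u; first by rewrite u0/=; lra.
exists t0 => // tau x h m z j tau0 tt x1 wh hm m0 hx htail zj.
have tau8 : (tau <= 1 / 8)%R by exact: le_trans tt t8.
pose b i := ((i == j)%:R * gam + eta)%R.
have b0 i : (0 <= b i)%R by rewrite addr_ge0 ?(ltW eta0)// mulr_ge0 ?(ltW g0).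
have bB i y : eball (x i) tau y -> (pairpot z y <= b i)%R.
  rewrite /eball/= => yi; rewrite /b; have [ij|ij] := eqVneq i j.
    subst i; rewrite mul1r; have h1 : (enorm (z - y) <= u + u)%R.
      apply: (le_trans (enorm_trans (x j) _ _)); apply: lerD => //.
      by rewrite enormB ltW// (lt_le_trans yi)// (le_trans tt).
    have h2 : (enorm (z - y) <= 1)%R by lra.
    apply: le_trans (profile_near0 b2 a4 (enorm_ge0 _) h2) _.
    by rewrite lerD2l; lra.
  rewrite mul0r add0r; apply: Hd; first exact: enorm_ge0.
  have h1 := enorm_dist (x i) y z; have h2 := enorm_dist (x j) z (x i).
  have h3 : (enorm (x j - x i) = 1)%R by rewrite x1// eq_sym.
  rewrite h3 in h2; rewrite (enormB y z) (enormB (x i) z) in h1.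
  have h4 : (tau <= u)%R by exact: le_trans tt tu.
  by move: h1 h2; rewrite !ler_norml ltr_norml => /andP[? ?] /andP[? ?];
    apply/andP; split; lra.
have H := potential_le_balls ba b2 a4 abn (z := z) wh b0 bB.
apply: (le_trans H).
have [p [pE pge ple sp]] := ball_masses x1 tau0 tau8 wh hm m0 hx.
have pj := ple j.
apply: (@le_trans _ _ ((\sum_i b i * p i)%:E + (tau * m)%:E)).
  apply: leeD => //; rewrite -sumEFin; apply: lee_sum => i _.
  by rewrite pE EFinM.
rewrite -EFinD lee_fin.
have -> : (\sum_i b i * p i = gam * p j + eta * \sum_i p i)%R.
  rewrite mulr_sumr (bigD1 j)//= [in RHS](bigD1 j)//= /b eqxx mul1r mulrDl -!addrA.
  congr (_ + (_ + _))%R; apply: eq_bigr => i /negPf ->.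
  by rewrite mul0r add0r.
have h1 : (gam * p j <= gam * (m * (M^-1 + M * tau)))%R by rewrite ler_pM2l.
have h2 : (eta * \sum_i p i <= eta * m)%R by rewrite ler_pM2l.
have h3 : (tau * m <= eta * m)%R by rewrite ler_pM2r// (le_trans tt).
have h4 : (gam * M * tau * m <= eta * m)%R.
  rewrite ler_pM2r// mulrC -ler_pdivlMr//; exact: le_trans tt tg.
have E1 : (gam * (m * (M^-1 + M * tau)) = m * (gam / M) + gam * M * tau * m)%R by ring.
have E2 : (m * (gam / M + k) = m * (gam / M) + (eta * m + eta * m + eta * m))%R.
  by rewrite /eta; field; exact: lt0r_neq0.
rewrite E2; rewrite E1 in h1.
move: h1 h2 h3 h4; move: (gam * p j)%R (m * (gam / M))%R (gam * M * tau * m)%R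
  (eta * m)%R (tau * m)%R => A1 A2 A3 A4 A5; lra.
Qed.

End potential_at_vertex.

(** * Second differences of the kernel *)

Section kernel_convexity.
Context (R : realType) (N : nat) (alpha beta : R).
Hypotheses (ba : beta < alpha) (b2 : 2 <= beta) (a4 : 4 <= alpha).
Hypothesis abn : (alpha, beta) <> (4, 2).
Local Notation V := 'rV[R]_N.
Local Notation f := (profile alpha beta).
Local Notation kap := (curv1 alpha beta).
Implicit Types (a b e : V) (s t : R).

Lemma sqr_gap_conv t (A B W : R) :
  (t * A + (1 - t) * B - t * (1 - t) * W) ^+ 2 =
  t * A ^+ 2 + (1 - t) * B ^+ 2 -
    t * (1 - t) * ((A - B) ^+ 2 + 2 * W * (t * A + (1 - t) * B) - t * (1 - t) * W ^+ 2).
Proof. by ring. Qed.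

Lemma dotv_subD a b : dotv (a - b) (a + b) = enorm a ^+ 2 - enorm b ^+ 2.
Proof. by rewrite !sqr_enorm !dotvE (dotvC b a); ring. Qed.

Lemma cross_gap_ge a b e (r : R) : enorm e = 1 -> enorm (a + b - 2 *: e) <= r ->
  4 * dotv (a - b) e ^+ 2 - 4 * r * enorm (a - b) ^+ 2 <=
  (enorm a ^+ 2 - enorm b ^+ 2) ^+ 2.
Proof.
move=> e1 abr; rewrite -dotv_subD.
have -> : a + b = 2 *: e + (a + b - 2 *: e) by rewrite [RHS]addrC subrK.
rewrite dotvDr dotvZr; set p := dotv _ e; set q := dotv _ _; set v := enorm (a - b).
have v0 : 0 <= v by exact: enorm_ge0.
have pv : `|p| <= v by rewrite -[leRHS]mulr1 -e1; exact: ler_norm_dotv.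
have qv : `|q| <= v * r.
  by apply: le_trans (ler_norm_dotv _ _) _; exact: ler_wpM2l.
have : `|p * q| <= v * (v * r) by rewrite normrM; apply: ler_pM.
rewrite ler_norml => /andP[+ _]; have := sqr_ge0 q.
have -> : (2 * p + q) ^+ 2 = 4 * p ^+ 2 + 4 * (p * q) + q ^+ 2 by ring.
have -> : 4 * r * v ^+ 2 = 4 * (v * (v * r)) by ring.
by move: (p * q) (v * (v * r)) (q ^+ 2) (p ^+ 2) => A B C D; lra.
Qed.

Let sqr_small (w e : R) : 0 <= w -> w <= 4 * e -> e <= 1 / 16 -> w ^+ 2 <= e.
Proof. by nra. Qed.

Let combine_gap (q1 q2 q3 q4 q5 : R) : - 5 * q1 <= q2 -> q3 <= q1 -> 0 <= q1 ->
  4 * q5 - 16 * q1 <= q4 -> 4 * q5 - 40 * q1 <= q4 + 2 * q2 - q3.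
Proof. by lra. Qed.

Let slack_bound (q s : R) : q <= s / 40 -> 20 * q <= s / 2.
Proof. by lra. Qed.

Let combine_far (K S t A B a b u G w P Q fc fa fb : R) :
  fc - K * (t * A + (1 - t) * B - u * G) + S * (t * a + (1 - t) * b - u * w) <=
    t * (fa - K * A + S * a) + (1 - t) * (fb - K * B + S * b) ->
  K * u * (P - Q) <= K * u * G -> K * u * Q <= u * (S * w) ->
  fc + K * u * P <= t * fa + (1 - t) * fb + (u * (S * w) + u * (S * w)).
Proof. by lra. Qed.

(** The second difference is computed without derivatives.  The profile is the
    sum of the function of [profile_cvx_near1], which is convex when composed with the
    norm, and of polynomials whose second differences are exact
    ([sqr_gap_conv], [sqr_enorm_conv]).  The main term is
    [(|a|^2 - |b|^2)^2 = ((a - b).(a + b))^2], where [a + b] is about [2 e]. *)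
Lemma kernel_convex_far s : 0 < s -> exists2 e0 : R, 0 < e0 &
  forall (xi xj y z z' : V) t, enorm (xj - xi) = 1 -> enorm (y - xi) <= e0 ->
    enorm (z - xj) <= e0 -> enorm (z' - xj) <= e0 -> 0 <= t <= 1 ->
    f (enorm (t *: z + (1 - t) *: z' - y)) +
      t * (1 - t) * (2 * kap * dotv (z - z') (xj - xi) ^+ 2) <=
    t * f (enorm (z - y)) + (1 - t) * f (enorm (z' - y)) +
      t * (1 - t) * (s * enorm (z - z') ^+ 2).
Proof.
move=> s0; have k0 := curv1_gt0 ba.
have s20 : 0 < s / 2 by rewrite divr_gt0.
have [d /andP[d0 d12] [Hc Hn]] := profile_cvx_near1 b2 a4 s20.
pose e0 := Num.min (d / 2) (Num.min (1 / 16) (s / (40 * kap))).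
have e00 : 0 < e0.
  have ks : 0 < s / (40 * kap) by rewrite divr_gt0// mulr_gt0.
  by rewrite !lt_min ks divr_gt0//= divr_gt0.
have ed : e0 <= d / 2 by rewrite ge_min lexx.
have e8 : e0 <= 1 / 16 by rewrite !ge_min lexx orbT.
have ek : kap * e0 <= s / 40.
  have : e0 <= s / (40 * kap) by rewrite !ge_min lexx !orbT.
  have p0 : 0 < 40 * kap by rewrite mulr_gt0.
  rewrite (ler_pdivlMr _ _ p0) => q; rewrite ler_pdivlMr//.
  by apply: le_trans q; rewrite mulrAC mulrC [kap * 40]mulrC.
clearbody e0; exists e0 => // xi xj y z z' t exy yi zj zj' /andP[t0 t1].
pose a := z - y; pose b := z' - y; pose e := xj - xi.
have cE : t *: z + (1 - t) *: z' - y = t *: a + (1 - t) *: b.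
  by apply/rowP => k; rewrite !mxE; ring.
have vE : z - z' = a - b by apply/rowP => k; rewrite !mxE; ring.
rewrite cE vE -/a -/b -/e.
have ae : enorm (a - e) <= 2 * e0.
  have -> : a - e = (z - xj) - (y - xi) by rewrite /a /e; apply/rowP => k; rewrite !mxE; ring.
  by apply: (le_trans (enormD _ _)); rewrite enormN; lra.
have be : enorm (b - e) <= 2 * e0.
  have -> : b - e = (z' - xj) - (y - xi) by rewrite /b /e; apply/rowP => k; rewrite !mxE; ring.
  by apply: (le_trans (enormD _ _)); rewrite enormN; lra.
have e1 : enorm e = 1 by exact: exy.
clearbody a b e.
have near c : enorm (c - e) <= 2 * e0 -> 1 - d <= enorm c <= 1 + d /\
    `|enorm c ^+ 2 - 1| <= 5 * e0.
  move=> ce; 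
  have h1 := enorm_trans 0 c e; have h2 := enorm_trans e c 0; have h3 := enorm_trans c e 0.
  rewrite !subr0 e1 in h2 h3; rewrite enormB in h3.
  have c0 := enorm_ge0 c; have lo : 1 - 2 * e0 <= enorm c by lra.
  have hi : enorm c <= 1 + 2 * e0 by lra.
  split; first by apply/andP; split; lra.
  by rewrite ler_norml; apply/andP; split; nra.
have [ad aq] := near _ ae; have [bd bq] := near _ be.
have ce : enorm (t *: a + (1 - t) *: b - e) <= 2 * e0.
  have -> : t *: a + (1 - t) *: b - e = t *: (a - e) + (1 - t) *: (b - e).
    by apply/rowP => k; rewrite !mxE; ring.
  apply: le_trans (enorm_conv _ _ _) _; first by rewrite t0 t1.
  have h1 := ler_wpM2l t0 ae; have t1' : 0 <= 1 - t by rewrite subr_ge0.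
  have h2 := ler_wpM2l t1' be; apply: le_trans (lerD h1 h2) _.
  by rewrite -mulrDl addrC subrK mul1r.
have [/andP[cd1 cd2] _] := near _ ce.
have tt : 0 <= t <= 1 by rewrite t0 t1.
have conv := Hc _ _ _ ad bd tt.
have le1 := enorm_conv a b tt.
have le2 : t * enorm a + (1 - t) * enorm b <= 1 + d.
  have [/andP[_ a2] /andP[_ b2']] := (ad, bd); have t1' : 0 <= 1 - t by rewrite subr_ge0.
  have h1 := ler_wpM2l t0 a2; have h2 := ler_wpM2l t1' b2'.
  apply: le_trans (lerD h1 h2) _; rewrite -mulrDl addrC subrK mul1r//.
have mono := le_trans (Hn _ _ cd1 le1 le2) conv.
have sqc := sqr_enorm_conv t a b.
set c2 := enorm (t *: a + (1 - t) *: b) in mono sqc *.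
set W := enorm (a - b) in sqc *.
pose A := enorm a ^+ 2 - 1; pose B := enorm b ^+ 2 - 1.
have gE : c2 ^+ 2 - 1 = t * A + (1 - t) * B - t * (1 - t) * W ^+ 2.
  by rewrite sqc /A /B; ring.
have W1 : W ^+ 2 <= e0.
  have : W <= 4 * e0.
    apply: le_trans (enorm_trans e a b) _; rewrite (enormB e b).
    have -> : 4 * e0 = 2 * e0 + 2 * e0 by ring.
    exact: lerD.
  by move=> W4; exact: (sqr_small (enorm_ge0 _) W4 e8).
have cross : 4 * dotv (a - b) e ^+ 2 - 16 * e0 * W ^+ 2 <= (A - B) ^+ 2.
  have -> : A - B = enorm a ^+ 2 - enorm b ^+ 2 by rewrite /A /B; ring.
  have := @cross_gap_ge a b e (4 * e0) e1; rewrite -/W.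
  have -> : 4 * (4 * e0) = 16 * e0 by ring.
  apply; have -> : a + b - 2 *: e = (a - e) + (b - e).
    by apply/rowP => k; rewrite !mxE; ring.
  have -> : 4 * e0 = 2 * e0 + 2 * e0 by ring.
  by apply: le_trans (enormD _ _) _; exact: lerD.
pose u := t * (1 - t); have u0 : 0 <= u by rewrite mulr_ge0// subr_ge0.
have u1 : u <= 1 by rewrite /u mulr_ile1 ?subr_ge0// gerBl.
have W0 : 0 <= W ^+ 2 by rewrite sqr_ge0.
have mixed : - (5 * e0) <= t * A + (1 - t) * B.
  move: aq bq; rewrite !ler_norml -/A -/B => /andP[A1 _] /andP[B1 _].
  have t1' : 0 <= 1 - t by rewrite subr_ge0.
  have h1 := ler_wpM2l t0 A1; have h2 := ler_wpM2l t1' B1.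
  have := lerD h1 h2; rewrite -mulrDl [t + _]addrC subrK mul1r//.
pose G := (A - B) ^+ 2 + 2 * W ^+ 2 * (t * A + (1 - t) * B) - u * (W ^+ 2) ^+ 2.
have GE : (c2 ^+ 2 - 1) ^+ 2 = t * A ^+ 2 + (1 - t) * B ^+ 2 - u * G.
  by rewrite gE sqr_gap_conv.
have Gge : 4 * dotv (a - b) e ^+ 2 - 40 * e0 * W ^+ 2 <= G.
  have h1 := ler_wpM2l W0 mixed.
  have h2 : u * (W ^+ 2) ^+ 2 <= e0 * W ^+ 2.
    have : (W ^+ 2) ^+ 2 <= e0 * W ^+ 2 by rewrite expr2 ler_wpM2r.
    have : u * (W ^+ 2) ^+ 2 <= 1 * (W ^+ 2) ^+ 2 by rewrite ler_wpM2r// sqr_ge0.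
    by rewrite mul1r => ? ?; apply: le_trans; eassumption.
  have h3 : 0 <= e0 * W ^+ 2 by rewrite mulr_ge0// ltW.
  rewrite /G; move: h1 h2 h3 cross.
  have -> : W ^+ 2 * - (5 * e0) = - 5 * (e0 * W ^+ 2) by ring.
  have -> : 16 * e0 * W ^+ 2 = 16 * (e0 * W ^+ 2) by ring.
  have -> : 40 * e0 * W ^+ 2 = 40 * (e0 * W ^+ 2) by ring.
  have -> : 2 * W ^+ 2 * (t * A + (1 - t) * B) = 2 * (W ^+ 2 * (t * A + (1 - t) * B)) by ring.
  exact: combine_gap.
clearbody G; have final : kap / 2 * u * (4 * dotv (a - b) e ^+ 2 - 40 * e0 * W ^+ 2) <= kap / 2 * u * G.
  by rewrite ler_wpM2l// mulr_ge0// divr_ge0// ltW.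
have slack : kap / 2 * u * (40 * e0 * W ^+ 2) <= u * (s / 2 * W ^+ 2).
  have -> : kap / 2 * u * (40 * e0 * W ^+ 2) = u * (20 * (kap * e0) * W ^+ 2) by field.
  apply: ler_wpM2l => //; apply: ler_wpM2r => //.
  exact: slack_bound.
rewrite -/u; rewrite GE -/A -/B sqc -/u in mono.
have E1 : u * (2 * kap * dotv (a - b) e ^+ 2) = kap / 2 * u * (4 * dotv (a - b) e ^+ 2).
  by field.
have E2 : u * (s * W ^+ 2) = u * (s / 2 * W ^+ 2) + u * (s / 2 * W ^+ 2) by field.
rewrite E1 E2; exact: combine_far mono final slack.
Qed.

Let combine_near (s t a b w fc fa fb : R) :
  fc + s * (t * a + (1 - t) * b - t * (1 - t) * w) <=
    t * (fa + s * a) + (1 - t) * (fb + s * b) ->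
  fc <= t * fa + (1 - t) * fb + t * (1 - t) * (s * w).
Proof. by lra. Qed.

(** The profile may fail to be convex at 0, but it loses less than the
    curvature [kap] that the other vertices provide. *)
Lemma kernel_convex_near : exists2 s : R, 0 < s < kap &
  exists2 e0 : R, 0 < e0 &
  forall (xj y z z' : V) t, enorm (y - xj) <= e0 ->
    enorm (z - xj) <= e0 -> enorm (z' - xj) <= e0 -> 0 <= t <= 1 ->
    f (enorm (t *: z + (1 - t) *: z' - y)) <=
    t * f (enorm (z - y)) + (1 - t) * f (enorm (z' - y)) +
      t * (1 - t) * (s * enorm (z - z') ^+ 2).
Proof.
have [s sk [d d0 [Hc Hn]]] := profile_cvx_near0 ba b2 a4 abn.
exists s => //; exists (d / 2) => [|xj y z z' t yj zj zj' tt].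
  by rewrite divr_gt0.
have /andP[t0 t1] := tt.
pose a := z - y; pose b := z' - y.
have cE : t *: z + (1 - t) *: z' - y = t *: a + (1 - t) *: b.
  by apply/rowP => k; rewrite !mxE; ring.
have vE : z - z' = a - b by apply/rowP => k; rewrite !mxE; ring.
rewrite cE vE -/a -/b.
have dist c : enorm (c - xj) <= d / 2 -> 0 <= enorm (c - y) <= d.
  move=> cj; rewrite enorm_ge0/=; have := enorm_trans xj c y.
  by rewrite (enormB xj y); lra.
have ad := dist _ zj; have bd := dist _ zj'; rewrite -/a -/b in ad bd.
have conv := Hc _ _ _ ad bd tt.
have le1 := enorm_conv a b tt.
have le2 : t * enorm a + (1 - t) * enorm b <= d.
  have [/andP[_ a2] /andP[_ b2']] := (ad, bd); have t1' : 0 <= 1 - t by rewrite subr_ge0.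
  have h1 := ler_wpM2l t0 a2; have h2 := ler_wpM2l t1' b2'.
  apply: le_trans (lerD h1 h2) _; rewrite -mulrDl addrC subrK mul1r//.
have mono := le_trans (Hn _ _ (enorm_ge0 _) le1 le2) conv.
have sqc := sqr_enorm_conv t a b.
rewrite sqc in mono; exact: combine_near mono.
Qed.

End kernel_convexity.

(** * Strict convexity of the potential *)

Section step_weights.
Local Open Scope ereal_scope.
Context (R : realType) (N : nat) (I : finType).
Local Notation V := 'rV[R]_N.
Variables (A : I -> set V) (b : I -> R).
Hypotheses (mA : forall i, measurable (A i)) (b0 : forall i, (0 <= b i)%R).

Definition step (y : V) : \bar R := \sum_i (b i)%:E * (\1_(A i) y)%:E.

Let term0 i y : 0 <= (b i)%:E * (\1_(A i) y)%:E.
Proof. by rewrite mule_ge0 ?lee_fin// b0. Qed.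

Let mterm i : measurable_fun setT (fun y => (b i)%:E * (\1_(A i) y)%:E).
Proof. by apply: emeasurable_funM => //; exact: measurable_indicE. Qed.

Lemma step_ge0 y : 0 <= step y.
Proof. by apply: sume_ge0 => i _; exact: term0. Qed.

Lemma measurable_step : measurable_fun setT step.
Proof. exact: emeasurable_sum. Qed.

Lemma wint_step h (p : I -> R) : weight h ->
  (forall i, mass h (A i) = (p i)%:E) -> wint h step = (\sum_i b i * p i)%:E.
Proof.
move=> wh hp; rewrite /step wint_sum// -sumEFin; apply: eq_bigr => i _.
rewrite wintZ//; first by rewrite -[wint h _]/(mass h (A i)) hp -EFinM.
exact: measurable_indicE.
Qed.

Lemma step_disjoint i y : A i y -> (forall j, A j y -> j = i) -> step y = (b i)%:E.
Proof.
move=> yi dis; rewrite /step (bigD1 i)//= big1 ?adde0.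
  have -> : \1_(A i) y = 1%R :> R by rewrite indicE mem_set.
  by rewrite mule1.
move=> j ji; have -> : \1_(A j) y = 0%R :> R.
  by rewrite indicE memNset// => /dis ij; rewrite ij eqxx in ji.
by rewrite mule0.
Qed.

End step_weights.

Section strict_convexity.
Local Open Scope ereal_scope.
Context (R : realType) (N : nat) (alpha beta : R).
Local Notation V := 'rV[R]_N.
Local Notation mu := (lebesgue_rV R N).
Hypotheses (ba : (beta < alpha)%R) (b2 : (2 <= beta)%R) (a4 : (4 <= alpha)%R).
Hypothesis abn : (alpha, beta) <> (4, 2)%R.
Local Notation pairpot := (@pairpot R N alpha beta).
Local Notation potential := (@potential R N alpha beta).
Local Notation kap := (curv1 alpha beta).
Local Notation M := (N.+1%:R : R).

Let M0 : (0 < M)%R. Proof. by rewrite ltr0n. Qed.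
Let M1 : (1 <= M)%R. Proof. by rewrite ler1n. Qed.

Let gain_beats_loss (k s m e c : R) : (0 < s)%R -> (s < k)%R -> (0 < m)%R ->
  (e * (8 * k * M ^+ 2) <= k - s)%R -> c = ((k - s) / (4 * M))%R -> (0 <= e)%R ->
  (s * (m * (M^-1 + M * e)) + c * m < k * (m * (M^-1 - e)))%R.
Proof.
move=> s0 sk m0 he -> e0; have k0 : (0 < k)%R by exact: lt_trans sk.
rewrite -subr_gt0.
have -> : (k * (m * (M^-1 - e)) - (s * (m * (M^-1 + M * e)) + (k - s) / (4 * M) * m) =
  m * (3 * (k - s) - 4 * (e * (k * M + s * M ^+ 2))) / (4 * M))%R.
  by field; exact: lt0r_neq0.
apply: divr_gt0; last by rewrite mulr_gt0.
apply: mulr_gt0 => //.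
have h1 : (k * M <= k * M ^+ 2)%R by rewrite ler_pM2l// expr2 ler_peMr// ltW.
have h2 : (s * M ^+ 2 <= k * M ^+ 2)%R by rewrite ler_wpM2r ?sqr_ge0// ltW.
have h3 : (e * (k * M + s * M ^+ 2) <= e * (2 * (k * M ^+ 2)))%R.
  by apply: ler_wpM2l => //; rewrite mulr_natl mulr2n lerD.
have h4 : (e * (8 * k * M ^+ 2) = 4 * (e * (2 * (k * M ^+ 2))))%R by ring.
rewrite h4 in he; move: h3 he sk.
by move: (e * (k * M + _))%R (e * (2 * _))%R => u1 u2; lra.
Qed.

(** By [simplex_frame] the clusters at the other vertices, of mass about
    [m / (N+1)], increase the second difference by about [kap m |v|^2 / (N+1)]; the
    cluster at the vertex itself decreases it by at most about
    [s m |v|^2 / (N+1)] with [s < kap].  No second derivative of the potential is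
    involved. *)
Lemma potential_strictly_convex : exists2 e0 : R, (0 < e0 <= 1 / 8)%R &
  forall (e m : R) (x : 'I_N.+1 -> V) h j z z' (t P P' : R),
    (0 < e)%R -> (e <= e0)%R -> unit_simplex x ->
    weight h -> mass h setT = m%:E -> (0 < m)%R ->
    (forall i, (m * (M^-1 - e))%:E <= mass h (eball (x i) e)) ->
    {ae mu, forall y, (0 < h y)%R -> exists i, eball (x i) e y} ->
    eball (x j) e z -> eball (x j) e z' -> z != z' -> (0 < t < 1)%R ->
    potential h z = P%:E -> potential h z' = P'%:E ->
    potential h (t *: z + (1 - t) *: z')%R < (t * P + (1 - t) * P')%:E.
Proof.
have k0 := curv1_gt0 ba.
have [s /andP[s0 sk] [e1 e10 near]] := kernel_convex_near N ba b2 a4 abn.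
pose c := ((kap - s) / (4 * M))%R.
have c0 : (0 < c)%R by rewrite divr_gt0 ?mulr_gt0// subr_gt0.
have [e2 e20 far] := kernel_convex_far N ba b2 a4 c0.
have D0 : (0 < 8 * kap * M ^+ 2)%R by rewrite mulr_gt0 ?exprn_gt0// mulr_gt0.
(* Of the difference [kap - s], the choice of [c] uses up a quarter, and the
   deviation of the masses from [m / (N+1)] at most another one. *)
pose e3 := ((kap - s) / (8 * kap * M ^+ 2))%R.
have e30 : (0 < e3)%R by rewrite divr_gt0// subr_gt0.
pose e0 := Num.min (Num.min e1 e2) (Num.min (1 / 8)%R e3).
have e00 : (0 < e0)%R by rewrite !lt_min e10 e20 e30 divr_gt0.
have e01 : (e0 <= e1)%R by rewrite !ge_min lexx.
have e02 : (e0 <= e2)%R by rewrite !ge_min lexx !orbT.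
have e08 : (e0 <= 1 / 8)%R by rewrite !ge_min lexx !orbT.
have e03 : (e0 <= e3)%R by rewrite !ge_min lexx !orbT.
clearbody e0; exists e0; first by rewrite e00.
move=> e m x h j z z' t P P' ep ee x1 wh hm m0 hx supp zj zj' zz' /andP[t0 t1] hP hP'.
have ee1 := le_trans ee e01; have ee2 := le_trans ee e02; have ee8 := le_trans ee e08.
have ee3 := le_trans ee e03; rewrite ler_pdivlMr// in ee3.
have [p [pE pge ple sp]] := ball_masses x1 ep ee8 wh hm m0 hx.
set w := (_ + _)%R; pose v := (z - z')%R; pose u := (t * (1 - t))%R.
have t1' : (0 < 1 - t)%R by rewrite subr_gt0.
have u0 : (0 < u)%R by rewrite mulr_gt0.
have V0 : (0 < enorm v ^+ 2)%R.
  rewrite exprn_gt0// lt0r enorm_ge0 andbT; apply: contra_neq zz' => /enorm_eq0 v0.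
  by apply/eqP; rewrite -subr_eq0; apply/eqP.
pose B i := eball (x i) e; have mB i : measurable (B i) by exact: measurable_eball.
pose q i := (dotv v (x j - x i) ^+ 2)%R.
pose b i := (u * (2 * kap * q i))%R.
pose d i := (u * ((if i == j then s else c) * enorm v ^+ 2))%R.
have b0 i : (0 <= b i)%R.
  by rewrite mulr_ge0 ?(ltW u0)// mulr_ge0 ?sqr_ge0// mulr_ge0// ltW.
have d0 i : (0 <= d i)%R.
  by rewrite mulr_ge0 ?(ltW u0)// mulr_ge0 ?sqr_ge0//; case: ifP => _; exact: ltW.
have mp y : measurable_fun setT (fun y' => (pairpot y y')%:E) by exact: measurable_pairpot1.
have p0 y y' : 0 <= (pairpot y y')%:E by exact: pairpotE_ge0.
have mb := measurable_step b mB; have md := measurable_step d mB.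
have sb0 := step_ge0 B b0; have sd0 := step_ge0 B d0.
have t0' : (0 <= t)%R by exact: ltW.
have t1'' : (0 <= 1 - t)%R by exact: ltW.
have mz y : measurable_fun setT (fun y' => (pairpot y y')%:E) by exact: mp.
have mtz : measurable_fun setT (fun y => t%:E * (pairpot z y)%:E).
  exact: emeasurable_funM.
have mtz' : measurable_fun setT (fun y => (1 - t)%:E * (pairpot z' y)%:E).
  exact: emeasurable_funM.
have tz0 y : 0 <= t%:E * (pairpot z y)%:E by rewrite mule_ge0.
have tz0' y : 0 <= (1 - t)%:E * (pairpot z' y)%:E by rewrite mule_ge0.
have mS : measurable_fun setT (fun y => (1 - t)%:E * (pairpot z' y)%:E + step B d y).
  exact: emeasurable_funD.
have S0 y : 0 <= (1 - t)%:E * (pairpot z' y)%:E + step B d y by rewrite adde_ge0.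
have key : wint h (fun y => (pairpot w y)%:E + step B b y) <=
    wint h (fun y => t%:E * (pairpot z y)%:E + ((1 - t)%:E * (pairpot z' y)%:E + step B d y)).
  apply: le_wint_ae => //.
  - exact: (emeasurable_funD (mp w) mb).
  - exact: (emeasurable_funD mtz mS).
  - by move=> y; exact: (adde_ge0 (p0 w y) (sb0 y)).
  - by move=> y; exact: (adde_ge0 (tz0 y) (S0 y)).
  apply: filterS supp => y sy hy; have [i yi] := sy hy.
  have dis k : B k y -> k = i by move=> yk; exact: (simplex_balls_disjoint x1 ee8 yk yi).
  rewrite (step_disjoint b yi dis) (step_disjoint d yi dis) -!EFinM -!EFinD lee_fin addrA.
  rewrite -[pairpot w y]/(profile alpha beta (enorm (w - y))).
  rewrite -[pairpot z y]/(profile alpha beta (enorm (z - y))).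
  rewrite -[pairpot z' y]/(profile alpha beta (enorm (z' - y))).
  have tt : (0 <= t <= 1)%R by rewrite t0' -subr_ge0.
  have zj1 : (enorm (z - x j) <= e)%R by exact: ltW.
  have zj1' : (enorm (z' - x j) <= e)%R by exact: ltW.
  have yi1 : (enorm (y - x i) <= e)%R by exact: ltW.
  rewrite /b /d /q; have [ij|ij] := eqVneq i j.
    subst i; have -> : dotv v (x j - x j) = 0%R.
      by rewrite subrr -(scale0r 0%R) dotvZr mul0r.
    rewrite expr0n/= !mulr0 addr0.
    exact: near (le_trans yi1 ee1) (le_trans zj1 ee1) (le_trans zj1' ee1) tt.
  apply: far (le_trans yi1 ee2) (le_trans zj1 ee2) (le_trans zj1' ee2) tt.
  by apply: x1; rewrite eq_sym.
have wF : wint h (fun y => (pairpot w y)%:E + step B b y) =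
    potential h w + (\sum_i b i * p i)%:E.
  rewrite -(wint_step mB b0 wh pE); exact: (wintD wh (mp w) mb (p0 w) sb0).
have wz : wint h (fun y => t%:E * (pairpot z y)%:E) = (t * P)%:E.
  by rewrite EFinM -hP; exact: (wintZ wh (mp z) (p0 z) t0').
have wz' : wint h (fun y => (1 - t)%:E * (pairpot z' y)%:E) = ((1 - t) * P')%:E.
  by rewrite EFinM -hP'; exact: (wintZ wh (mp z') (p0 z') t1'').
have wG : wint h (fun y => t%:E * (pairpot z y)%:E +
      ((1 - t)%:E * (pairpot z' y)%:E + step B d y)) =
    (t * P + ((1 - t) * P' + \sum_i d i * p i))%:E.
  have -> : (t * P + ((1 - t) * P' + \sum_i d i * p i))%:E =
    (t * P)%:E + (((1 - t) * P')%:E + (\sum_i d i * p i)%:E) by [].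
  have wS := wintD wh mtz' md tz0' sd0; have wT := wintD wh mtz mS tz0 S0.
  rewrite (wint_step mB d0 wh pE) wz' in wS.
  by rewrite wz wS in wT.
rewrite wF wG in key.
have beat := gain_beats_loss s0 sk m0 ee3 (erefl c) (ltW ep).
have kme : (0 < kap * (m * (M^-1 - e)))%R.
  apply: le_lt_trans beat; apply: addr_ge0; last exact: (mulr_ge0 (ltW c0) (ltW m0)).
  apply: (mulr_ge0 (ltW s0)); apply: (mulr_ge0 (ltW m0)); apply: addr_ge0.
    by rewrite invr_ge0 ltW.
  exact: (mulr_ge0 (ltW M0) (ltW ep)).
have gain : (u * (kap * (m * (M^-1 - e))) * enorm v ^+ 2 <= \sum_i b i * p i)%R.
  have frame := simplex_frame x1 v j.
  have qE i : q i = (dotv v (x i - x j) ^+ 2)%R.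
    by rewrite /q -(opprB (x i)) dotvNr sqrrN.
  have h1 : (u * (2 * kap) * (m * (M^-1 - e)) * \sum_i q i <= \sum_i b i * p i)%R.
    rewrite mulr_sumr; apply: ler_sum => i _.
    have -> : (u * (2 * kap) * (m * (M^-1 - e)) * q i = b i * (m * (M^-1 - e)))%R.
      by rewrite /b; ring.
    exact: ler_wpM2l.
  apply: le_trans h1.
  have -> : (u * (kap * (m * (M^-1 - e))) * enorm v ^+ 2 =
     u * (2 * kap) * (m * (M^-1 - e)) * (enorm v ^+ 2 / 2))%R by field.
  have -> : (u * (2 * kap) * (m * (M^-1 - e)) = 2 * u * (kap * (m * (M^-1 - e))))%R by ring.
  apply: ler_wpM2l; first exact: (mulr_ge0 (mulr_ge0 (ler0n _ _) (ltW u0)) (ltW kme)).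
  by under eq_bigr do rewrite qE.
have loss : (\sum_i d i * p i <=
    u * (s * (m * (M^-1 + M * e)) + c * m) * enorm v ^+ 2)%R.
  have uV : (0 <= u * enorm v ^+ 2)%R by rewrite mulr_ge0 ?sqr_ge0// ltW.
  have pp i : (0 <= p i)%R by rewrite -lee_fin -pE; exact: mass_ge0.
  apply: (@le_trans _ _ (\sum_i (u * enorm v ^+ 2) * ((i == j)%:R * s * p i + c * p i))%R).
    apply: ler_sum => i _; rewrite /d.
    have -> : (u * ((if i == j then s else c) * enorm v ^+ 2) * p i =
      (u * enorm v ^+ 2) * ((if i == j then s else c) * p i))%R by ring.
    apply: ler_wpM2l => //; case: ifP => _; rewrite ?mul1r ?mul0r ?add0r//.
    by rewrite lerDl mulr_ge0// ltW.
  rewrite -mulr_sumr.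
  have -> : (u * (s * (m * (M^-1 + M * e)) + c * m) * enorm v ^+ 2 =
    (u * enorm v ^+ 2) * (s * (m * (M^-1 + M * e)) + c * m))%R by ring.
  apply: ler_wpM2l => //; rewrite big_split/= -mulr_sumr; apply: lerD.
    rewrite (bigD1 j)//= big1 => [|i /negPf ->]; last by rewrite !mul0r.
    by rewrite eqxx mul1r addr0 ler_pM2l.
  by rewrite ler_pM2l.
rewrite -(ltr_pM2l u0) -(ltr_pM2r V0) in beat.
have diff : (\sum_i d i * p i < \sum_i b i * p i)%R.
  exact: le_lt_trans loss (lt_le_trans beat gain).
apply: (@le_lt_trans _ _ (t * P + ((1 - t) * P' + \sum_i d i * p i) - \sum_i b i * p i)%:E).
  by rewrite EFinB leeBrDr.
rewrite lte_fin addrA ltrBlDr.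
by rewrite ltrD2l.
Qed.

End strict_convexity.

(** * Localization of minimizers *)

Section localization.
Local Open Scope ereal_scope.
Context (R : realType) (N : nat) (alpha beta : R).
Local Notation V := 'rV[R]_N.
Local Notation mu := (lebesgue_rV R N).
Hypotheses (ba : (beta < alpha)%R) (b2 : (2 <= beta)%R) (a4 : (4 <= alpha)%R).
Hypothesis abn : (alpha, beta) <> (4, 2)%R.
Hypothesis N0 : (0 < N)%N.
Local Notation gam := (wdepth alpha beta).
Local Notation potential := (@potential R N alpha beta).
Local Notation M := (N.+1%:R : R).
Variable Delta : 'I_N.+1 -> V.
Hypothesis D1 : unit_simplex Delta.

Let M0 : (0 < M)%R. Proof. by rewrite ltr0n. Qed.
Let NR0 : (0 < N%:R :> R)%R. Proof. by rewrite ltr0n. Qed.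

(** A cube at a vertex, of a size that does not depend on [m], lies where the
    potential is below [m (gam / (N+1) + 3 k / 4)].  For small [m] it has measure
    more than [m], so the bathtub level is at most this value, which the potential
    exceeds away from the vertices. *)
Lemma minimizers_localize (eps : R) : (0 < eps)%R -> (eps <= 1 / 8)%R ->
  exists2 m0 : R, (0 < m0)%R & forall m h, (0 < m)%R -> (m < m0)%R ->
  tame_minimizer alpha beta m h ->
  exists (T : V -> V) (x : 'I_N.+1 -> V) (lam : R),
    [/\ rigid_motion T, forall i, T (x i) = Delta i,
        forall i, (m * (M^-1 - eps))%:E <= mass h (eball (x i) eps),
        [set z | potential h z <= lam%:E] `<=` \bigcup_i eball (x i) eps &
        {ae mu, forall z, (potential h z < lam%:E -> h z = 1%R) /\
                          (lam%:E < potential h z -> h z = 0%R)}].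
Proof.
move=> eps0 eps8; have g0 := wdepth_gt0 ba b2 a4.
have [k k0 [t1 t10 far]] := potential_large_away ba b2 a4 abn N0 eps0.
have k20 : (0 < k / 2)%R by rewrite divr_gt0.
have [rho /andP[rho0 rho12] [t2 t20 near]] := potential_small_near N ba b2 a4 abn k20.
pose tau := Num.min (Num.min t1 t2) eps.
have tau0 : (0 < tau)%R by rewrite !lt_min t10 t20.
have taut1 : (tau <= t1)%R by rewrite !ge_min lexx.
have taut2 : (tau <= t2)%R by rewrite !ge_min lexx !orbT.
have taue : (tau <= eps)%R by rewrite !ge_min lexx !orbT.
clearbody tau; have tau8 := le_trans taue eps8.
have [m1 m10 conc] := minimizers_concentrate ba b2 a4 abn N0 D1 tau0 tau8.
pose s := (rho / N%:R)%R; have s0 : (0 < s)%R by rewrite divr_gt0.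
exists (Num.min m1 (s ^+ N)%R); first by rewrite lt_min m10 exprn_gt0.
move=> m h m0; rewrite lt_min => /andP[mm1 ms] hmin.
have [wh h1 hm _] := hmin.
have [T [x [rT TD hx htail]]] := conc m h m0 mm1 hmin.
have x1 : unit_simplex x.
  by move=> i j ij; rewrite -(rigid_motion_isometry _ _ rT) !TD D1.
pose s1 := (m * (gam / M + 3 / 4 * k))%R; pose s2 := (m * (gam / M + k))%R.
have s12 : (s1 < s2)%R.
  by rewrite ltr_pM2l// ltrD2l gtr_pMl// ltr_pdivrMr// mul1r ltr_nat.
have sub2 : [set z | potential h z < s2%:E] `<=` \bigcup_i eball (x i) eps.
  move=> z /= zs; apply: contrapT => H; move: zs; apply/negP; rewrite -leNgt.
  apply: (far tau x h m z) => // i; rewrite leNgt; apply/negP => zi; apply: H.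
  by exists i.
have sub1 : cube (x ord0) s `<=` [set z | potential h z < s1%:E].
  move=> z zc /=; have zr : (enorm (z - x ord0) <= rho)%R.
    have -> : rho = (N%:R * s)%R by rewrite /s mulrC divfK// gt_eqF.
    apply: enorm_le_coord => [|l]; first exact: ltW.
    have /andP[l1 l2] := zc l; rewrite !mxE ger0_norm ?subr_ge0// lerBlDl//.
  apply: (@le_lt_trans _ _ (m * (gam / M + k / 2))%:E).
    apply: (near tau x h m z ord0) => //; apply: (htail ord0).
    exact: le_trans zr rho12.
  by rewrite lte_fin ltr_pM2l// ltrD2l; move: k0; lra.
have mpot := measurable_potential ba b2 a4 abn wh.
have pot0 z : 0 <= potential h z by exact: potential_ge0.
have big : \bigcup_i eball (x i) eps `<=` eball (x ord0) 2.
  move=> z [i _]; rewrite /eball/= => zi.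
  apply: (le_lt_trans (enorm_trans (x i) _ _)).
  have e1 : (enorm (x i - x ord0) <= 1)%R.
    by have [->|ij] := eqVneq i ord0; rewrite ?subrr ?enorm0 ?x1.
  apply: (@lt_le_trans _ _ (eps + 1)%R); first exact: ltr_leD.
  by rewrite -lerBrDr (le_trans eps8)// ler_pdivrMr//; lra.
have [lam [/andP[lam0 lam1] Lm mL]] : exists lam : R, [/\ (0 <= lam <= s1)%R,
    mu [set z | potential h z < lam%:E] <= m%:E
    & m%:E <= mu [set z | potential h z <= lam%:E]].
  apply: (bathtub_level mpot pot0 (ltW m0) s12).
    apply: (@lt_le_trans _ _ (mu (cube (x ord0) s))).
      by rewrite lebesgue_rV_cube ?lte_fin// ltW.
    apply: le_measure => //; rewrite inE; first exact: measurable_cube.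
    exact: measurable_sublevel.
  apply: le_lt_trans (lebesgue_rV_eball_lty (x ord0) 2).
  apply: le_measure; rewrite ?inE; [exact: measurable_sublevel|exact: measurable_eball|].
  exact: subset_trans sub2 big.
have sub : [set z | potential h z <= lam%:E] `<=` \bigcup_i eball (x i) eps.
  move=> z /= zl; apply: sub2 => /=; apply: le_lt_trans zl _.
  by rewrite lte_fin; exact: le_lt_trans lam1 s12.
exists T, x, lam; split=> //; last first.
  apply: (minimizer_bathtub ba b2 a4 abn hmin lam0 _ Lm mL (c := x ord0) (r := 2)).
  exact: subset_trans sub big.
move=> i; apply: (@le_trans _ _ (m * (M^-1 - tau))%:E).
  by rewrite lee_fin ler_pM2l// lerD2l lerN2.
apply: le_trans (hx i) _; apply: le_mass => //; try exact: measurable_eball.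
by move=> z; rewrite /eball/= => zi; exact: lt_le_trans zi taue.
Qed.

End localization.

(** * Convex components *)

Section structure.
Local Open Scope ereal_scope.
Context (R : realType) (N : nat) (alpha beta : R).
Local Notation V := 'rV[R]_N.
Local Notation mu := (lebesgue_rV R N).
Hypotheses (ba : (beta < alpha)%R) (b2 : (2 <= beta)%R) (a4 : (4 <= alpha)%R).
Hypothesis abn : (alpha, beta) <> (4, 2)%R.
Hypothesis N0 : (0 < N)%N.
Local Notation potential := (@potential R N alpha beta).
Local Notation M := (N.+1%:R : R).
Variable Delta : 'I_N.+1 -> V.
Hypothesis D1 : unit_simplex Delta.

Let M0 : (0 < M)%R. Proof. by rewrite ltr0n. Qed.

(** The pieces are the parts of the balls where the potential is below the
    bathtub level.  Strict convexity makes them convex and makes the remaining parts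
    of the level set null; each piece is nonempty because its ball has positive mass. *)
Lemma minimizers_are_convex_clusters (eps : R) : (0 < eps)%R ->
  exists2 m0 : R, (0 < m0)%R & forall m h, (0 < m)%R -> (m < m0)%R ->
  tame_minimizer alpha beta m h ->
  exists (T : V -> V) (C : 'I_N.+1 -> set V),
    [/\ rigid_motion T, forall i, measurable (C i) /\ C i !=set0,
        forall i y z (t : R), C i y -> C i z -> (0 <= t <= 1)%R ->
          C i (t *: y + (1 - t) *: z)%R,
        (forall i z, C i z -> (enorm (T z - Delta i) < eps)%R) /\
          (forall i j z, C i z -> C j z -> i = j) &
        {ae mu, forall z, h z = \1_(\bigcup_i C i) z}].
Proof.
move=> eps0.
have [e1 /andP[e10 e18] convex] := potential_strictly_convex N ba b2 a4 abn.
pose e := Num.min (Num.min eps e1) (1 / (2 * M))%R.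
have e0 : (0 < e)%R by rewrite !lt_min eps0 e10 divr_gt0// mulr_gt0.
have eeps : (e <= eps)%R by rewrite !ge_min lexx.
have ee1 : (e <= e1)%R by rewrite !ge_min lexx !orbT.
have eM : (e <= 1 / (2 * M))%R by rewrite !ge_min lexx !orbT.
clearbody e; have e8 := le_trans ee1 e18.
have Me0 : (0 < M^-1 - e)%R.
  rewrite subr_gt0; apply: le_lt_trans eM _; rewrite div1r ltf_pV2 ?posrE ?mulr_gt0//.
  by rewrite ltr_pMl// ltr1n.
have [m0 m00 loc] := minimizers_localize ba b2 a4 abn N0 D1 e0 e8.
exists m0 => // m h mp mm0 hmin; have [wh h1 hm _] := hmin.
have [T [x [lam [rT TD hx sub rule]]]] := loc m h mp mm0 hmin.
have x1 : unit_simplex x.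
  by move=> i j ij; rewrite -(rigid_motion_isometry _ _ rT) !TD D1.
have dis i j z : eball (x i) e z -> eball (x j) e z -> i = j.
  exact: (simplex_balls_disjoint x1 e8).
have supp : {ae mu, forall y, (0 < h y)%R -> exists i, eball (x i) e y}.
  apply: filterS rule => y [_ hy0] hy; apply: contrapT => H.
  move: hy; rewrite hy0 ?ltxx// ltNge; apply/negP => /sub[i _ yi].
  by apply: H; exists i.
have pot0 z : 0 <= potential h z by exact: potential_ge0.
have potfin z : potential h z <= lam%:E ->
    exists2 P : R, potential h z = P%:E & (P <= lam)%R.
  move=> zl; have zf : potential h z \is a fin_num.
    by rewrite ge0_fin_numE//; exact: le_lt_trans zl (ltry _).
  by exists (fine (potential h z)); rewrite -?lee_fin fineK.
have strict j z z' (t : R) : eball (x j) e z -> eball (x j) e z' -> z != z' ->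
    (0 < t < 1)%R -> potential h z <= lam%:E -> potential h z' <= lam%:E ->
    potential h (t *: z + (1 - t) *: z')%R < lam%:E.
  move=> zj zj' zz' t01 zl zl'; have [P hP Pl] := potfin _ zl.
  have [P' hP' Pl'] := potfin _ zl'.
  apply: lt_le_trans (convex e m x h j z z' t P P' e0 ee1 x1 wh hm mp hx supp
    zj zj' zz' t01 hP hP') _.
  have /andP[t0 t1] := t01; have tp : (0 <= t)%R by exact: ltW.
  have tp' : (0 <= 1 - t)%R by rewrite subr_ge0 ltW.
  rewrite lee_fin (le_trans (lerD (ler_wpM2l tp Pl) (ler_wpM2l tp' Pl')))//.
  by rewrite -mulrDl addrC subrK mul1r.
have mpot := measurable_potential ba b2 a4 abn wh.
pose B i := eball (x i) e; have mB i : measurable (B i) by exact: measurable_eball.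
pose C i := B i `&` [set z | potential h z < lam%:E].
have mC i : measurable (C i) by apply: measurableI => //; exact: measurable_sublevel.
pose L i := B i `&` [set z | potential h z <= lam%:E] `&` ~` [set z | potential h z < lam%:E].
have mL i : measurable (L i).
  apply: measurableI; last by apply: measurableC; exact: measurable_sublevel.
  by apply: measurableI => //; exact: measurable_closed_sublevel.
have L0 i : mu (L i) = 0.
  apply: betweenness_free_null => // y z t [[yi yl] _] [[zi zl] _] yz t01 [_]; apply.
  exact: (strict i y z t yi zi yz t01 yl zl).
have aeL : {ae mu, forall z, forall i, ~ L i z}.
  apply: filter_forall => i; exists (L i); split=> // z /= H.
  by apply: contrapT => nL; apply: H.
have hC : {ae mu, forall z, h z = \1_(\bigcup_i C i) z}.
  apply: filterS2 aeL rule => z zL [hz1 hz0].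
  have [zl|zl] := leP (potential h z) lam%:E; last first.
    rewrite hz0// indicE memNset// => -[i _ [_ /= zl']].
    by move: (lt_trans zl zl'); rewrite ltxx.
  have [i _ zi] := sub z zl.
  have zl' : potential h z < lam%:E by apply: contrapT => H; apply: (zL i).
  by rewrite hz1// indicE mem_set//; exists i.
have CB i z : C i z -> B i z by case.
have neC i : C i !=set0.
  apply/set0P/negP => /eqP Ci0.
  have : mass h (B i) <= wint h (fun=> 0%R%:E).
    apply: (le_wint_ae wh); [exact: measurable_indicE|exact: measurable_cst| | |].
    - by move=> z; exact: indicE_ge0.
    - by [].
    apply: filterS hC => z hz zh; rewrite lee_fin indicE memNset// => zi.
    move: zh; rewrite hz indicE; case: (boolP (z \in _)); last by rewrite ltxx.
    rewrite inE => -[k _ zk] _.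
    have : C i z by rewrite (dis _ _ _ zi (CB _ _ zk)).
    by rewrite Ci0.
  rewrite wint_cst// mul0e leNgt => /negP; apply.
  by apply: lt_le_trans (hx i); rewrite lte_fin mulr_gt0.
exists T, C; split.
- exact: rT.
- by move=> i; split; [exact: mC|exact: neC].
- move=> i y z t [yi yl] [zi zl] t01.
  split; first exact: eball_conv.
  have [->|yz] := eqVneq y z; first by rewrite -scalerDl addrC subrK scale1r.
  have [->|t0] := eqVneq t 0%R; first by rewrite scale0r add0r subr0 scale1r.
  have [->|t1] := eqVneq t 1%R; first by rewrite subrr scale0r addr0 scale1r.
  apply: (strict i y z t yi zi yz _ (ltW yl) (ltW zl)).
  by have /andP[? ?] := t01; rewrite lt_neqAle eq_sym t0 lt_neqAle t1; apply/andP.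
- split=> [i z zi|i j z zi zj]; last exact: dis (CB _ _ zi) (CB _ _ zj).
  rewrite -TD (rigid_motion_isometry _ _ rT); exact: lt_le_trans (CB _ _ zi) eeps.
- exact: hC.
Qed.

End structure.

Theorem theorem3p6 (R : realType) (N : nat) (alpha beta : R)
    (Delta : 'I_N.+1 -> 'rV[R]_N) :
  (2 <= N)%N -> beta < alpha -> 2 <= beta -> 4 <= alpha ->
  (alpha, beta) <> (4, 2) -> regular_simplex Delta ->
  let g := @power_kernel R N alpha beta in
  exists mbar : R, 0 < mbar /\
    (forall (m : R) (h : 'rV[R]_N -> R), 0 < m -> m < mbar ->
       density_minimizer g m h ->
       exists E : set 'rV[R]_N, ae_characteristic h E /\ set_minimizer g m E) /\
    (forall eps : R, 0 < eps ->
       exists meps : R, [/\ 0 < meps, meps <= mbar &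
         forall (m : R) (h : 'rV[R]_N -> R) (E : set 'rV[R]_N),
           0 < m -> m < meps ->
           density_minimizer g m h -> ae_characteristic h E ->
           exists (T : 'rV[R]_N -> 'rV[R]_N)
                  (C : 'I_N.+1 -> set 'rV[R]_N),
             [/\ rigid_motion T,
                 (lebesgue_rV R N).-negligible ((T @` E) `+` \bigcup_i C i),
                 trivIset setT C,
                 forall i, C i !=set0 /\ convex_set (C i) &
                 forall i, C i `<=` eball (Delta i) eps]]).
Proof.
move=> N2 ba b2 a4 abn [_ D1] g; have N0 : (0 < N)%N by exact: leq_trans N2.
have [mbar mbar0 clusters] := minimizers_are_convex_clusters ba b2 a4 abn N0 D1 ltr01.
have mU (C : 'I_N.+1 -> set 'rV[R]_N) : (forall i, measurable (C i)) ->
    measurable (\bigcup_i C i).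
  by move=> mC; apply: fin_bigcup_measurable => //; exact: finite_finset.
exists mbar; split=> //; split.
  move=> m h m0 mm hmin; have [h' [tame hh']] := density_minimizer_tame ba b2 a4 abn hmin.
  have [T [C [_ mC _ _ hC]]] := clusters m h' m0 mm tame.
  have hE : ae_characteristic h (\bigcup_i C i).
    split; first by apply: mU => i; have [] := mC i.
    by apply: filterS2 hh' hC => z ->.
  exists (\bigcup_i C i); split; first exact: hE.
  exact: (set_minimizer_of_density hmin hE).
move=> eps eps0.
have [m1 m10 small] := minimizers_are_convex_clusters ba b2 a4 abn N0 D1 eps0.
exists (Num.min mbar m1); split; [by rewrite lt_min mbar0|by rewrite ge_min lexx|].
move=> m h E m0; rewrite lt_min => /andP[_ mm] hmin [mE hE].
have [h' [tame hh']] := density_minimizer_tame ba b2 a4 abn hmin.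
have [T [C [rT mC cC [CD disC] hC]]] := small m h' m0 mm tame.
have [S [_ TS ST]] := rigid_motion_inv rT.
exists T, (fun i => T @` C i); split.
- exact: rT.
(* The set moved is [E], which agrees with the union of the pieces up to a
   null set; rigid motions preserve null sets. *)
- have nEC : (lebesgue_rV R N).-negligible (E `+` \bigcup_i C i).
    have EC : {ae lebesgue_rV R N, forall z, \1_E z = \1_(\bigcup_i C i) z :> R}.
      by apply: filterS (filterI hE (filterI hh' hC)) => z [<- [-> ->]].
    apply: negligibleS EC => z zEC /=; rewrite !indicE.
    by case: zEC => -[zE zC]; rewrite (mem_set zE) (memNset zC) => /eqP;
      rewrite ?oner_eq0// eq_sym oner_eq0.
  apply: negligibleS (rigid_motion_negligible rT nEC).
  move=> y [[[z zE <-] yC]|[[i _ [z zC <-]] yE]]; exists z => //.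
    by left; split=> // -[i _ zi]; apply: yC; exists i => //; exists z.
  by right; split; [exists i|move=> zE; apply: yE; exists z].
- apply/trivIsetP => i j _ _ ij; rewrite -subset0 => y [[z zi <-] [w wj]].
  by move=> /(can_inj TS) wz; move: ij; rewrite (disC i j z zi) ?eqxx// -wz.
- move=> i; have [_ [z zi]] := mC i; split; first by exists (T z); exists z.
  apply: convex_setP => _ _ t [y yi <-] [w wi <-] t01.
  by exists (t *: y + (1 - t) *: w); [exact: cC|exact: rigid_motion_conv].
- by move=> i _ [z zi <-]; exact: CD.
Qed.
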